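(* Let $r\ge 7$ and let $f=f(x,\mu)$ be a real-valued $C^r$ function defined on a neighbourhood of $(0,0)\in\mathbb{R}\times\mathbb{R}$, regarded as a one-parameter family of maps $x\mapsto f(x,\mu)$. Suppose $f(0,\mu)=0$ for all $\mu$ in a neighbourhood of $0$, and $$f_x(0,0)=-1,\quad \left(3f_{xx}^2+2f_{xxx}\right)\big|_{(0,0)}>0,\quad f_{x\mu}(0,0)<0.$$ Let $$g(y,\nu,a)=-y-\nu y+y^3+a y^5 .$$ There exist a neighbourhood $N$ of $x=0$ and $\mu_0>0$ such that for all $\mu\in(-\mu_0,\mu_0)$ the map $f(\cdot,\mu)$ has one fixed point in $N$ (namely $x=0$, which is stable for $\mu<0$ and unstable for $\mu>0$), and if $\mu\in(0,\mu_0)$ then $f(\cdot,\mu)$ has a stable period-$2$ solution in $N$. Moreover, there exist a neighbourhood $M$ of $y=0$, a $C^1$ function $\nu(\mu)$, and a continuous function $a(\mu)$ with $$\nu(0)=0,\qquad \nu'(0)=-f_{x\mu}(0,0),$$ $$a(0)=\frac{1}{\left(3f_{xx}^2+2f_{xxx}\right)^2}\left(\frac{45}{4}f_{xx}^4+\frac{39}{2}f_{xx}^2f_{xxx}+9f_{xx}f_{xxxx}+\frac{6}{5}f_{xxxxx}\right)\Big|_{(0,0)},$$ such that, with $\tilde g(y,\mu)=g(y,\nu(\mu),a(\mu))$: 1. if $\mu\in(-\mu_0,0)$ then $f|_N$ and $\tilde g|_M$ are $C^{r-1}$-conjugate on $N$; 2. if $\mu=0$ then $f|_N$ is $C^1$-conjugate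 to $\tilde g|_M$; 3. if $\mu\in(0,\mu_0)$ then $f|_N$ and $\tilde g|_M$ are $C^{r-1}$-conjugate on the basins of repulsion of their fixed points, and $C^{r-1}$-conjugate on the basins of attraction of their stable period-$2$ solutions.
   Context: Subscripts denote partial derivatives. For fixed $\mu$, $f|_N$ denotes the map $x\mapsto f(x,\mu)$ restricted to $N$, and $\tilde g|_M$ the map $y\mapsto\tilde g(y,\mu)$ restricted to $M$. Two maps $F:U\to\mathbb{R}$ and $G:V\to\mathbb{R}$ are topologically conjugate if there is a homeomorphism $h:U\to V$ with $h\circ F=G\circ h$ (for restricted maps this relation is understood at points where both sides are defined, i.e. whose image remains in the domain). They are differentiably conjugate if $h$ is a diffeomorphism, and $C^s$-conjugate ($s\ge1$) if the diffeomorphism $h$ is of class $C^s$. The basin of repulsion of an unstable fixed point in a neighbourhood is the set of points of the neighbourhood whose backward orbits stay in the neighbourhood and converge to the fixed point (the maps are locally invertible). The basin of attraction of a stable period-$2$ solution is the set of points of the neighbourhood whose forward orbits stay in the neighbourhood and converge to the period-$2$ orbit; for the period-$2$ solution of $f$ this basin is all of $N\setminus\{0\}$.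
   Formalization: In item 1 and for the basins of attraction in item 3, the conjugacy maps N (resp. N\{0}) onto V (resp. the basin in V), where V may depend on μ and contains a fixed neighbourhood of 0 and lies in M; onto a fixed M (or its basin) fails in general. *)

(* Defs.v *)
From Stdlib Require Import Reals.
From Coquelicot Require Import Coquelicot.
Open Scope R_scope.

(** Families [f x mu] are total functions [R -> R -> R]; only their values near
    [(0,0)] matter. *)

Definition Cr_near_origin (r : nat) (f : R -> R -> R) : Prop :=
  locally_2d (fun x mu => ex_diff_n f r x mu) 0 0.

(** [dx f n] is the [n]-th pure [x]-derivative at the origin. *)
Definition dx (f : R -> R -> R) (n : nat) : R := partial_derive n 0 f 0 0.

Definition open_nbhd (p : R) (N : R -> Prop) : Prop := open N /\ N p.

Definition subset (A B : R -> Prop) : Prop := forall x, A x -> B x.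

(** Used with [U] open, so that the total [Derive_n] is the actual derivative. *)
Definition Cs_on (s : nat) (U : R -> Prop) (h : R -> R) : Prop :=
  forall x, U x ->
    (forall k, (k <= s)%nat -> ex_derive_n h k x) /\
    continuous (Derive_n h s) x.

Definition Cs_diffeo (s : nat) (U V : R -> Prop) (h : R -> R) : Prop :=
  exists k : R -> R,
    (forall x, U x -> V (h x) /\ k (h x) = x) /\
    (forall y, V y -> U (k y) /\ h (k y) = y) /\
    Cs_on s U h /\ Cs_on s V k.

(** Conjugacy of the restricted maps [F|_U] and [G|_V]: the relation is required
    where the image stays in the domain. *)
Definition Cs_conjugate (s : nat) (U V : R -> Prop) (F G : R -> R) : Prop :=
  exists h : R -> R,
    Cs_diffeo s U V h /\
    forall x, U x -> U (F x) -> h (F x) = G (h x).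

Definition lyapunov_stable (F : R -> R) (p : R) : Prop :=
  forall eps : posreal, exists delta : posreal, forall x,
    Rabs (x - p) < delta -> forall n, Rabs (Nat.iter n F x - p) < eps.

Definition stable_fixed_point (F : R -> R) (p : R) : Prop :=
  F p = p /\ lyapunov_stable F p /\
  exists delta : posreal, forall x,
    Rabs (x - p) < delta -> is_lim_seq (fun n => Nat.iter n F x) p.

Definition unstable_fixed_point (F : R -> R) (p : R) : Prop :=
  F p = p /\ ~ lyapunov_stable F p.

Definition stable_period2 (F : R -> R) (N : R -> Prop) (p q : R) : Prop :=
  N p /\ N q /\ p <> q /\ F p = q /\ F q = p /\
  stable_fixed_point (fun x => F (F x)) p /\
  stable_fixed_point (fun x => F (F x)) q.

Definition basin_repulsion (F : R -> R) (N : R -> Prop) (p x : R) : Prop :=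
  exists u : nat -> R,
    u 0%nat = x /\ (forall n, N (u n)) /\ (forall n, F (u (S n)) = u n) /\
    is_lim_seq u p.

Definition basin_attraction2 (F : R -> R) (N : R -> Prop) (p q x : R) : Prop :=
  (forall n, N (Nat.iter n F x)) /\
  is_lim_seq
    (fun n => Rmin (Rabs (Nat.iter n F x - p)) (Rabs (Nat.iter n F x - q))) 0.

Definition g (y nu a : R) : R := - y - nu * y + y ^ 3 + a * y ^ 5.

Definition a_zero (f : R -> R -> R) : R :=
  / (3 * dx f 2 ^ 2 + 2 * dx f 3) ^ 2 *
  (45 / 4 * dx f 2 ^ 4 + 39 / 2 * dx f 2 ^ 2 * dx f 3
   + 9 * dx f 2 * dx f 4 + 6 / 5 * dx f 5).

(* Main.v *)
Require Import Defs.
From Stdlib Require Import Reals Ranalysis5 Lra Lia ClassicalEpsilon.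
From Coquelicot Require Import Coquelicot.
Open Scope R_scope.

(** Near the bifurcation every map of the family is a decreasing diffeomorphism F fixing 0, so
    its dynamics is that of the increasing map A = F o F on each side of 0.  Dividing A(x) - x by
    the quadratic polynomial that carries its first two Taylor coefficients leaves a strictly
    decreasing function on (0, d), uniformly in the parameter ([square_dynamics]).  Hence A has no
    fixed point in (0, d) when F'(0) >= -1, and exactly one, attracting, when F'(0) < -1.  This
    describes the orbits of f, and equally those of the model g.

    The conjugacies away from mu = 0 come from linearization at a hyperbolic fixed point of
    multiplier lam.  A coordinate phi with phi o F = lam phi is found through its nonlinearity
    N = phi''/phi', which solves the linear equation N = F''/F' + F' (N o F) with contracting
    coefficient F' ([Cs_on_lin_sol], [local_linearization]); it extends to the whole basin by
    phi(x) = lam^-n phi(F^n x) ([linearization]).  Two maps with equal multipliers are conjugate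
    by psi^-1 (c phi), and the free constant c is used to send the right end point of N to a
    prescribed point, which keeps the images of N uniformly large ([transport]).  Equality of the
    multipliers at 0 forces nu(mu) = -1 - f_x(0, mu); it gives the conjugacy on N for mu < 0
    ([sink_conjugacy]) and on the basins of repulsion for mu > 0 ([repulsion_conjugacy]).  On the
    basins of attraction one linearizes A at the positive point of the cycle and carries the
    conjugacy to the negative side as G^-1 h F ([side_extension]).

    This last step needs equal multipliers of the cycles, and this determines a(mu): the cycle of
    the odd map g and its multiplier are explicit, so that a(mu) is an explicit function of nu(mu)
    and of the multiplier of the cycle of f ([s_of], [a_of]).  Its limit at mu = 0 is computed
    from the fifth order expansion of f along the cycle ([cycle_parameter_limit]).

    At mu = 0 the map A is tangent to the identity, A(x) = x - ga x^3 + O(x^4) with ga > 0, and a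
    Fatou coordinate phi with phi o A = phi - tau replaces the linearization.  Its derivative is
    e(x) / x^3 with e -> 1, because ln (A'(x) x^3 / A(x)^3) is O(x^3) and therefore summable along
    orbits ([fatou_coordinate]).  This asymptotics makes psi^-1 (c phi + const) a C^1 map up to 0
    with positive derivative ([parabolic_transport]), and its extension by G^-1 h F is C^1 at 0
    because F and G^-1 both have slope -1 there ([parabolic_conjugacy]). *)

Implicit Types (U V : R -> Prop) (h : R -> R) (x y mu : R) (s : nat).

(** * The C^s calculus on open sets of the line *)

Definition itv (a b : R) : R -> Prop := fun x => a < x < b.

Lemma open_itv a b : open (itv a b).
Proof.
  apply (open_and (fun x => a < x) (fun x => x < b)).
  apply open_gt. apply open_lt.
Qed.

Lemma locally_on U (P : R -> Prop) x : open U -> U x -> (forall z, U z -> P z) -> locally x P.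
Proof. intros HU Hx HP. apply (filter_imp U P HP), HU, Hx. Qed.

Lemma is_derive_continuous h x (l : R) : is_derive h x l -> continuous h x.
Proof.
  intros H. apply (@ex_derive_continuous R_AbsRing R_NormedModule). exists l. exact H.
Qed.

Lemma is_derive_ext_on U h (k : R -> R) x (l : R) : open U -> U x -> (forall z, U z -> h z = k z) ->
  is_derive h x l -> is_derive k x l.
Proof. intros HU Hx E. apply is_derive_ext_loc, (locally_on U); assumption. Qed.

Lemma continuous_ext_on U h (k : R -> R) x : open U -> U x -> (forall z, U z -> h z = k z) ->
  continuous h x -> continuous k x.
Proof. intros HU Hx E. apply continuous_ext_loc, (locally_on U); assumption. Qed.

Lemma Derive_ext_on U h (k : R -> R) x : open U -> U x -> (forall z, U z -> h z = k z) ->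
  Derive h x = Derive k x.
Proof. intros HU Hx E. apply Derive_ext_loc, (locally_on U); assumption. Qed.

Lemma pos_min2 a b : 0 < a -> 0 < b -> exists c, 0 < c /\ c <= a /\ c <= b.
Proof.
  intros Ha Hb. exists (Rmin a b). split; [apply Rmin_glb_lt; assumption|].
  split; [apply Rmin_l|apply Rmin_r].
Qed.

Lemma pos_min3 a b c : 0 < a -> 0 < b -> 0 < c -> exists m, 0 < m /\ m <= a /\ m <= b /\ m <= c.
Proof.
  intros Ha Hb Hc. destruct (pos_min2 a b Ha Hb) as (m & Hm & H1 & H2).
  destruct (pos_min2 m c Hm Hc) as (k & Hk & H3 & H4). exists k. lra.
Qed.

Lemma pos_min4 a b c e : 0 < a -> 0 < b -> 0 < c -> 0 < e ->
  exists m, 0 < m /\ m <= a /\ m <= b /\ m <= c /\ m <= e.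
Proof.
  intros Ha Hb Hc He. destruct (pos_min3 a b c Ha Hb Hc) as (m & Hm & H).
  destruct (pos_min2 m e Hm He) as (k & Hk & H3 & H4). exists k. lra.
Qed.

Lemma Derive_n_S_comm (h : R -> R) k x :
  Derive_n (Derive h) k x = Derive_n h (S k) x.
Proof.
  replace (S k) with (k + 1)%nat by lia. exact (Derive_n_comp h k 1 x).
Qed.

(** Recursive form of the class C^s: it allows proofs by induction on s, in which a map is
    shown to be of class C^(s+1) by exhibiting a derivative of class C^s. *)
Lemma Cs_on_step s U h : Cs_on (S s) U h <->
  (forall x, U x -> ex_derive h x) /\ Cs_on s U (Derive h).
Proof.
  split.
  - intros H. split.
    + intros x Hx. destruct (H x Hx) as [H1 _]. apply (H1 1%nat). lia.
    + intros x Hx. destruct (H x Hx) as [H1 H2]. split.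
      * intros [|k] Hk; [exact I|]. simpl.
        apply (ex_derive_ext (Derive_n h (S k))).
        intros t. symmetry. apply Derive_n_S_comm.
        apply (H1 (S (S k))). lia.
      * apply (continuous_ext (Derive_n h (S s))); [|exact H2].
        intros t. symmetry. apply Derive_n_S_comm.
  - intros [H0 H] x Hx. destruct (H x Hx) as [H1 H2]. split.
    + intros [|[|k]] Hk; [exact I| exact (H0 x Hx)|].
      simpl. apply (ex_derive_ext (Derive_n (Derive h) k)).
      intros t. apply Derive_n_S_comm.
      apply (H1 (S k)). lia.
    + apply (continuous_ext (Derive_n (Derive h) s)); [|exact H2].
      intros t. apply Derive_n_S_comm.
Qed.

Lemma Cs_on_0 U h : Cs_on 0 U h <-> forall x, U x -> continuous h x.
Proof.
  split.
  - intros H x Hx. apply (H x Hx).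
  - intros H x Hx. split; [|apply H, Hx].
    intros k Hk. replace k with 0%nat by lia. exact I.
Qed.

Lemma Cs_on_subset s (U V : R -> Prop) h :
  (forall x, V x -> U x) -> Cs_on s U h -> Cs_on s V h.
Proof. intros HS H x Hx. apply H, HS, Hx. Qed.

Lemma Cs_on_ext s U h (k : R -> R) : open U -> (forall x, U x -> h x = k x) ->
  Cs_on s U h -> Cs_on s U k.
Proof.
  intros HU. revert h k. induction s as [|s IH]; intros h k E H.
  - rewrite Cs_on_0 in *. intros x Hx. apply (continuous_ext_on U h); auto.
  - rewrite Cs_on_step in *. destruct H as [H1 H2]. split.
    + intros x Hx. destruct (H1 x Hx) as [l Hl]. exists l. apply (is_derive_ext_on U h); auto.
    + apply (IH (Derive h)); [|exact H2]. intros x Hx. apply (Derive_ext_on U); auto.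
Qed.

Lemma Cs_on_intro s U h (h' : R -> R) : open U ->
  (forall x, U x -> is_derive h x (h' x)) -> Cs_on s U h' -> Cs_on (S s) U h.
Proof.
  intros HU Hd H. rewrite Cs_on_step. split.
  - intros x Hx. exists (h' x). apply Hd, Hx.
  - apply (Cs_on_ext s U h'); try assumption.
    intros x Hx. symmetry. apply is_derive_unique, Hd, Hx.
Qed.

Lemma Cs_on_derive s U h x : Cs_on (S s) U h -> U x -> is_derive h x (Derive h x).
Proof.
  intros H Hx. apply Derive_correct. rewrite Cs_on_step in H. apply H, Hx.
Qed.

Lemma Cs_on_weaken s U h : Cs_on (S s) U h -> Cs_on s U h.
Proof.
  revert h. induction s as [|s IH]; intros h H.
  - rewrite Cs_on_0. intros x Hx. apply (@ex_derive_continuous R_AbsRing R_NormedModule).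
    rewrite Cs_on_step in H. apply H, Hx.
  - rewrite Cs_on_step in H. rewrite Cs_on_step. split; [apply H|].
    apply IH, H.
Qed.

Lemma Cs_on_le s t U h : (s <= t)%nat -> Cs_on t U h -> Cs_on s U h.
Proof.
  induction 1; [trivial|]. intros H'. apply IHle, Cs_on_weaken, H'.
Qed.

Lemma Cs_on_continuous s U h x : Cs_on s U h -> U x -> continuous h x.
Proof.
  intros H Hx. apply (Cs_on_le 0) in H; [|lia]. rewrite Cs_on_0 in H. apply H, Hx.
Qed.

Lemma Cs_on_const s U c : open U -> Cs_on s U (fun _ => c).
Proof.
  intros HU. revert c. induction s as [|s IH]; intros c.
  - rewrite Cs_on_0. intros x _. apply continuous_const.
  - apply (Cs_on_intro _ _ _ (fun _ => 0)); [exact HU| |apply IH].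
    intros x _. apply (is_derive_const c x).
Qed.

Lemma Cs_on_id s U : open U -> Cs_on s U (fun x => x).
Proof.
  intros HU. destruct s.
  - rewrite Cs_on_0. intros x _. apply continuous_id.
  - apply (Cs_on_intro _ _ _ (fun _ => 1)); [exact HU| |apply Cs_on_const, HU].
    intros x _. apply (is_derive_id x).
Qed.

Lemma Cs_on_plus s U h (k : R -> R) : open U -> Cs_on s U h -> Cs_on s U k ->
  Cs_on s U (fun x => h x + k x).
Proof.
  intros HU. revert h k. induction s as [|s IH]; intros h k H K.
  - rewrite Cs_on_0 in *. intros x Hx.
    apply (continuous_plus h k); [apply H, Hx | apply K, Hx].
  - apply (Cs_on_intro _ _ _ (fun x => Derive h x + Derive k x)); [exact HU| |].
    + intros x Hx. apply (is_derive_plus h k); eapply Cs_on_derive; eassumption.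
    + rewrite Cs_on_step in H, K. apply IH; [apply H|apply K].
Qed.

Lemma Cs_on_mult s U h (k : R -> R) : open U -> Cs_on s U h -> Cs_on s U k ->
  Cs_on s U (fun x => h x * k x).
Proof.
  intros HU. revert h k. induction s as [|s IH]; intros h k H K.
  - rewrite Cs_on_0 in *. intros x Hx.
    apply (continuous_mult h k); [apply H, Hx | apply K, Hx].
  - apply (Cs_on_intro _ _ _ (fun x => Derive h x * k x + h x * Derive k x)); [exact HU| |].
    + intros x Hx. apply (is_derive_mult h k); [eapply Cs_on_derive; eassumption..|].
      intros; apply Rmult_comm.
    + assert (H' := Cs_on_weaken _ _ _ H). assert (K' := Cs_on_weaken _ _ _ K).
      rewrite Cs_on_step in H, K. apply Cs_on_plus; [exact HU| |];
      apply IH; try assumption; [apply H|apply K].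
Qed.

Lemma Cs_on_scal s U c h : open U -> Cs_on s U h -> Cs_on s U (fun x => c * h x).
Proof.
  intros HU H. apply (Cs_on_mult s U (fun _ => c)); try assumption. apply Cs_on_const, HU.
Qed.

Lemma Cs_on_comp s U V h (k : R -> R) : open U -> open V -> (forall x, U x -> V (k x)) ->
  Cs_on s V h -> Cs_on s U k -> Cs_on s U (fun x => h (k x)).
Proof.
  intros HU HV Hk. revert h. induction s as [|s IH]; intros h H K.
  - rewrite Cs_on_0 in *. intros x Hx.
    apply (continuous_comp k h); [apply K, Hx | apply H, Hk, Hx].
  - apply (Cs_on_intro _ _ _ (fun x => Derive k x * Derive h (k x))); [exact HU| |].
    + intros x Hx. apply (is_derive_comp h k);
      [eapply (Cs_on_derive _ V)|eapply Cs_on_derive]; try eassumption.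
      apply Hk, Hx.
    + assert (K' := Cs_on_weaken _ _ _ K).
      rewrite Cs_on_step in H, K. apply Cs_on_mult; [exact HU|apply K|].
      apply IH; [apply H|exact K'].
Qed.

Lemma Cs_on_exp s U : open U -> Cs_on s U exp.
Proof.
  intros HU. induction s as [|s IH].
  - rewrite Cs_on_0. intros x _. apply (is_derive_continuous _ _ _ (is_derive_exp x)).
  - apply (Cs_on_intro _ _ _ exp); [exact HU| |exact IH]. intros x _. apply is_derive_exp.
Qed.

Lemma open_neq0 : open (fun x : R => x <> 0).
Proof. apply open_neq. Qed.

Lemma Cs_on_Rinv s : Cs_on s (fun x => x <> 0) Rinv.
Proof.
  induction s as [|s IH].
  - rewrite Cs_on_0. intros x Hx. apply continuous_Rinv, Hx.
  - apply (Cs_on_intro _ _ _ (fun x => (-1) * (/ x * / x))); [apply open_neq0| |].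
    + intros x Hx. auto_derive; [exact Hx|]. field. exact Hx.
    + apply Cs_on_scal; [apply open_neq0|].
      apply Cs_on_mult; [apply open_neq0|exact IH..].
Qed.

Lemma Cs_on_inv s U h : open U -> (forall x, U x -> h x <> 0) -> Cs_on s U h ->
  Cs_on s U (fun x => / h x).
Proof.
  intros HU Hn H. apply (Cs_on_comp s U (fun x => x <> 0)); try assumption.
  apply open_neq0. apply Cs_on_Rinv.
Qed.

Lemma IVT_between (h : R -> R) a b y :
  a <= b -> (forall x, a <= x <= b -> continuous h x) -> h a <= y <= h b ->
  exists x, a <= x <= b /\ h x = y.
Proof.
  intros Hab Hc Hy.
  destruct (Req_dec (h a) y) as [E|E]; [exists a; split; [lra|exact E]|].
  destruct (Req_dec (h b) y) as [E'|E']; [exists b; split; [lra|exact E']|].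
  assert (a < b). { destruct Hab; [assumption|]. subst. lra. }
  destruct (IVT_interv (fun x => h x - y) a b) as [x [Hx Ex]]; try lra.
  { intros x Hx. apply continuity_pt_filterlim.
    apply (continuous_minus h (fun _ => y)); [apply Hc, Hx|apply continuous_const]. }
  exists x; split; [exact Hx|lra].
Qed.

Lemma is_derive_lin_bound h x l eta : is_derive h x l -> 0 < eta ->
  exists d : posreal, forall t, Rabs (t - x) <= d ->
    Rabs (h t - h x - l * (t - x)) <= eta * Rabs (t - x).
Proof.
  intros Hd Heta. apply is_derive_Reals in Hd.
  destruct (Hd eta Heta) as [d Hd'].
  assert (Hp : 0 < d / 2) by (destruct d; simpl; lra).
  exists (mkposreal _ Hp). intros t Ht. simpl in Ht.
  destruct (Req_dec t x) as [->|Hne].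
  { replace (h x - h x - l * (x - x)) with 0 by ring.
    replace (x - x) with 0 by ring. rewrite Rabs_R0. lra. }
  assert (Hs : t - x <> 0) by lra.
  specialize (Hd' (t - x) Hs). destruct d as [d Hdp]; simpl in *.
  replace (x + (t - x)) with t in Hd' by ring.
  assert (Hlt : Rabs (t - x) < d) by lra.
  specialize (Hd' Hlt).
  replace (h t - h x - l * (t - x)) with (((h t - h x) / (t - x) - l) * (t - x)) by (field; lra).
  rewrite Rabs_mult. apply Rmult_le_compat_r; [apply Rabs_pos|]. lra.
Qed.

Lemma locally_Rabs U x : locally x U ->
  exists d : posreal, forall t, Rabs (t - x) < d -> U t.
Proof. intros [d Hd]. exists d. intros t Ht. apply Hd. exact Ht. Qed.

(** A positive derivative and the intermediate value theorem make [h] locally onto, with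
    control on the location of the preimage. *)
Lemma locally_onto U h x0 l : open U -> U x0 -> (forall x, U x -> continuous h x) ->
  is_derive h x0 l -> 0 < l -> forall e, 0 < e ->
  exists d, 0 < d /\ forall y, Rabs (y - h x0) < d -> exists x, U x /\ Rabs (x - x0) < e /\ h x = y.
Proof.
  intros HU Hx0 Hc Hd Hl e He.
  destruct (is_derive_lin_bound h x0 l (l / 2) Hd ltac:(lra)) as [d Hb].
  destruct (locally_Rabs U x0 (HU x0 Hx0)) as [e1 He1].
  assert (P1 := cond_pos d). assert (P2 := cond_pos e1).
  destruct (pos_min3 d (e / 2) (e1 / 2)) as (s & Hs & Hs1 & Hs2 & Hs3); [lra..|].
  assert (B1 := Hb (x0 - s)). assert (B2 := Hb (x0 + s)).
  replace (x0 - s - x0) with (- s) in B1 by ring.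
  replace (x0 + s - x0) with s in B2 by ring.
  rewrite Rabs_Ropp in B1. rewrite (Rabs_pos_eq s) in B1, B2 by lra.
  specialize (B1 Hs1). specialize (B2 Hs1).
  apply Rabs_le_between in B1. apply Rabs_le_between in B2.
  exists (l * s / 2). split; [nra|]. intros y Hy. apply Rabs_lt_between in Hy.
  assert (HI : forall x, x0 - s <= x <= x0 + s -> Rabs (x - x0) < e /\ U x).
  { intros x Hx. split; [|apply He1]; apply Rabs_lt_between; lra. }
  destruct (IVT_between h (x0 - s) (x0 + s) y) as [x [Hx Ex]]; [lra| |nra|].
  - intros x Hx. apply Hc, HI, Hx.
  - exists x. destruct (HI x Hx). auto.
Qed.

(** The preimage of a point near [h x0] lies near [x0] by [locally_onto]; this replaces the
    continuity of [k], which is not known beforehand. *)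
Lemma is_derive_left_inverse_pos U h (k : R -> R) x0 l :
  open U -> U x0 -> (forall x, U x -> k (h x) = x) ->
  (forall x, U x -> continuous h x) -> is_derive h x0 l -> 0 < l ->
  is_derive k (h x0) (/ l).
Proof.
  intros HU Hx0 Hk Hc Hd Hl. apply is_derive_Reals. intros eps Heps.
  assert (Hel : 0 < eps * l) by nra.
  destruct (pos_min2 (l / 2) (eps * l * l / 4)) as (eta & Heta & Heta1 & Heta2); [lra|nra|].
  destruct (is_derive_lin_bound h x0 l eta Hd Heta) as [d Hb].
  destruct (locally_onto U h x0 l HU Hx0 Hc Hd Hl d (cond_pos d)) as (c & Hc0 & Hon).
  exists (mkposreal _ Hc0). intros t Ht0 Ht. simpl in Ht.
  destruct (Hon (h x0 + t)) as (x & HUx & Hxx & Ex).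
  { replace (h x0 + t - h x0) with t by ring. exact Ht. }
  rewrite <- Ex, (Hk x HUx), (Hk x0 Hx0).
  assert (B := Hb x ltac:(lra)).
  assert (Et : t = h x - h x0) by lra. rewrite <- Et in B.
  assert (Hne : x - x0 <> 0).
  { intros E. apply Ht0. rewrite Et. replace x with x0 by lra. ring. }
  assert (Hap := Rabs_pos_lt _ Hne).
  assert (Ht2 : l / 2 * Rabs (x - x0) <= Rabs t).
  { assert (T := Rabs_triang_inv (l * (x - x0)) (l * (x - x0) - t)).
    replace (l * (x - x0) - (l * (x - x0) - t)) with t in T by ring.
    rewrite (Rabs_minus_sym (l * (x-x0)) t), Rabs_mult, (Rabs_pos_eq l) in T by lra. nra. }
  replace ((x - x0) / t - / l) with (- (t - l * (x - x0)) / (l * t)) by (field; lra).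
  unfold Rdiv. rewrite Rabs_mult, Rabs_Ropp, Rabs_inv, Rabs_mult, (Rabs_pos_eq l) by lra.
  assert (Htp : 0 < Rabs t) by (apply Rabs_pos_lt; exact Ht0).
  apply (Rmult_lt_reg_r (l * Rabs t)); [nra|].
  rewrite Rmult_assoc, Rinv_l, Rmult_1_r by nra.
  apply Rle_lt_trans with (1 := B).
  apply Rle_lt_trans with (eps * l * l / 4 * Rabs (x - x0)); [nra|].
  assert (eps * l * (l / 2 * Rabs (x - x0)) <= eps * l * Rabs t) by nra.
  nra.
Qed.

Lemma is_derive_left_inverse U h (k : R -> R) x0 l :
  open U -> U x0 -> (forall x, U x -> k (h x) = x) ->
  (forall x, U x -> continuous h x) -> is_derive h x0 l -> l <> 0 ->
  is_derive k (h x0) (/ l).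
Proof.
  intros HU Hx0 Hk Hc Hd Hl.
  destruct (Rlt_dec 0 l) as [Hp|Hn].
  - apply (is_derive_left_inverse_pos U); assumption.
  - assert (D : is_derive (fun y => k (- y)) (- h x0) (/ - l)).
    { apply (is_derive_left_inverse_pos U (fun x => - h x)); try assumption.
      - intros x Hx. rewrite Ropp_involutive. apply Hk, Hx.
      - intros x Hx. apply (continuous_opp h), Hc, Hx.
      - apply (is_derive_opp h), Hd.
      - lra. }
    apply (is_derive_ext (fun y => k (- - y))).
    { intros t. rewrite Ropp_involutive. reflexivity. }
    replace (/ l) with (-1 * / - l) by (field; lra).
    apply (is_derive_comp (fun y => k (- y)) (fun y => - y)); [exact D|].
    auto_derive; [exact I|reflexivity].
Qed.

(** Bootstrap: the derivative of [k] is 1 / (h' o k), which is as smooth as [k] itself. *)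
Lemma Cs_on_left_inverse s U V h (k : R -> R) :
  open U -> open V -> (forall x, U x -> k (h x) = x) ->
  (forall y, V y -> U (k y) /\ h (k y) = y) ->
  Cs_on (S s) U h -> (forall x, U x -> Derive h x <> 0) -> Cs_on (S s) V k.
Proof.
  intros HU HV Hk Hhk H H0.
  assert (D : forall y, V y -> is_derive k y (/ Derive h (k y))).
  { intros y Hy. destruct (Hhk y Hy) as [HUy E]. rewrite <- E at 1.
    apply (is_derive_left_inverse U); try assumption.
    - intros x Hx. apply (Cs_on_continuous (S s) U); assumption.
    - apply (Cs_on_derive s U); assumption.
    - apply H0, HUy. }
  induction s as [|s IH].
  - apply (Cs_on_intro _ _ _ _ HV D). rewrite Cs_on_0. intros y Hy.
    apply continuous_Rinv_comp; [|apply H0, Hhk, Hy].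
    apply (continuous_comp k (Derive h)).
    + apply (is_derive_continuous _ _ _ (D y Hy)).
    + rewrite Cs_on_step, Cs_on_0 in H. apply H, Hhk, Hy.
  - apply (Cs_on_intro _ _ _ _ HV D). apply Cs_on_inv; [exact HV| |].
    + intros y Hy. apply H0, Hhk, Hy.
    + apply (Cs_on_comp (S s) V U (Derive h) k); try assumption.
      * intros y Hy. apply Hhk, Hy.
      * rewrite Cs_on_step in H. apply H.
      * apply IH. apply Cs_on_weaken, H.
Qed.

Lemma open_image (U V : R -> Prop) h : open U ->
  (forall x, U x -> V (h x)) -> (forall y, V y -> exists x, U x /\ h x = y) ->
  Cs_on 1 U h -> (forall x, U x -> Derive h x > 0) -> open V.
Proof.
  intros HU Hh Hs H H0 y Hy. destruct (Hs y Hy) as [x0 [Hx0 <-]].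
  destruct (locally_onto U h x0 (Derive h x0) HU Hx0) with (e := 1) as (d & Hd & Hon).
  - intros x Hx. apply (Cs_on_continuous 1 U); assumption.
  - apply (Cs_on_derive 0 U); assumption.
  - apply H0, Hx0.
  - lra.
  - exists (mkposreal _ Hd). intros t Ht. destruct (Hon t Ht) as (x & Hx & _ & <-). apply Hh, Hx.
Qed.

Lemma Cs_diffeo_onto_image s (U V : R -> Prop) h : open U ->
  (forall x, U x -> V (h x)) -> (forall y, V y -> exists x, U x /\ h x = y) ->
  Cs_on (S s) U h -> (forall x, U x -> Derive h x > 0) ->
  (forall x y, U x -> U y -> h x = h y -> x = y) ->
  Cs_diffeo (S s) U V h.
Proof.
  intros HU Hh Hs H H0 Hi.
  pose (k := fun y => epsilon (inhabits 0) (fun x => U x /\ h x = y)).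
  assert (Hk : forall y, V y -> U (k y) /\ h (k y) = y).
  { intros y Hy. apply (epsilon_spec (inhabits 0) (fun x => U x /\ h x = y)), Hs, Hy. }
  assert (Hk' : forall x, U x -> k (h x) = x).
  { intros x Hx. destruct (Hk (h x) (Hh x Hx)) as [A B]. apply Hi; assumption. }
  exists k. split; [auto|]. split; [exact Hk|]. split; [exact H|].
  apply (Cs_on_left_inverse s U V h k); try assumption.
  - apply (open_image U V h); try assumption. apply (Cs_on_le _ (S s)); [lia|exact H].
  - intros z Hz. apply Rgt_not_eq, H0, Hz.
Qed.

Lemma MVT_itv h (h' : R -> R) a b : a < b ->
  (forall x, a <= x <= b -> is_derive h x (h' x)) ->
  exists c, a < c < b /\ h b - h a = h' c * (b - a).
Proof.
  intros Hab Hd. destruct (MVT_cor2 h h' a b Hab) as [c [E Hc]].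
  - intros c Hc. apply is_derive_Reals, Hd, Hc.
  - exists c. split; assumption.
Qed.

Lemma increasing_itv h (h' : R -> R) (D : R -> Prop) :
  (forall a b x, D a -> D b -> a <= x <= b -> D x) ->
  (forall x, D x -> is_derive h x (h' x)) -> (forall x, D x -> 0 < h' x) ->
  forall x y, D x -> D y -> x < y -> h x < h y.
Proof.
  intros HD Hd Hp x y Hx Hy Hxy.
  destruct (MVT_itv h h' x y Hxy) as [c [Hc E]].
  - intros z Hz. apply Hd, (HD x y z); assumption.
  - assert (0 < h' c) by (apply Hp, (HD x y c); try assumption; lra).
    assert (0 < h' c * (y - x)) by (apply Rmult_lt_0_compat; lra). lra.
Qed.

Lemma decreasing_itv h (h' : R -> R) (D : R -> Prop) :
  (forall a b x, D a -> D b -> a <= x <= b -> D x) ->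
  (forall x, D x -> is_derive h x (h' x)) -> (forall x, D x -> h' x < 0) ->
  forall x y, D x -> D y -> x < y -> h y < h x.
Proof.
  intros HD Hd Hp x y Hx Hy Hxy.
  apply Ropp_lt_cancel.
  apply (increasing_itv (fun x => - h x) (fun x => - h' x) D); try assumption.
  - intros z Hz. apply (is_derive_opp h), Hd, Hz.
  - intros z Hz. apply Hp in Hz. lra.
Qed.

Lemma itv_convex l u : forall a b x, itv l u a -> itv l u b -> a <= x <= b -> itv l u x.
Proof. unfold itv. intros. lra. Qed.

Lemma continuous_eps h x eps : continuous h x -> 0 < eps ->
  exists d : posreal, forall t, Rabs (t - x) < d -> Rabs (h t - h x) < eps.
Proof.
  intros Hc He. apply (locally_Rabs (fun t => Rabs (h t - h x) < eps)).
  apply (Hc (fun y => Rabs (y - h x) < eps)). exists (mkposreal _ He). intros y Hy. exact Hy.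
Qed.

(** * Linear functional equations and linearization of hyperbolic fixed points *)

Definition oball (p e : R) : R -> Prop := fun x => Rabs (x - p) < e.

Lemma open_oball p e : open (oball p e).
Proof.
  intros x Hx. unfold oball in *.
  assert (H : 0 < e - Rabs (x - p)) by lra.
  exists (mkposreal _ H). intros t Ht.
  assert (Ht' : Rabs (t - x) < e - Rabs (x - p)) by exact Ht.
  replace (t - p) with ((t - x) + (x - p)) by ring.
  eapply Rle_lt_trans; [apply Rabs_triang|]. lra.
Qed.

Lemma bounded_oball h p e rho : (forall x, oball p e x -> continuous h x) -> rho < e ->
  exists M, 0 < M /\ forall x, Rabs (x - p) <= rho -> Rabs (h x) <= M.
Proof.
  intros Hc Hr.
  destruct (bounded_continuity h (p - rho) (p + rho)) as [M HM].
  - intros x Hx. apply Hc. unfold oball.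
    apply Rle_lt_trans with (2 := Hr). apply Rabs_le_between. lra.
  - exists (Rmax M 1). split.
    + apply Rlt_le_trans with 1; [lra|apply Rmax_r].
    + intros x Hx. apply Rabs_le_between in Hx.
      apply Rle_trans with M; [|apply Rmax_l]. left. apply (HM x). lra.
Qed.

(** Compared with a Cauchy argument this yields the error bound at once.  The null sequence
    [e] is geometric for linear equations, and a parabolic orbit for Fatou coordinates. *)
Lemma pinched_limit (u e : nat -> R) : is_lim_seq e 0 -> (forall n, 0 <= e n) ->
  (forall n, u (S n) + e (S n) <= u n + e n) -> (forall n, u n - e n <= u (S n) - e (S n)) ->
  exists L : R, is_lim_seq u L /\ forall n, Rabs (u n - L) <= e n.
Proof.
  intros He Hp D I.
  assert (I0 : forall n, u O - e O <= u n - e n).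
  { induction n as [|n IH]; [lra|]. apply Rle_trans with (1 := IH). apply I. }
  destruct (ex_finite_lim_seq_decr (fun n => u n + e n) (u O - e O)) as [L HL].
  - exact D.
  - intros n. specialize (I0 n). specialize (Hp n). lra.
  - assert (Lu : is_lim_seq u L).
    { apply (is_lim_seq_ext (fun n => (u n + e n) - e n)); [intros n; ring|].
      replace L with (L - 0) by ring. apply is_lim_seq_minus'; assumption. }
    exists L. split; [exact Lu|]. intros n. apply Rabs_le_between.
    assert (A1 := is_lim_seq_decr_compare _ _ HL D n). simpl in A1.
    assert (A2 : is_lim_seq (fun n => u n - e n) L).
    { replace L with (L - 0) by ring. apply is_lim_seq_minus'; assumption. }
    assert (A3 := is_lim_seq_incr_compare _ _ A2 I n). simpl in A3. lra.
Qed.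

Lemma lim_scal_0 (u : nat -> R) C : is_lim_seq u 0 -> is_lim_seq (fun n => C * u n) 0.
Proof.
  intros H. replace (Finite 0) with (Rbar_mult C 0) by (simpl; f_equal; ring).
  apply is_lim_seq_scal_l, H.
Qed.

Lemma lim_geom_0 C th : 0 <= th < 1 -> is_lim_seq (fun n => C * th ^ n) 0.
Proof. intros H. apply lim_scal_0, is_lim_seq_geom. rewrite Rabs_pos_eq; lra. Qed.

Lemma geometric_limit (u : nat -> R) W th : 0 <= th < 1 ->
  (forall n, Rabs (u (S n) - u n) <= W * th ^ n) ->
  exists L : R, is_lim_seq u L /\ forall n, Rabs (u n - L) <= W / (1 - th) * th ^ n.
Proof.
  intros Hth Hu. set (C := W / (1 - th)).
  assert (EC : C * (1 - th) = W) by (unfold C; field; lra).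
  assert (HC : 0 <= C).
  { assert (B := Hu O). assert (P := Rabs_pos (u 1%nat - u O)). simpl in B.
    apply Rdiv_le_0_compat; lra. }
  apply (pinched_limit u (fun n => C * th ^ n)); [apply lim_geom_0, Hth| | |]; intros n;
    specialize (Hu n); apply Rabs_le_between in Hu; rewrite <- EC in Hu; simpl; try lra.
  apply Rmult_le_pos; [exact HC|apply pow_le; lra].
Qed.

(** Picard iteration for the equation psi = w + m (psi o T), started at 0. *)
Fixpoint lin_iter (w m T : R -> R) (n : nat) (x : R) : R :=
  match n with
  | O => 0
  | S n => w x + m x * lin_iter w m T n (T x)
  end.

Definition lin_sol (w m T : R -> R) (x : R) : R :=
  real (Lim_seq (fun n => lin_iter w m T n x)).

Lemma lin_iter_cauchy w m T p e rho W th :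
  rho < e ->
  (forall x, oball p e x -> Rabs (T x - p) <= Rabs (x - p)) ->
  (forall x, oball p e x -> Rabs (m x) <= th) ->
  (forall x, Rabs (x - p) <= rho -> Rabs (w x) <= W) ->
  forall n x, Rabs (x - p) <= rho ->
    Rabs (lin_iter w m T (S n) x - lin_iter w m T n x) <= W * th ^ n.
Proof.
  intros Hr HT Hm HW n. induction n as [|n IH]; intros x Hx.
  - simpl. replace (w x + m x * 0 - 0) with (w x) by ring. rewrite Rmult_1_r. apply HW, Hx.
  - assert (HJ : oball p e x) by (unfold oball; lra).
    change (lin_iter w m T (S (S n)) x) with (w x + m x * lin_iter w m T (S n) (T x)).
    change (lin_iter w m T (S n) x) with (w x + m x * lin_iter w m T n (T x)).
    replace (w x + m x * lin_iter w m T (S n) (T x) - (w x + m x * lin_iter w m T n (T x)))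
      with (m x * (lin_iter w m T (S n) (T x) - lin_iter w m T n (T x))) by ring.
    rewrite Rabs_mult. specialize (IH (T x)).
    assert (HTx := HT x HJ). assert (Hmx := Hm x HJ).
    assert (IH' := IH ltac:(lra)). simpl (th ^ S n).
    replace (W * (th * th ^ n)) with (th * (W * th ^ n)) by ring.
    apply Rmult_le_compat; try apply Rabs_pos; assumption.
Qed.

Lemma lin_sol_unif w m T p e rho th : 0 <= th < 1 -> rho < e ->
  (forall x, oball p e x -> Rabs (T x - p) <= Rabs (x - p)) ->
  (forall x, oball p e x -> Rabs (m x) <= th) ->
  (forall x, oball p e x -> continuous w x) ->
  exists C, 0 < C /\ forall x, Rabs (x - p) <= rho ->
    is_lim_seq (fun n => lin_iter w m T n x) (lin_sol w m T x) /\
    forall n, Rabs (lin_iter w m T n x - lin_sol w m T x) <= C * th ^ n.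
Proof.
  intros Hth Hr HT Hm Hw.
  destruct (bounded_oball w p e rho Hw Hr) as [W [HW0 HW]].
  exists (W / (1 - th)). split; [apply Rdiv_lt_0_compat; lra|].
  intros x Hx.
  destruct (geometric_limit (fun n => lin_iter w m T n x) W th Hth) as [L [HL HB]].
  { intros n. apply (lin_iter_cauchy w m T p e rho); assumption. }
  unfold lin_sol. rewrite (is_lim_seq_unique _ _ HL). split; assumption.
Qed.

Lemma lin_sol_lim w m T p e th x : 0 <= th < 1 ->
  (forall x, oball p e x -> Rabs (T x - p) <= Rabs (x - p)) ->
  (forall x, oball p e x -> Rabs (m x) <= th) ->
  (forall x, oball p e x -> continuous w x) -> oball p e x ->
  is_lim_seq (fun n => lin_iter w m T n x) (lin_sol w m T x).
Proof.
  intros Hth HT Hm Hw Hx.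
  destruct (lin_sol_unif w m T p e (Rabs (x - p)) th) as [C [_ H]]; try assumption.
  apply (H x). lra.
Qed.

Lemma lin_sol_eq w m T p e th x : 0 <= th < 1 ->
  (forall x, oball p e x -> Rabs (T x - p) <= Rabs (x - p)) ->
  (forall x, oball p e x -> Rabs (m x) <= th) ->
  (forall x, oball p e x -> continuous w x) -> oball p e x ->
  lin_sol w m T x = w x + m x * lin_sol w m T (T x).
Proof.
  intros Hth HT Hm Hw Hx.
  assert (HTx : oball p e (T x)) by (unfold oball; apply Rle_lt_trans with (1 := HT x Hx), Hx).
  assert (L1 := lin_sol_lim w m T p e th x Hth HT Hm Hw Hx).
  assert (L2 := lin_sol_lim w m T p e th (T x) Hth HT Hm Hw HTx).
  assert (L3 : is_lim_seq (fun n => lin_iter w m T (S n) x) (w x + m x * lin_sol w m T (T x))).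
  { simpl. apply is_lim_seq_plus'; [apply is_lim_seq_const|].
    apply (is_lim_seq_scal_l _ (m x) _ L2). }
  apply is_lim_seq_incr_1 in L1. 
  assert (E := is_lim_seq_unique _ _ L1). rewrite (is_lim_seq_unique _ _ L3) in E.
  injection E as E. symmetry. exact E.
Qed.

(** The derivatives of the Picard iterates satisfy the differentiated equation up to an error
    of order th^n; they converge at any rate slower than th^n, here ((1 + th) / 2)^n. *)
Lemma perturbed_iteration (T : R -> R) (chi : nat -> R -> R) (sol : R -> R) p rho th K C0 :
  0 <= th < 1 -> 0 <= K -> 0 <= C0 ->
  (forall x, Rabs (x - p) <= rho -> Rabs (T x - p) <= rho) ->
  (forall x, Rabs (x - p) <= rho -> Rabs (chi O x - sol x) <= C0) ->
  (forall n x, Rabs (x - p) <= rho ->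
     Rabs (chi (S n) x - sol x) <= K * th ^ n + th * Rabs (chi n (T x) - sol (T x))) ->
  exists C, 0 <= C /\ forall n x, Rabs (x - p) <= rho ->
    Rabs (chi n x - sol x) <= C * ((1 + th) / 2) ^ n.
Proof.
  intros Hth HK HC0 HT H0 HS. set (eta := (1 + th) / 2).
  assert (Heta : th < eta < 1) by (unfold eta; lra).
  exists (C0 + K / (eta - th)).
  assert (HKe : 0 <= K / (eta - th)) by (apply Rdiv_le_0_compat; lra).
  split; [lra|].
  induction n as [|n IH]; intros x Hx.
  - simpl. rewrite Rmult_1_r. specialize (H0 x Hx). lra.
  - apply Rle_trans with (1 := HS n x Hx).
    specialize (IH (T x) (HT x Hx)).
    assert (Hpow : th ^ n <= eta ^ n) by (apply pow_incr; lra).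
    assert (Hpe : 0 <= eta ^ n) by (apply pow_le; lra).
    set (C := C0 + K / (eta - th)) in *.
    assert (EK : K <= C * (eta - th)).
    { unfold C. rewrite Rmult_plus_distr_r.
      replace (K / (eta - th) * (eta - th)) with K by (field; lra).
      assert (0 <= C0 * (eta - th)) by (apply Rmult_le_pos; lra). lra. }
    simpl.
    assert (K * th ^ n <= K * eta ^ n) by (apply Rmult_le_compat_l; assumption).
    assert (K * eta ^ n <= C * (eta - th) * eta ^ n) by (apply Rmult_le_compat_r; assumption).
    assert (th * Rabs (chi n (T x) - sol (T x)) <= th * (C * eta ^ n))
      by (apply Rmult_le_compat_l; lra).
    lra.
Qed.

Lemma CVU_dom_bound (fn : nat -> R -> R) (g : R -> R) (D : R -> Prop) (eps : nat -> R) :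
  is_lim_seq eps 0 -> (forall n x, D x -> Rabs (fn n x - g x) <= eps n) ->
  (forall x, D x -> is_lim_seq (fun n => fn n x) (g x)) /\ CVU_dom fn D.
Proof.
  intros Hg HB.
  assert (HL : forall x, D x -> is_lim_seq (fun n => fn n x) (g x)).
  { intros x Hx.
    apply (is_lim_seq_le_le (fun n => g x - eps n) _ (fun n => g x + eps n)).
    - intros n. specialize (HB n x Hx). apply Rabs_le_between in HB. lra.
    - replace (Finite (g x)) with (Finite (g x - 0)) by (f_equal; ring).
      apply is_lim_seq_minus'; [apply is_lim_seq_const|exact Hg].
    - replace (Finite (g x)) with (Finite (g x + 0)) by (f_equal; ring).
      apply is_lim_seq_plus'; [apply is_lim_seq_const|exact Hg]. }
  split; [exact HL|]. intros e.
  apply is_lim_seq_spec in Hg. specialize (Hg e).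
  apply filter_imp with (2 := Hg). intros n Hn x Hx.
  rewrite (is_lim_seq_unique _ _ (HL x Hx)). simpl.
  apply Rle_lt_trans with (1 := HB n x Hx).
  rewrite Rminus_0_r in Hn. apply Rle_lt_trans with (2 := Hn). apply Rle_abs.
Qed.

Lemma lin_sol_continuous w m T p e th x : 0 <= th < 1 ->
  (forall x, oball p e x -> Rabs (T x - p) <= Rabs (x - p)) ->
  (forall x, oball p e x -> Rabs (m x) <= th) ->
  (forall x, oball p e x -> continuous w x) ->
  (forall x, oball p e x -> continuous m x) ->
  (forall x, oball p e x -> continuous T x) -> oball p e x ->
  continuous (lin_sol w m T) x.
Proof.
  intros Hth HT Hm Hw Hcm HcT Hx.
  set (rho := (Rabs (x - p) + e) / 2).
  assert (Hr : rho < e) by (unfold rho, oball in *; lra).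
  assert (Hxr : Rabs (x - p) < rho) by (unfold rho, oball in *; lra).
  destruct (lin_sol_unif w m T p e rho th Hth Hr HT Hm Hw) as [C [_ HC]].
  destruct (CVU_dom_bound (fun n => lin_iter w m T n) (lin_sol w m T) (oball p rho) (fun n => C * th ^ n) (lim_geom_0 C th Hth))
    as [_ HU].
  { intros n y Hy. apply HC. unfold oball in Hy. lra. }
  assert (Hit : forall n y, oball p e y -> continuous (lin_iter w m T n) y).
  { induction n as [|n IH]; intros y Hy.
    - apply continuous_const.
    - apply (continuous_plus w (fun y => m y * lin_iter w m T n (T y))); [apply Hw, Hy|].
      apply (continuous_mult m (fun y => lin_iter w m T n (T y))); [apply Hcm, Hy|].
      apply (continuous_comp T (lin_iter w m T n)); [apply HcT, Hy|].
      apply IH. unfold oball in *. apply Rle_lt_trans with (1 := HT y Hy). exact Hy. }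
  apply continuity_pt_filterlim.
  apply (CVU_cont_open (fun n => lin_iter w m T n) (oball p rho)); try assumption.
  - apply open_oball.
  - intros n y Hy. apply continuity_pt_filterlim, Hit. unfold oball in *. lra.
Qed.

(** The derivative of [lin_iter], by differentiation of its recursion. *)
Fixpoint lin_iter' (w m T w' m' T' : R -> R) (n : nat) (x : R) : R :=
  match n with
  | O => 0
  | S n => w' x + (m' x * lin_iter w m T n (T x)
                   + m x * (T' x * lin_iter' w m T w' m' T' n (T x)))
  end.

(** The derivative of the solution solves an equation of the same kind, with data
    w' + m' (psi o T) and coefficient m T'.  The iterates and their derivatives converge uniformly
    on smaller balls, so that the limit may be differentiated. *)
Lemma lin_sol_derive (w m T w' m' T' : R -> R) p e th x : 0 <= th < 1 ->
  (forall x, oball p e x -> Rabs (T x - p) <= Rabs (x - p)) ->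
  (forall x, oball p e x -> Rabs (m x) <= th) ->
  (forall x, oball p e x -> Rabs (T' x) <= 1) ->
  (forall x, oball p e x -> is_derive w x (w' x) /\ continuous w' x) ->
  (forall x, oball p e x -> is_derive m x (m' x) /\ continuous m' x) ->
  (forall x, oball p e x -> is_derive T x (T' x) /\ continuous T' x) -> oball p e x ->
  is_derive (lin_sol w m T) x
    (lin_sol (fun x => w' x + m' x * lin_sol w m T (T x)) (fun x => m x * T' x) T x).
Proof.
  intros Hth HT Hm HT1 Hdw Hdm HdT Hx.
  assert (HTJ : forall x, oball p e x -> oball p e (T x)).
  { intros y Hy. apply Rle_lt_trans with (1 := HT y Hy), Hy. }
  set (sol := lin_sol w m T). set (w1 := fun x => w' x + m' x * sol (T x)).
  set (m1 := fun x => m x * T' x).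
  assert (Hcw : forall x, oball p e x -> continuous w x) by (intros; eapply is_derive_continuous; apply Hdw; assumption).
  assert (Hcm : forall x, oball p e x -> continuous m x) by (intros; eapply is_derive_continuous; apply Hdm; assumption).
  assert (HcT : forall x, oball p e x -> continuous T x) by (intros; eapply is_derive_continuous; apply HdT; assumption).
  assert (Hsc : forall x, oball p e x -> continuous sol x).
  { intros y Hy. apply (lin_sol_continuous w m T p e th); assumption. }
  assert (Hw1 : forall x, oball p e x -> continuous w1 x).
  { intros y Hy. apply (continuous_plus w' (fun y => m' y * sol (T y))); [apply Hdw, Hy|].
    apply (continuous_mult m' (fun y => sol (T y))); [apply Hdm, Hy|].
    apply (continuous_comp T sol); [apply HcT, Hy|apply Hsc, HTJ, Hy]. }
  assert (Hm1 : forall x, oball p e x -> Rabs (m1 x) <= th).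
  { intros y Hy. unfold m1. rewrite Rabs_mult. rewrite <- (Rmult_1_r th).
    apply Rmult_le_compat; try apply Rabs_pos; auto. }
  set (rho := (Rabs (x - p) + e) / 2).
  assert (Hr : rho < e) by (unfold rho, oball in *; lra).
  assert (Hxr : Rabs (x - p) < rho) by (unfold rho, oball in *; lra).
  assert (HJ : forall y, Rabs (y - p) <= rho -> oball p e y) by (unfold oball; intros; lra).
  destruct (lin_sol_unif w m T p e rho th Hth Hr HT Hm Hcw) as [C [HC0 HC]].
  destruct (CVU_dom_bound (fun n => lin_iter w m T n) sol (oball p rho) (fun n => C * th ^ n) (lim_geom_0 C th Hth))
    as [_ HU].
  { intros n y Hy. apply HC. unfold oball in Hy. lra. }
  set (chi := lin_iter' w m T w' m' T').
  set (s1 := lin_sol w1 m1 T).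
  destruct (bounded_oball m' p e rho) as [M [HM0 HM]]; [intros; apply Hdm; assumption|exact Hr|].
  destruct (bounded_oball s1 p e rho) as [C1 [HC10 HC1]]; [|exact Hr|].
  { intros y Hy. apply (lin_sol_continuous w1 m1 T p e th); try assumption.
    intros z Hz. apply (continuous_mult m T'); [apply Hcm, Hz|apply HdT, Hz]. }
  assert (Hrr : forall y, Rabs (y - p) <= rho -> Rabs (T y - p) <= rho).
  { intros y Hy. apply Rle_trans with (2 := Hy), HT, HJ, Hy. }
  destruct (perturbed_iteration T chi s1 p rho th (M * C) C1 Hth) as [C2 [HC20 HC2]].
  - apply Rmult_le_pos; lra.
  - lra.
  - exact Hrr.
  - intros y Hy. change (chi O y) with 0. replace (0 - s1 y) with (- s1 y) by ring. rewrite Rabs_Ropp. auto.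
  - intros n y Hy.
    rewrite (lin_sol_eq w1 m1 T p e th y Hth HT Hm1 Hw1 (HJ y Hy) : s1 y = _). fold s1.
    change (chi (S n) y) with (w' y + (m' y * lin_iter w m T n (T y) + m y * (T' y * chi n (T y)))).
    unfold w1 at 1, m1 at 1.
    replace (w' y + (m' y * lin_iter w m T n (T y) + m y * (T' y * chi n (T y))) -
     (w' y + m' y * sol (T y) + m y * T' y * s1 (T y)))
    with (m' y * (lin_iter w m T n (T y) - sol (T y)) + (m1 y) * (chi n (T y) - s1 (T y)))
      by (unfold m1; ring).
    eapply Rle_trans; [apply Rabs_triang|]. rewrite !Rabs_mult.
    apply Rplus_le_compat.
    + rewrite Rmult_assoc. apply Rmult_le_compat; try apply Rabs_pos; [apply HM, Hy|].
      apply HC, Hrr, Hy.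
    + apply Rmult_le_compat_r; [apply Rabs_pos|]. apply Hm1, HJ, Hy.
  - assert (Hd : forall n y, oball p e y -> is_derive (lin_iter w m T n) y (chi n y)).
    { induction n as [|n IH]; intros y Hy.
      - apply (is_derive_const 0 y).
      - apply (is_derive_plus w (fun y => m y * lin_iter w m T n (T y))); [apply Hdw, Hy|].
        apply (is_derive_mult m (fun y => lin_iter w m T n (T y))); [apply Hdm, Hy| |].
        + apply (is_derive_comp (lin_iter w m T n) T); [apply IH, HTJ, Hy|apply HdT, Hy].
        + intros; apply Rmult_comm. }
    assert (Hcc : forall n y, oball p e y -> continuous (chi n) y).
    { induction n as [|n IH]; intros y Hy.
      - apply continuous_const.
      - apply (continuous_plus w' (fun y => m' y * lin_iter w m T n (T y) + m y * (T' y * chi n (T y))));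
          [apply Hdw, Hy|].
        apply (continuous_plus (fun y => m' y * lin_iter w m T n (T y)) (fun y => m y * (T' y * chi n (T y)))).
        + apply (continuous_mult m' (fun y => lin_iter w m T n (T y))); [apply Hdm, Hy|].
          apply (continuous_comp T (lin_iter w m T n)); [apply HcT, Hy|].
          apply (is_derive_continuous _ _ _ (Hd n _ (HTJ y Hy))).
        + apply (continuous_mult m (fun y => T' y * chi n (T y))); [apply Hcm, Hy|].
          apply (continuous_mult T' (fun y => chi n (T y))); [apply HdT, Hy|].
          apply (continuous_comp T (chi n)); [apply HcT, Hy|]. apply IH, HTJ, Hy. }
    assert (HDe : forall n y, oball p rho y -> Derive (lin_iter w m T n) y = chi n y).
    { intros n y Hy. apply is_derive_unique, Hd. unfold oball in *; lra. }
    destruct (CVU_dom_bound (fun n y => Derive (lin_iter w m T n) y) s1 (oball p rho) (fun n => C2 * ((1 + th) / 2) ^ n))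
      as [HL2 HU2].
    + apply lim_geom_0. lra.
    + intros n y Hy. rewrite HDe by exact Hy. apply HC2. unfold oball in Hy. lra.
    + assert (G := CVU_Derive (fun n => lin_iter w m T n) (oball p rho) (open_oball p rho)).
      specialize (HL2 x Hxr). apply is_lim_seq_unique in HL2.
      replace (s1 x) with (real (Lim_seq (fun n => Derive (lin_iter w m T n) x)))
        by (rewrite HL2; reflexivity).
      apply G; try assumption.
      * intros a b y Ha Hb Hy. unfold oball in *. apply Rabs_lt_between in Ha.
        apply Rabs_lt_between in Hb. apply Rabs_lt_between. lra.
      * intros n y Hy. exists (chi n y). apply Hd. unfold oball in *; lra.
      * intros n y Hy. apply continuity_pt_filterlim.
        apply (continuous_ext_on (oball p rho) (chi n)); [apply open_oball|exact Hy| |].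
        { intros z Hz. symmetry. apply HDe, Hz. }
        apply Hcc. unfold oball in *; lra.
Qed.

(** The derivative of the solution solves an equation of the same kind, so one degree of
    regularity is gained at each step of the induction. *)
Lemma Cs_on_lin_sol s (w m T : R -> R) p e th : 0 <= th < 1 ->
  (forall x, oball p e x -> Rabs (T x - p) <= Rabs (x - p)) ->
  (forall x, oball p e x -> Rabs (m x) <= th) ->
  (forall x, oball p e x -> Rabs (Derive T x) <= 1) ->
  Cs_on s (oball p e) w -> Cs_on s (oball p e) m -> Cs_on s (oball p e) T ->
  Cs_on s (oball p e) (lin_sol w m T).
Proof.
  intros Hth HT Hm HT1. revert w m Hm.
  induction s as [|s IH]; intros w m Hm Hw Hcm HcT.
  - rewrite Cs_on_0. intros x Hx.
    apply (lin_sol_continuous w m T p e th); try assumption;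
    intros y Hy; apply (Cs_on_continuous 0 (oball p e)); assumption.
  - assert (HO := open_oball p e).
    set (m1 := fun x => m x * Derive T x).
    set (w1 := fun x => Derive w x + Derive m x * lin_sol w m T (T x)).
    assert (HS := IH w m Hm (Cs_on_weaken _ _ _ Hw) (Cs_on_weaken _ _ _ Hcm) (Cs_on_weaken _ _ _ HcT)).
    assert (W := fun f H => proj2 (proj1 (Cs_on_step s (oball p e) f) H)).
    apply (Cs_on_intro s _ _ (lin_sol w1 m1 T) HO).
    + intros x Hx. unfold w1, m1.
      apply (lin_sol_derive w m T (Derive w) (Derive m) (Derive T) p e th); try assumption;
      intros y Hy; (split; [eapply Cs_on_derive; eassumption|];
         eapply (Cs_on_continuous s); [apply W; eassumption|exact Hy]).
    + apply IH.
      * intros x Hx. unfold m1. rewrite Rabs_mult. rewrite <- (Rmult_1_r th).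
        apply Rmult_le_compat; try apply Rabs_pos; auto.
      * unfold w1. apply Cs_on_plus; [exact HO|apply W, Hw|].
        apply Cs_on_mult; [exact HO|apply W, Hcm|].
        apply (Cs_on_comp s (oball p e) (oball p e)); try assumption.
        -- intros x Hx. apply Rle_lt_trans with (1 := HT x Hx), Hx.
        -- apply Cs_on_weaken, HcT.
      * unfold m1. apply Cs_on_mult; [exact HO|apply Cs_on_weaken, Hcm|apply W, HcT].
      * apply Cs_on_weaken, HcT.
Qed.

Lemma oball_convex p e : forall a b x, oball p e a -> oball p e b -> a <= x <= b -> oball p e x.
Proof.
  unfold oball. intros a b x Ha Hb Hx. apply Rabs_lt_between in Ha.
  apply Rabs_lt_between in Hb. apply Rabs_lt_between. lra.
Qed.

Lemma primitive_oball h p e : 0 < e -> (forall x, oball p e x -> continuous h x) ->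
  exists H : R -> R, H p = 0 /\ forall x, oball p e x -> is_derive H x (h x).
Proof.
  intros He Hc. exists (RInt h p). split; [exact (RInt_point (V:=R_CompleteNormedModule) p h)|].
  assert (Hp : oball p e p) by (unfold oball; rewrite Rminus_diag, Rabs_R0; exact He).
  intros x Hx. apply (is_derive_RInt h (RInt h p) p x); [|apply Hc, Hx].
  apply (locally_on _ _ x (open_oball p e) Hx).
  intros y Hy. apply (RInt_correct h), (ex_RInt_continuous h). intros z Hz. apply Hc.
  unfold Rmin, Rmax in Hz. destruct (Rle_dec p y).
  - apply (oball_convex p e p y); assumption.
  - apply (oball_convex p e y p); assumption.
Qed.

Lemma const_of_derive_0 h (D : R -> Prop) :
  (forall a b x, D a -> D b -> a <= x <= b -> D x) ->
  (forall x, D x -> is_derive h x 0) -> forall x y, D x -> D y -> h x = h y.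
Proof.
  intros HD Hd.
  assert (W : forall x y, D x -> D y -> x < y -> h x = h y).
  { intros x y Hx Hy Hxy. destruct (MVT_itv h (fun _ => 0) x y Hxy) as [c [_ E]]; [|lra].
    intros z Hz. apply Hd, (HD x y); assumption. }
  intros x y Hx Hy. destruct (Rtotal_order x y) as [H|[->|H]]; [apply W|reflexivity|symmetry; apply W];
  assumption.
Qed.

(** Sternberg's theorem in dimension one.  The nonlinearity N = phi''/phi' of a coordinate
    with phi o T = lam phi satisfies N = T''/T' + T' (N o T), where the coefficient T' is
    contracting; conversely the solution N gives phi by two integrations. *)
Lemma local_linearization s T p e lam : 0 < e -> T p = p -> Derive T p = lam ->
  Cs_on (S (S s)) (oball p e) T -> lam <> 0 -> Rabs lam < 1 ->
  exists e' phi, 0 < e' /\ (forall x, oball p e' x -> oball p e' (T x)) /\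
    Cs_on (S (S s)) (oball p e') phi /\ (forall x, oball p e' x -> 0 < Derive phi x) /\
    (forall x, oball p e' x -> phi (T x) = lam * phi x).
Proof.
  intros He HTp HTl HT Hl0 Hl1.
  assert (Hp0 : forall r, 0 < r -> oball p r p) by (intros r Hr; unfold oball; rewrite Rminus_diag, Rabs_R0; exact Hr).
  assert (HT' := proj2 (proj1 (Cs_on_step _ _ _) HT)).
  assert (HT'' := proj2 (proj1 (Cs_on_step _ _ _) HT')).
  assert (Hlp := Rabs_pos_lt lam Hl0).
  set (th := (1 + Rabs lam) / 2).
  assert (Hth : Rabs lam < th < 1) by (unfold th; lra).
  (* a ball on which |T'| stays below th < 1 and away from 0 *)
  assert (Hcd : continuous (Derive T) p) by (eapply Cs_on_continuous; [exact HT'|apply Hp0, He]).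
  destruct (pos_min2 (Rabs lam / 2) (th - Rabs lam)) as (eta & Heta & He1 & He2); [lra..|].
  destruct (continuous_eps (Derive T) p eta Hcd Heta) as [d Hd]. rewrite HTl in Hd.
  destruct (pos_min2 e d He (cond_pos d)) as (e' & He' & He'e & He'd).
  assert (Hsub : forall x, oball p e' x -> oball p e x).
  { unfold oball. intros x Hx. lra. }
  assert (HdT : forall x, oball p e' x -> Rabs (Derive T x - lam) < eta).
  { unfold oball. intros x Hx. apply Hd. lra. }
  assert (HTth : forall x, oball p e' x -> Rabs (Derive T x) <= th).
  { intros x Hx. specialize (HdT x Hx).
    replace (Derive T x) with ((Derive T x - lam) + lam) by ring.
    eapply Rle_trans; [apply Rabs_triang|]. lra. }
  assert (HTn : forall x, oball p e' x -> Derive T x <> 0).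
  { intros x Hx E. specialize (HdT x Hx).
    rewrite E in HdT. replace (0 - lam) with (- lam) in HdT by ring. rewrite Rabs_Ropp in HdT. lra. }
  assert (HTc : forall x, oball p e' x -> Rabs (T x - p) <= Rabs (x - p)).
  { intros x Hx. rewrite <- HTp at 1.
    destruct (Rtotal_order x p) as [Hxp|[->|Hxp]].
    - destruct (MVT_itv T (Derive T) x p Hxp) as [c [Hc E]].
      + intros z Hz. eapply Cs_on_derive; [exact HT|]. apply Hsub.
        apply (oball_convex p e' x p); auto.
      + assert (Hc' : oball p e' c) by (apply (oball_convex p e' x p); auto; lra).
        rewrite (Rabs_minus_sym (T x)), E, Rabs_mult, (Rabs_minus_sym x).
        rewrite <- (Rmult_1_l (Rabs (p - x))) at 2.
        apply Rmult_le_compat_r; [apply Rabs_pos|]. specialize (HTth c Hc'). lra.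
    - rewrite !Rminus_diag. lra.
    - destruct (MVT_itv T (Derive T) p x Hxp) as [c [Hc E]].
      + intros z Hz. eapply Cs_on_derive; [exact HT|]. apply Hsub.
        apply (oball_convex p e' p x); auto.
      + assert (Hc' : oball p e' c) by (apply (oball_convex p e' p x); auto; lra).
        rewrite E, Rabs_mult.
        rewrite <- (Rmult_1_l (Rabs (x - p))) at 2.
        apply Rmult_le_compat_r; [apply Rabs_pos|]. specialize (HTth c Hc'). lra. }
  assert (HO := open_oball p e').
  assert (HTs : Cs_on (S (S s)) (oball p e') T) by (eapply Cs_on_subset; eassumption).
  assert (HTs' : Cs_on (S s) (oball p e') (Derive T)) by (eapply Cs_on_subset; eassumption).
  assert (HTs'' : Cs_on s (oball p e') (Derive (Derive T))) by (eapply Cs_on_subset; eassumption).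
  set (w := fun x => Derive (Derive T) x * / Derive T x).
  set (N := lin_sol w (Derive T) T).
  assert (Hw : Cs_on s (oball p e') w).
  { apply Cs_on_mult; [exact HO|exact HTs''|]. apply Cs_on_inv; [exact HO|exact HTn|].
    apply Cs_on_weaken, HTs'. }
  assert (HN : Cs_on s (oball p e') N).
  { apply (Cs_on_lin_sol s w (Derive T) T p e' th); try assumption.
    - lra.
    - intros x Hx. specialize (HTth x Hx). lra.
    - apply Cs_on_weaken, HTs'.
    - apply (Cs_on_le s (S (S s))); [lia|exact HTs]. }
  assert (HNeq : forall x, oball p e' x -> N x = w x + Derive T x * N (T x)).
  { intros x Hx. apply (lin_sol_eq w (Derive T) T p e' th); try assumption; [lra|].
    intros y Hy. eapply Cs_on_continuous; [exact Hw|exact Hy]. }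
  destruct (primitive_oball N p e' He') as [I [HI0 HI]].
  { intros x Hx. eapply Cs_on_continuous; eassumption. }
  assert (HIs : Cs_on (S s) (oball p e') I) by (eapply Cs_on_intro; eassumption).
  set (E := fun x => exp (I x)).
  assert (HEs : Cs_on (S s) (oball p e') E).
  { refine (Cs_on_comp (S s) (oball p e') (fun _ => True) exp I HO open_true _ _ HIs).
    - intros; exact Logic.I.
    - apply Cs_on_exp, open_true. }
  assert (HE : forall x, oball p e' x -> is_derive E x (N x * exp (I x))).
  { intros x Hx. apply (is_derive_comp exp I); [apply is_derive_exp|apply HI, Hx]. }
  destruct (primitive_oball E p e' He') as [phi [Hphi0 Hphi]].
  { intros x Hx. eapply Cs_on_continuous; eassumption. }
  assert (HTJ : forall x, oball p e' x -> oball p e' (T x)).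
  { intros x Hx. apply Rle_lt_trans with (1 := HTc x Hx), Hx. }
  assert (HdTx : forall x, oball p e' x -> is_derive T x (Derive T x)).
  { intros x Hx. eapply Cs_on_derive; eassumption. }
  (* E (T x) T'(x) / E x is constant: its logarithmic derivative T' (N o T) + T''/T' - N is 0 *)
  assert (HZ : forall x, oball p e' x -> E (T x) * Derive T x = lam * E x).
  { intros x Hx.
    assert (HZ0 : forall x, oball p e' x ->
      is_derive (fun x => exp (I (T x) - I x) * Derive T x) x 0).
    { intros y Hy.
      replace 0 with ((Derive T y * N (T y) - N y) * exp (I (T y) - I y) * Derive T y
         + exp (I (T y) - I y) * Derive (Derive T) y).
      - apply (is_derive_mult (fun y => exp (I (T y) - I y)) (Derive T)).
        + apply (is_derive_comp exp (fun y => I (T y) - I y)); [apply is_derive_exp|].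
          apply (is_derive_minus (fun y => I (T y)) I); [|apply HI, Hy].
          apply (is_derive_comp I T); [apply HI, HTJ, Hy|apply HdTx, Hy].
        + eapply Cs_on_derive; eassumption.
        + intros; apply Rmult_comm.
      - rewrite (HNeq y Hy). unfold w. field. apply HTn, Hy. }
    assert (C := const_of_derive_0 _ _ (oball_convex p e') HZ0 x p Hx (Hp0 e' He')).
    cbv beta in C. rewrite HTp, Rminus_diag, exp_0, HTl, Rmult_1_l in C.
    rewrite <- C. unfold E. replace (I (T x)) with ((I (T x) - I x) + I x) at 1 by ring.
    rewrite exp_plus. ring. }
  exists e', phi. split; [exact He'|]. split; [exact HTJ|].
  split; [eapply Cs_on_intro; eassumption|].
  split.
  { intros x Hx. rewrite (is_derive_unique phi x _ (Hphi x Hx)). apply exp_pos. }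
  intros x Hx.
  assert (HD0 : forall x, oball p e' x -> is_derive (fun x => phi (T x) - lam * phi x) x 0).
  { intros y Hy. replace 0 with (Derive T y * E (T y) - lam * E y).
    - apply (is_derive_minus (fun y => phi (T y)) (fun y => lam * phi y)).
      + apply (is_derive_comp phi T); [apply Hphi, HTJ, Hy|apply HdTx, Hy].
      + apply (is_derive_scal phi), Hphi, Hy.
    - rewrite <- (HZ y Hy). ring. }
  assert (C := const_of_derive_0 _ _ (oball_convex p e') HD0 x p Hx (Hp0 e' He')).
  cbv beta in C. rewrite HTp, Hphi0 in C. lra.
Qed.

Lemma iter_swap (T : R -> R) n x : Nat.iter n T (T x) = T (Nat.iter n T x).
Proof. induction n as [|n IH]; simpl; [reflexivity|]. rewrite IH. reflexivity. Qed.

Lemma iter_in (U : R -> Prop) (T : R -> R) x n :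
  (forall x, U x -> U (T x)) -> U x -> U (Nat.iter n T x).
Proof. intros H Hx. induction n; simpl; auto. Qed.

(** The coordinate extends from a neighbourhood of [p] to the whole basin by
    phi(x) = lam^-n phi(T^n x).  Its smoothness and the sign of its derivative propagate backwards
    along orbits, by induction on the number of steps needed to enter the neighbourhood. *)
Lemma linearization s T U p lam :
  open U -> U p -> (forall x, U x -> U (T x)) -> Cs_on (S (S s)) U T ->
  T p = p -> Derive T p = lam -> lam <> 0 -> Rabs lam < 1 ->
  (forall x, U x -> 0 < lam * Derive T x) ->
  (forall x, U x -> is_lim_seq (fun n => Nat.iter n T x) p) ->
  exists phi, Cs_on (S (S s)) U phi /\ (forall x, U x -> 0 < Derive phi x) /\
    (forall x, U x -> phi (T x) = lam * phi x).
Proof.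
  intros HO Hp HU HT HTp HTl Hl0 Hl1 Hsgn Hconv.
  destruct (locally_Rabs U p (HO p Hp)) as [e He].
  assert (HTe : Cs_on (S (S s)) (oball p e) T) by (eapply Cs_on_subset; [exact He|exact HT]).
  destruct (local_linearization s T p e lam (cond_pos e) HTp HTl HTe Hl0 Hl1)
    as (e' & phl & He' & HJT & Hphs & Hphd & Hphe).
  set (J := oball p e') in *.
  assert (HJi : forall k x, J x -> J (Nat.iter k T x) /\ phl (Nat.iter k T x) = lam ^ k * phl x).
  { induction k as [|k IH]; intros x Hx; simpl; [split; [exact Hx|ring]|].
    destruct (IH x Hx) as [A B]. split; [apply HJT, A|].
    rewrite (Hphe _ A), B. ring. }
  assert (Hlk : forall k, lam ^ k <> 0) by (intros; apply pow_nonzero, Hl0).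
  pose (nx := fun x => epsilon (inhabits O) (fun n => J (Nat.iter n T x))).
  set (phi := fun x => phl (Nat.iter (nx x) T x) / lam ^ nx x).
  assert (Hex : forall x, U x -> exists n, J (Nat.iter n T x)).
  { intros x Hx. assert (L := Hconv x Hx). apply is_lim_seq_spec in L.
    destruct (L (mkposreal _ He')) as [n Hn]. exists n. apply (Hn n). lia. }
  assert (HA : forall n x, J (Nat.iter n T x) -> phi x = phl (Nat.iter n T x) / lam ^ n).
  { assert (W : forall a b x, J (Nat.iter a T x) -> (a <= b)%nat ->
       phl (Nat.iter a T x) / lam ^ a = phl (Nat.iter b T x) / lam ^ b).
    { intros a b x Ha Hab. replace b with ((b - a) + a)%nat by lia.
      rewrite Nat.iter_add. rewrite (proj2 (HJi (b - a)%nat _ Ha)), pow_add.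
      field. split; apply Hlk. }
    intros n x Hn.
    assert (Hx : J (Nat.iter (nx x) T x)).
    { apply (epsilon_spec (inhabits O) (fun n => J (Nat.iter n T x))). exists n. exact Hn. }
    unfold phi. destruct (Nat.le_ge_cases (nx x) n).
    - apply W; assumption.
    - symmetry. apply W; assumption. }
  assert (HB : forall x, U x -> phi (T x) = lam * phi x).
  { intros x Hx. destruct (Hex (T x) (HU x Hx)) as [n Hn].
    rewrite (HA n (T x) Hn). rewrite iter_swap in *.
    change (T (Nat.iter n T x)) with (Nat.iter (S n) T x) in *.
    rewrite (HA (S n) x Hn). simpl (lam ^ S n). field. split; [apply Hlk|exact Hl0]. }
  set (Jn := fun n x => U x /\ J (Nat.iter n T x)).
  assert (HJs : forall n x, Jn (S n) x <-> U x /\ Jn n (T x)).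
  { intros n x. unfold Jn. simpl. rewrite iter_swap. split; [|tauto].
    intros [A B]. auto. }
  assert (HJo : forall n, open (Jn n)).
  { induction n as [|n IH].
    - apply (open_and U J); [exact HO|apply open_oball].
    - intros x Hx. apply HJs in Hx. destruct Hx as [HUx Hx].
      assert (C : continuous T x) by (apply (Cs_on_continuous _ U T x HT HUx)).
      assert (L1 : locally x (fun y => Jn n (T y))) by exact (C _ (IH _ Hx)). assert (L2 := HO x HUx).
      refine (filter_imp (fun y => Jn n (T y) /\ U y) _ _ (filter_and _ _ L1 L2)).
      intros y [A B]. apply HJs. split; assumption. }
  assert (HC : forall n, Cs_on (S (S s)) (Jn n) phi /\ forall x, Jn n x -> 0 < Derive phi x).
  { induction n as [|n [IH1 IH2]].
    - assert (E : forall x, Jn O x -> phl x = phi x).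
      { intros x [_ Hx]. rewrite (HA O x Hx). simpl. field. }
      split.
      + apply (Cs_on_ext _ (Jn O) phl); [apply HJo|exact E|].
        eapply Cs_on_subset; [|exact Hphs]. intros x [_ Hx]. exact Hx.
      + intros x Hx. rewrite <- (Derive_ext_on (Jn O) phl phi x (HJo O) Hx E). apply Hphd, Hx.
    - assert (E : forall x, Jn (S n) x -> / lam * phi (T x) = phi x).
      { intros x [Hx _]. rewrite (HB x Hx). field. exact Hl0. }
      split.
      + apply (Cs_on_ext _ (Jn (S n)) (fun x => / lam * phi (T x))); [apply HJo|exact E|].
        apply Cs_on_scal; [apply HJo|].
        apply (Cs_on_comp _ (Jn (S n)) (Jn n) phi T); try apply HJo.
        * intros x Hx. apply HJs, Hx.
        * exact IH1.
        * eapply Cs_on_subset; [|exact HT]. intros x Hx. apply Hx.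
      + intros x Hx. assert (Hx' := proj1 (HJs n x) Hx). destruct Hx' as [HUx HTx].
        assert (D : is_derive phi x (/ lam * (Derive T x * Derive phi (T x)))).
        { apply (is_derive_ext_on (Jn (S n)) (fun x => / lam * phi (T x))); try assumption.
          - apply HJo.
          - apply (is_derive_scal (fun x => phi (T x))).
            apply (is_derive_comp phi T).
            + eapply Cs_on_derive; [exact IH1|exact HTx].
            + eapply Cs_on_derive; [exact HT|exact HUx]. }
        rewrite (is_derive_unique _ _ _ D).
        replace (/ lam * (Derive T x * Derive phi (T x)))
          with ((lam * Derive T x) * (/ lam * / lam) * Derive phi (T x)) by (field; exact Hl0).
        apply Rmult_lt_0_compat; [|apply IH2, HTx].
        apply Rmult_lt_0_compat; [apply Hsgn, HUx|].
        assert (0 < / lam * / lam); [|assumption].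
        apply Rsqr_pos_lt, Rinv_neq_0_compat, Hl0. }
  exists phi. split; [|split; [|exact HB]]; intros x Hx; destruct (Hex x Hx) as [n Hn].
  - apply (proj1 (HC n)). split; assumption.
  - apply (proj2 (HC n)). split; assumption.
Qed.

(** * Attracting crossings and second iterates of decreasing maps *)

Lemma iter_limit_fixed (T : R -> R) x (L : R) : is_lim_seq (fun n => Nat.iter n T x) L ->
  continuous T L -> T L = L.
Proof.
  intros HL Hc.
  assert (H1 := HL). apply is_lim_seq_incr_1 in H1.
  assert (H2 := is_lim_seq_continuous T _ L (proj2 (continuity_pt_filterlim T L) Hc) HL).
  assert (E := is_lim_seq_unique _ _ H1).
  change (Lim_seq (fun n => T (Nat.iter n T x)) = L) in E.
  rewrite (is_lim_seq_unique _ _ H2) in E. injection E as E. exact E.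
Qed.

Lemma attract_above (T : R -> R) c u : (forall x, c <= x < u -> continuous T x) ->
  (forall x, c < x < u -> c < T x < x) -> forall x, c < x < u ->
  (forall n, c < Nat.iter n T x <= x) /\ is_lim_seq (fun n => Nat.iter n T x) c.
Proof.
  intros Hc HT x Hx.
  assert (HI : forall n, c < Nat.iter n T x <= x).
  { induction n as [|n IH]; simpl; [lra|].
    assert (B := HT (Nat.iter n T x) ltac:(lra)). lra. }
  split; [exact HI|].
  destruct (ex_finite_lim_seq_decr (fun n => Nat.iter n T x) c) as [L HL].
  - intros n. simpl. specialize (HI n). assert (B := HT (Nat.iter n T x) ltac:(lra)). lra.
  - intros n. specialize (HI n). lra.
  - assert (HLb : c <= L <= x).
    { split.
      - apply (is_lim_seq_le (fun _ => c) (fun n => Nat.iter n T x) c L);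
          [intros n; specialize (HI n); lra|apply is_lim_seq_const|exact HL].
      - apply (is_lim_seq_le (fun n => Nat.iter n T x) (fun _ => x) L x);
          [intros n; specialize (HI n); lra|exact HL|apply is_lim_seq_const]. }
    assert (E := iter_limit_fixed T x L HL (Hc L ltac:(lra))).
    destruct (Req_dec L c) as [->|Hne]; [exact HL|].
    assert (B := HT L ltac:(lra)). lra.
Qed.

Lemma iter_opp (T : R -> R) x n : Nat.iter n (fun x => - T (- x)) (- x) = - Nat.iter n T x.
Proof. induction n as [|n IH]; simpl; [reflexivity|]. rewrite IH, Ropp_involutive. reflexivity. Qed.

Lemma attract_below (T : R -> R) l c : (forall x, l < x <= c -> continuous T x) ->
  (forall x, l < x < c -> x < T x < c) -> forall x, l < x < c ->
  (forall n, x <= Nat.iter n T x < c) /\ is_lim_seq (fun n => Nat.iter n T x) c.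
Proof.
  intros Hc HT x Hx.
  destruct (attract_above (fun x => - T (- x)) (- c) (- l)) with (x := - x) as [A B].
  - intros y Hy. apply (continuous_opp (fun y => T (- y))).
    apply (continuous_comp (fun y => - y) T).
    + apply (continuous_opp (fun y => y)), continuous_id.
    + apply Hc. lra.
  - intros y Hy. assert (C := HT (- y) ltac:(lra)). lra.
  - lra.
  - split.
    + intros n. specialize (A n). rewrite iter_opp in A. lra.
    + apply (is_lim_seq_ext (fun n => - Nat.iter n (fun x => - T (- x)) (- x))).
      * intros n. rewrite iter_opp. ring.
      * apply is_lim_seq_opp in B. simpl in B. rewrite Ropp_involutive in B. exact B.
Qed.

Lemma iter_fixed (T : R -> R) c n : T c = c -> Nat.iter n T c = c.
Proof. intros E. induction n as [|n IH]; simpl; [reflexivity|]. rewrite IH. exact E. Qed.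

(** Every attractor met below is of this kind for the second iterate: an increasing map that
    crosses the diagonal downwards, so that all orbits approach [c] monotonically. *)
Definition crossing (T : R -> R) (l c u : R) : Prop :=
  l < c < u /\ T c = c /\ (forall x, itv l u x -> continuous T x) /\
  (forall x y, itv l u x -> itv l u y -> x < y -> T x < T y) /\
  (forall x, l < x < c -> x < T x) /\ (forall x, c < x < u -> T x < x).

Lemma crossing_attract T l c u : crossing T l c u -> forall x, itv l u x ->
  (forall n, Rabs (Nat.iter n T x - c) <= Rabs (x - c)) /\
  is_lim_seq (fun n => Nat.iter n T x) c.
Proof.
  intros (Hc & E & HC & HM & HB & HA) x Hx. unfold itv in *.
  destruct (Rtotal_order x c) as [H|[->|H]].
  - destruct (attract_below T l c) with (x := x) as [A B].
    + intros y Hy. apply HC. lra.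
    + intros y Hy. specialize (HB y Hy). assert (D := HM y c). lra.
    + lra.
    + split; [|exact B]. intros n. specialize (A n). rewrite !Rabs_left1; lra.
  - split.
    + intros n. rewrite iter_fixed by exact E. lra.
    + apply (is_lim_seq_ext (fun _ => c)); [|apply is_lim_seq_const].
      intros n. rewrite iter_fixed by exact E. reflexivity.
  - destruct (attract_above T c u) with (x := x) as [A B].
    + intros y Hy. apply HC. lra.
    + intros y Hy. specialize (HA y Hy). assert (D := HM c y). lra.
    + lra.
    + split; [|exact B]. intros n. specialize (A n). rewrite !Rabs_pos_eq; lra.
Qed.

Lemma crossing_stable T l c u : crossing T l c u -> stable_fixed_point T c.
Proof.
  intros HX. assert (HX' := HX). destruct HX' as ((Hl & Hu) & E & _).
  destruct (pos_min2 (c - l) (u - c)) as (e & He & He1 & He2); [lra..|].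
  assert (HJ : forall x, Rabs (x - c) < e -> itv l u x).
  { intros x Hx. apply Rabs_lt_between in Hx. unfold itv. lra. }
  split; [exact E|]. split.
  - intros eps. destruct (pos_min2 eps e (cond_pos eps) He) as (dl & Hdl & A & B).
    exists (mkposreal _ Hdl). intros x Hx n. simpl in Hx.
    apply Rle_lt_trans with (Rabs (x - c)); [|lra].
    apply (crossing_attract T l c u HX). apply HJ. lra.
  - exists (mkposreal _ He). intros x Hx. apply (crossing_attract T l c u HX), HJ, Hx.
Qed.

(** Regularity is required on an interval twice as large as (-d, d), so that second iterates
    of points of (-d, d) are under control. *)
Definition flip (r : nat) (d : R) (F : R -> R) : Prop :=
  0 < d /\ F 0 = 0 /\ Cs_on r (itv (- (2 * d)) (2 * d)) F /\
  forall x, itv (- (2 * d)) (2 * d) x -> -2 <= Derive F x <= - / 2.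

Definition sink (d : R) (F : R -> R) : Prop := forall x, 0 < x < d -> F (F x) < x.

(** [q] is the positive point of an orbit of period 2; the last two clauses give the direction
    in which F o F moves the other points of (0, d). *)
Definition cycle (d : R) (F : R -> R) (q : R) : Prop :=
  0 < q < d /\ F (F q) = q /\ Derive F q * Derive F (F q) < 1 /\
  (forall x, 0 < x < q -> x < F (F x)) /\ (forall x, q < x < d -> F (F x) < x).

Lemma square_derivatives (F F1 F2 F3 : R -> R) x :
  is_derive F x (F1 x) /\ is_derive F1 x (F2 x) /\ is_derive F2 x (F3 x) ->
  is_derive F (F x) (F1 (F x)) /\ is_derive F1 (F x) (F2 (F x)) /\ is_derive F2 (F x) (F3 (F x)) ->
  is_derive (fun x => F (F x)) x (F1 x * F1 (F x)) /\
  is_derive (fun x => F1 x * F1 (F x)) x (F2 (F x) * F1 x ^ 2 + F1 (F x) * F2 x) /\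
  is_derive (fun x => F2 (F x) * F1 x ^ 2 + F1 (F x) * F2 x) x
    (F3 (F x) * F1 x ^ 3 + 3 * F2 (F x) * F1 x * F2 x + F1 (F x) * F3 x).
Proof.
  intros (a1 & a2 & a3) (b1 & b2 & b3). split; [|split].
  - apply (is_derive_comp F F); assumption.
  - replace (F2 (F x) * F1 x ^ 2 + F1 (F x) * F2 x)
      with (F2 x * F1 (F x) + F1 x * (F1 x * F2 (F x))) by ring.
    apply (is_derive_mult F1 (fun x => F1 (F x))); [assumption| |intros; apply Rmult_comm].
    apply (is_derive_comp F1 F); assumption.
  - replace (F3 (F x) * F1 x ^ 3 + 3 * F2 (F x) * F1 x * F2 x + F1 (F x) * F3 x)
      with (((F1 x * F3 (F x)) * F1 x ^ 2 + F2 (F x) * (INR 2 * F2 x * F1 x ^ 1))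
       + ((F1 x * F2 (F x)) * F2 x + F1 (F x) * F3 x)) by (simpl; ring).
    apply (is_derive_plus (fun x => F2 (F x) * F1 x ^ 2) (fun x => F1 (F x) * F2 x)).
    + apply (is_derive_mult (fun x => F2 (F x)) (fun x => F1 x ^ 2)); [| |intros; apply Rmult_comm].
      * apply (is_derive_comp F2 F); assumption.
      * apply is_derive_pow. assumption.
    + apply (is_derive_mult (fun x => F1 (F x)) F2); [| |intros; apply Rmult_comm].
      * apply (is_derive_comp F1 F); assumption.
      * assumption.
Qed.

(** Let A = F o F and L = F'(0)^2 - 1.  The quadratic coefficient of A at 0 contains the
    factor 1 + F'(0), hence it is L times a bounded number be, and A(x) - x = L P(x) + R(x) with
    P(x) = x + be x^2 and R of third order.  So A(x) - x has the sign of L + R(x)/P(x).  The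
    numerator W of the derivative of R/P is negative because R''' is, and R/P decreases strictly
    from its limit 0 at 0: there is no zero if L <= 0, and a single transversal one if L > 0. *)
Lemma square_dynamics (F F1 F2 F3 : R -> R) d B K m :
  0 < d -> 0 <= B -> 0 < K -> 0 < m -> F 0 = 0 ->
  (forall x, Rabs x < 2 * d -> is_derive F x (F1 x) /\ is_derive F1 x (F2 x) /\ is_derive F2 x (F3 x)) ->
  (forall x, Rabs x < 2 * d -> -2 <= F1 x <= - / 2) ->
  (forall x, Rabs x < d -> Rabs (F x) < 2 * d) ->
  Rabs (F2 0) <= B -> B * d <= / 2 -> 8 * B * K * d <= m ->
  (forall x, 0 <= x < d ->
     - K <= F3 (F x) * F1 x ^ 3 + 3 * F2 (F x) * F1 x * F2 x + F1 (F x) * F3 x <= - m) ->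
  (F1 0 ^ 2 <= 1 -> forall x, 0 < x < d -> F (F x) < x) /\
  (1 < F1 0 ^ 2 -> (exists x, 0 < x < d /\ F (F x) < x) ->
   exists q, 0 < q < d /\ F (F q) = q /\ F1 q * F1 (F q) < 1 /\
    (forall x, 0 < x < q -> x < F (F x)) /\ (forall x, q < x < d -> F (F x) < x)).
Proof.
  intros Hd HB HK Hm HF0 HF HF1 HFd HB2 HBd HBK HA3.
  set (lam := F1 0). set (L := lam ^ 2 - 1). set (be := F2 0 * lam / (2 * (lam - 1))).
  assert (Hlam : -2 <= lam <= - / 2) by (apply HF1; rewrite Rabs_R0; lra).
  assert (Hbe : Rabs be <= B).
  { unfold be. replace (F2 0 * lam / (2 * (lam - 1))) with (F2 0 * (lam / (2 * (lam - 1)))) by (field; lra).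
    rewrite Rabs_mult. rewrite <- (Rmult_1_r B). apply Rmult_le_compat; try apply Rabs_pos; [exact HB2|].
    apply Rabs_le_between. split; apply (Rmult_le_reg_r (2 * (1 - lam))); try lra;
    [replace (lam / (2 * (lam - 1)) * (2 * (1 - lam))) with (- lam) by (field; lra); lra|].
    replace (lam / (2 * (lam - 1)) * (2 * (1 - lam))) with (- lam) by (field; lra). lra. }
  set (A1 := fun x => F1 x * F1 (F x)).
  set (A2 := fun x => F2 (F x) * F1 x ^ 2 + F1 (F x) * F2 x).
  set (A3 := fun x => F3 (F x) * F1 x ^ 3 + 3 * F2 (F x) * F1 x * F2 x + F1 (F x) * F3 x).
  assert (Hx2 : forall x, Rabs x < d -> Rabs x < 2 * d) by (intros; lra).
  assert (DAll := fun x (Hx : Rabs x < d) =>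
    square_derivatives F F1 F2 F3 x (HF x (Hx2 x Hx)) (HF (F x) (HFd x Hx))).
  assert (DA : forall x, Rabs x < d -> is_derive (fun x => F (F x)) x (A1 x)).
  { intros x Hx. apply (DAll x Hx). }
  assert (DA1 : forall x, Rabs x < d -> is_derive A1 x (A2 x)).
  { intros x Hx. apply (DAll x Hx). }
  assert (DA2 : forall x, Rabs x < d -> is_derive A2 x (A3 x)).
  { intros x Hx. apply (DAll x Hx). }
  set (P := fun x => x + be * x ^ 2). set (P1 := fun x => 1 + 2 * be * x).
  set (Rr := fun x => F (F x) - x - L * P x).
  set (R1 := fun x => A1 x - 1 - L * P1 x).
  set (R2 := fun x => A2 x - 2 * L * be).
  assert (DP : forall x, is_derive P x (P1 x)).
  { intros x. unfold P, P1. auto_derive; [exact Logic.I|ring]. }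
  assert (DP1 : forall x, is_derive P1 x (2 * be)).
  { intros x. unfold P1. auto_derive; [exact Logic.I|ring]. }
  assert (DR : forall x, Rabs x < d -> is_derive Rr x (R1 x)).
  { intros x Hx. apply (is_derive_minus (fun x => F (F x) - x) (fun x => L * P x)).
    - apply (is_derive_minus (fun x => F (F x)) (fun x => x)); [apply DA, Hx|apply (is_derive_id x)].
    - apply (is_derive_scal P), DP. }
  assert (DR1 : forall x, Rabs x < d -> is_derive R1 x (R2 x)).
  { intros x Hx. unfold R2. replace (A2 x - 2 * L * be) with (A2 x - 0 - L * (2 * be)) by ring.
    apply (is_derive_minus (fun x => A1 x - 1) (fun x => L * P1 x)).
    - apply (is_derive_minus A1 (fun x => 1)); [apply DA1, Hx|apply (is_derive_const 1 x)].
    - apply (is_derive_scal P1), DP1. }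
  assert (DR2 : forall x, Rabs x < d -> is_derive R2 x (A3 x)).
  { intros x Hx. replace (A3 x) with (A3 x - 0) by ring.
    apply (is_derive_minus A2 (fun x => 2 * L * be)); [apply DA2, Hx|].
    apply (is_derive_const (2 * L * be) x). }
  assert (Habs : forall x, 0 <= x < d -> Rabs x < d) by (intros; rewrite Rabs_pos_eq; lra).
  assert (R00 : Rr 0 = 0) by (unfold Rr, P; rewrite !HF0; ring).
  assert (R10 : R1 0 = 0) by (unfold R1, A1, P1; rewrite HF0; fold lam; unfold L; ring).
  assert (R20 : R2 0 = 0).
  { unfold R2, A2. rewrite HF0. fold lam. unfold L, be. field. lra. }
  assert (BR2 : forall x, 0 < x < d -> - K * x <= R2 x <= - m * x).
  { intros x Hx. destruct (MVT_itv R2 A3 0 x) as [c [Hc E]]; [lra|intros; apply DR2, Habs; lra|].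
    rewrite R20 in E. assert (B3 := HA3 c ltac:(lra)). fold (A3 c) in B3. split; nra. }
  assert (BR1 : forall x, 0 < x < d -> - K * x ^ 2 <= R1 x <= 0).
  { intros x Hx. destruct (MVT_itv R1 R2 0 x) as [c [Hc E]]; [lra|intros; apply DR1, Habs; lra|].
    rewrite R10 in E. assert (B3 := BR2 c ltac:(lra)).
    assert (- K * x <= R2 c <= 0) by (split; nra). split; nra. }
  assert (BR : forall x, 0 < x < d -> - K * x ^ 3 <= Rr x <= 0).
  { intros x Hx. destruct (MVT_itv Rr R1 0 x) as [c [Hc E]]; [lra|intros; apply DR, Habs; lra|].
    rewrite R00 in E. assert (B3 := BR1 c ltac:(lra)).
    assert (c ^ 2 <= x ^ 2) by nra.
    assert (- K * x ^ 2 <= R1 c <= 0) by (split; nra). split; nra. }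
  assert (HP : forall x, 0 < x < d -> x / 2 <= P x).
  { intros x Hx. unfold P. apply Rabs_le_between in Hbe.
    assert (- / 2 <= be * x) by nra. nra. }
  set (W := fun x => R1 x * P x - Rr x * P1 x).
  assert (DW : forall x, Rabs x < d -> is_derive W x (R2 x * P x - 2 * be * Rr x)).
  { intros x Hx. replace (R2 x * P x - 2 * be * Rr x) with
      ((R2 x * P x + R1 x * P1 x) - (R1 x * P1 x + Rr x * (2 * be))) by ring.
    apply (is_derive_minus (fun x => R1 x * P x) (fun x => Rr x * P1 x)).
    - apply (is_derive_mult R1 P); [apply DR1, Hx|apply DP|intros; apply Rmult_comm].
    - apply (is_derive_mult Rr P1); [apply DR, Hx|apply DP1|intros; apply Rmult_comm]. }
  assert (HW' : forall x, 0 < x < d -> R2 x * P x - 2 * be * Rr x < 0).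
  { intros x Hx. assert (B2 := BR2 x Hx). assert (B0 := BR x Hx). assert (HPx := HP x Hx).
    assert (T1 : R2 x * P x <= - m * x * (x / 2)).
    { assert (m * x * (x / 2) <= (- R2 x) * P x) by (apply Rmult_le_compat; try lra; apply Rmult_le_pos; lra). lra. }
    assert (T2 : - 2 * be * Rr x <= 2 * B * (K * x ^ 3)).
    { apply Rle_trans with (Rabs (- 2 * be * Rr x)); [apply Rle_abs|].
      rewrite !Rabs_mult. rewrite (Rabs_left (-2)) by lra.
      replace (- - 2) with 2 by ring.
      apply Rmult_le_compat; [|apply Rabs_pos| |].
      - apply Rmult_le_pos; [lra|apply Rabs_pos].
      - apply Rmult_le_compat_l; [lra|exact Hbe].
      - apply Rabs_le_between. lra. }
    assert (T3 : 8 * B * K * x <= m).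
    { apply Rle_trans with (2 := HBK). apply Rmult_le_compat_l; [|lra].
      apply Rmult_le_pos; [|lra]. lra. }
    assert (T4 : 2 * B * (K * x ^ 3) <= m * x ^ 2 / 4).
    { replace (2 * B * (K * x ^ 3)) with ((8 * B * K * x) * (x ^ 2 / 4)) by field.
      replace (m * x ^ 2 / 4) with (m * (x ^ 2 / 4)) by field.
      apply Rmult_le_compat_r; [nra|exact T3]. }
    assert (0 < m * x ^ 2) by (apply Rmult_lt_0_compat; nra). nra. }
  assert (HW : forall x, 0 < x < d -> W x < 0).
  { intros x Hx. destruct (MVT_itv W (fun x => R2 x * P x - 2 * be * Rr x) 0 x) as [c [Hc E]];
      [lra|intros; apply DW, Habs; lra|].
    assert (W0 : W 0 = 0) by (unfold W; rewrite R10, R00; ring).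
    rewrite W0 in E. assert (B3 := HW' c ltac:(lra)). cbv beta in E. nra. }
  assert (BR' : forall x, 0 < x < d -> Rr x < 0).
  { intros x Hx. destruct (MVT_itv Rr R1 0 x) as [c [Hc E]]; [lra|intros; apply DR, Habs; lra|].
    rewrite R00 in E.
    destruct (MVT_itv R1 R2 0 c) as [c2 [Hc2 E2]]; [lra|intros; apply DR1, Habs; lra|].
    rewrite R10 in E2. assert (B3 := BR2 c2 ltac:(lra)).
    assert (R2 c2 < 0) by nra. assert (R1 c < 0) by nra. nra. }
  split.
  - intros HL x Hx. assert (B0 := BR' x Hx). assert (HPx := HP x Hx). unfold Rr in B0.
    assert (HLn : L <= 0) by (unfold L; lra). assert (L * P x <= 0) by nra. lra.
  - intros HL [x1 [Hx1 HA1]].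
    assert (HL' : 0 < L) by (unfold L; lra).
    set (Th := fun x => Rr x / P x).
    assert (DTh : forall x, 0 < x < d -> is_derive Th x (W x / P x ^ 2)).
    { intros x Hx. assert (HPx := HP x Hx). unfold W.
      apply is_derive_div; [apply DR, Habs; lra|apply DP|lra]. }
    assert (HTh : forall x y, 0 < x < d -> 0 < y < d -> x < y -> Th y < Th x).
    { apply (decreasing_itv Th (fun x => W x / P x ^ 2) (fun x => 0 < x < d)).
      - intros; lra.
      - exact DTh.
      - intros x Hx. assert (HPx := HP x Hx). assert (HWx := HW x Hx).
        unfold Rdiv. assert (0 < / P x ^ 2) by (apply Rinv_0_lt_compat, pow_lt; lra). nra. }
    assert (EF : forall x, 0 < x < d -> F (F x) - x = P x * (L + Th x)).
    { intros x Hx. assert (HPx := HP x Hx). unfold Th, Rr. field. lra. }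
    destruct (pos_min2 (x1 / 2) (L / (4 * K * d))) as (x0 & Hx0 & Hx01 & HxL); [lra| |].
    { apply Rdiv_lt_0_compat; [lra|]. nra. }
    assert (Hx0L : x0 * (4 * K * d) <= L).
    { apply Rmult_le_compat_r with (r := 4 * K * d) in HxL; [|nra].
      replace (L / (4 * K * d) * (4 * K * d)) with L in HxL by (field; lra). exact HxL. }
    assert (HTh0 : 0 < L + Th x0).
    { assert (B0 := BR x0 ltac:(lra)). assert (HPx := HP x0 ltac:(lra)).
      apply (Rmult_lt_reg_l (P x0)); [lra|]. rewrite Rmult_0_r.
      replace (P x0 * (L + Th x0)) with (L * P x0 + Rr x0) by (unfold Th; field; lra).
      assert (T1 : L * (x0 / 2) <= L * P x0) by (apply Rmult_le_compat_l; lra).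
      assert (T2 : K * x0 ^ 3 <= L * x0 / 4).
      { assert (K * x0 * x0 * x0 <= K * x0 * d * x0).
        { apply Rmult_le_compat_r; [lra|]. apply Rmult_le_compat_l; [nra|lra]. }
        nra. }
      nra. }
    assert (HTh1 : L + Th x1 < 0).
    { assert (HPx := HP x1 Hx1). assert (E := EF x1 Hx1). nra. }
    destruct (IVT_between (fun x => - (L + Th x)) x0 x1 0) as [q [Hq Eq]].
    + lra.
    + intros x Hx. apply (is_derive_continuous _ _ (- (0 + W x / P x ^ 2))). apply (is_derive_opp (fun x => L + Th x)).
      apply (is_derive_plus (fun _ => L) Th); [apply (is_derive_const L x)|apply DTh; lra].
    + lra.
    + exists q. assert (Hq0 : 0 < q < d) by lra.
      assert (HPq := HP q Hq0). assert (HWq := HW q Hq0).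
      assert (EFq := EF q Hq0). replace (L + Th q) with 0 in EFq by lra.
      split; [exact Hq0|]. split; [lra|]. split; [|split].
      * fold (A1 q).
        assert (EW : W q = (A1 q - 1) * P q - (F (F q) - q) * P1 q) by (unfold W, R1, Rr; ring).
        rewrite EFq, Rmult_0_r, Rmult_0_l, Rminus_0_r in EW. nra.
      * intros x Hx. assert (T := HTh x q ltac:(lra) Hq0 ltac:(lra)).
        assert (E := EF x ltac:(lra)). assert (HPx := HP x ltac:(lra)).
        assert (0 < P x * (L + Th x)) by (apply Rmult_lt_0_compat; lra). lra.
      * intros x Hx. assert (T := HTh q x Hq0 ltac:(lra) ltac:(lra)).
        assert (E := EF x ltac:(lra)). assert (HPx := HP x ltac:(lra)).
        assert (0 < P x * - (L + Th x)) by (apply Rmult_lt_0_compat; lra). lra.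
Qed.

(** * Decreasing maps near a fixed point: cycles and basins *)

Lemma flip_der r d F x : flip (S r) d F -> - (2 * d) < x < 2 * d -> is_derive F x (Derive F x).
Proof. intros (_ & _ & H & _) Hx. apply (Cs_on_derive r _ F x H Hx). Qed.

Lemma flip_cont r d F x : flip (S r) d F -> - (2 * d) < x < 2 * d -> continuous F x.
Proof. intros (_ & _ & H & _) Hx. apply (Cs_on_continuous _ _ F x H Hx). Qed.

Lemma flip_decr r d F x y : flip (S r) d F -> - (2 * d) < x -> y < 2 * d -> x < y -> F y < F x.
Proof.
  intros H Hx Hy Hxy.
  apply (decreasing_itv F (Derive F) (itv (- (2 * d)) (2 * d))); try (unfold itv; lra).
  - apply itv_convex.
  - intros z Hz. apply (flip_der r d); assumption.
  - intros z Hz. destruct H as (_ & _ & _ & B). specialize (B z Hz). lra.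
Qed.

Lemma flip_decr_inv r d F x y : flip (S r) d F -> - (2 * d) < x < 2 * d -> - (2 * d) < y < 2 * d ->
  F y < F x -> x < y.
Proof.
  intros H Hx Hy E. destruct (Rtotal_order x y) as [T|[->|T]]; [exact T|lra|].
  assert (B := flip_decr r d F y x H). lra.
Qed.

Lemma flip_pos r d F x : flip (S r) d F -> 0 < x < 2 * d -> - (2 * x) <= F x <= - (x / 2).
Proof.
  intros H Hx. assert (H' := H). destruct H' as (Hd & F0 & _ & B).
  destruct (MVT_itv F (Derive F) 0 x) as [c [Hc E]]; [lra| |].
  - intros z Hz. apply (flip_der r d); [exact H|lra].
  - assert (Bc := B c ltac:(unfold itv; lra)). rewrite F0 in E. split; nra.
Qed.

Lemma flip_neg r d F x : flip (S r) d F -> - (2 * d) < x < 0 -> - (x / 2) <= F x <= - (2 * x).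
Proof.
  intros H Hx. assert (H' := H). destruct H' as (Hd & F0 & _ & B).
  destruct (MVT_itv F (Derive F) x 0) as [c [Hc E]]; [lra| |].
  - intros z Hz. apply (flip_der r d); [exact H|lra].
  - assert (Bc := B c ltac:(unfold itv; lra)). rewrite F0 in E. split; nra.
Qed.

Lemma flip_abs r d F x : flip (S r) d F -> - (2 * d) < x < 2 * d ->
  Rabs x / 2 <= Rabs (F x) <= 2 * Rabs x.
Proof.
  intros H Hx. destruct (Rtotal_order x 0) as [T|[->|T]].
  - assert (B := flip_neg r d F x H ltac:(lra)). rewrite (Rabs_left x), (Rabs_pos_eq (F x)); lra.
  - destruct H as (_ & -> & _). rewrite Rabs_R0. lra.
  - assert (B := flip_pos r d F x H ltac:(lra)). rewrite (Rabs_pos_eq x), (Rabs_left1 (F x)); lra.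
Qed.

Lemma flip_in r d F x c : flip (S r) d F -> - (2 * d) < x < 2 * d -> Rabs x < c ->
  - (2 * c) < F x < 2 * c.
Proof.
  intros H Hx Hc. assert (B := flip_abs r d F x H Hx).
  apply Rabs_lt_between. lra.
Qed.

Lemma flip_in_d r d F x : flip (S r) d F -> - d < x < d -> - (2 * d) < F x < 2 * d.
Proof.
  intros H Hx. apply (flip_in r d F x d H); [lra|]. apply Rabs_lt_between. exact Hx.
Qed.

Lemma flip_sq_incr r d F x y : flip (S r) d F -> - d < x -> y < d -> x < y ->
  F (F x) < F (F y).
Proof.
  intros H Hx Hy Hxy.
  assert (Bx := flip_in_d r d F x H ltac:(lra)). assert (By := flip_in_d r d F y H ltac:(lra)).
  apply (flip_decr r d); try assumption; try lra.
  apply (flip_decr r d); try assumption; lra.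
Qed.

Lemma flip_sq_der r d F x : flip (S r) d F -> - d < x < d ->
  is_derive (fun x => F (F x)) x (Derive F x * Derive F (F x)).
Proof.
  intros H Hx. assert (Bx := flip_in_d r d F x H Hx).
  apply (is_derive_comp F F); apply (flip_der r d); try assumption; lra.
Qed.

Lemma flip_sq_cont r d F x : flip (S r) d F -> - d < x < d -> continuous (fun x => F (F x)) x.
Proof.
  intros H Hx. apply (is_derive_continuous _ _ _ (flip_sq_der r d F x H Hx)).
Qed.

Lemma flip_sq_Cs r d F : flip (S r) d F -> Cs_on (S r) (itv (- d) d) (fun x => F (F x)).
Proof.
  intros H. assert (H' := H). destruct H' as (Hd & _ & HC & _).
  apply (Cs_on_comp _ (itv (- d) d) (itv (- (2 * d)) (2 * d)) F F); try apply open_itv.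
  - intros x Hx. apply (flip_in_d r d); assumption.
  - exact HC.
  - apply (Cs_on_subset _ (itv (- (2 * d)) (2 * d))); [|exact HC].
    unfold itv. intros x Hx. lra.
Qed.

Lemma flip_inverse r d F : flip (S r) d F -> exists K : R -> R,
  (forall x, - (2 * d) < x < 2 * d -> K (F x) = x) /\
  (forall y, - d < y < d -> - (2 * d) < K y < 2 * d /\ F (K y) = y) /\
  Cs_on (S r) (itv (- d) d) K /\
  (forall y, 0 < y < d -> - (2 * y) <= K y <= - (y / 2)) /\
  (forall y z, - d < y -> z < d -> y < z -> K z < K y) /\
  (forall y, - d < y < d -> is_derive K y (/ Derive F (K y))).
Proof.
  intros H. assert (H' := H). destruct H' as (Hd & F0 & HC & B).
  pose (K := fun y => epsilon (inhabits 0) (fun x => - (2 * d) < x < 2 * d /\ F x = y)).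
  assert (HK : forall y, (exists x, - (2 * d) < x < 2 * d /\ F x = y) ->
     - (2 * d) < K y < 2 * d /\ F (K y) = y).
  { intros y Hy. apply (epsilon_spec (inhabits 0) (fun x => - (2 * d) < x < 2 * d /\ F x = y)), Hy. }
  assert (HKF : forall x, - (2 * d) < x < 2 * d -> K (F x) = x).
  { intros x Hx. destruct (HK (F x)) as [A E]; [exists x; auto|].
    destruct (Rtotal_order (K (F x)) x) as [T|[T|T]]; [|exact T|].
    - assert (T' := flip_decr r d F _ _ H ltac:(apply A) ltac:(apply Hx) T). lra.
    - assert (T' := flip_decr r d F _ _ H ltac:(apply Hx) ltac:(apply A) T). lra. }
  assert (HFK : forall y, - d < y < d -> - (2 * d) < K y < 2 * d /\ F (K y) = y).
  { intros y Hy. apply HK.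
    set (c := (Rabs y + d) / 2).
    assert (Hya : Rabs y < d) by (apply Rabs_lt_between; lra).
    assert (Hyc : Rabs y < c < d) by (unfold c; lra). destruct Hyc as [Hyc Hc].
    apply Rabs_lt_between in Hyc.
    assert (B1 := flip_pos r d F (2 * c) H ltac:(lra)).
    assert (B2 := flip_neg r d F (- (2 * c)) H ltac:(lra)).
    destruct (IVT_between (fun x => - F x) (- (2 * c)) (2 * c) (- y)) as [x [Hx E]]; [lra| |lra|].
    - intros x Hx. apply (continuous_opp F), (flip_cont r d); [exact H|lra].
    - exists x. split; lra. }
  exists K. split; [exact HKF|]. split; [exact HFK|]. split; [|split; [|split]].
  - apply (Cs_on_left_inverse r (itv (- (2 * d)) (2 * d)) (itv (- d) d) F K); try apply open_itv; try assumption.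
    intros x Hx. specialize (B x Hx). lra.
  - intros y Hy. destruct (HFK y ltac:(lra)) as [A E].
    destruct (Rtotal_order (K y) 0) as [T|[T|T]].
    + assert (Q := flip_neg r d F (K y) H ltac:(lra)). lra.
    + rewrite T, F0 in E. lra.
    + assert (Q := flip_pos r d F (K y) H ltac:(lra)). lra.
  - intros y z Hy Hz Hyz. destruct (HFK y ltac:(lra)) as [A1 E1].
    destruct (HFK z ltac:(lra)) as [A2 E2]. apply (flip_decr_inv r d F _ _ H); lra.
  - intros y Hy. destruct (HFK y Hy) as [T1 T2]. rewrite <- T2 at 1.
    apply (is_derive_left_inverse (itv (- (2 * d)) (2 * d)) F K); try assumption.
    + apply open_itv.
    + intros x Hx. apply (flip_cont r d F x H Hx).
    + apply (flip_der r d F _ H T1).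
    + specialize (B _ T1). lra.
Qed.

Lemma is_lim_seq_even_odd (u : nat -> R) (l : R) :
  is_lim_seq (fun n => u (2 * n)%nat) l -> is_lim_seq (fun n => u (2 * n + 1)%nat) l ->
  is_lim_seq u l.
Proof.
  intros H1 H2. apply is_lim_seq_spec in H1. apply is_lim_seq_spec in H2. apply is_lim_seq_spec.
  intros eps. destruct (H1 eps) as [N1 HN1]. destruct (H2 eps) as [N2 HN2].
  exists (2 * (N1 + N2) + 1)%nat. intros n Hn.
  destruct (Nat.Even_or_Odd n) as [[k ->]|[k ->]]; [apply HN1|apply HN2]; lia.
Qed.

Lemma iter_double (F : R -> R) x n : Nat.iter (2 * n) F x = Nat.iter n (fun x => F (F x)) x.
Proof.
  induction n as [|n IH]; [reflexivity|].
  replace (2 * S n)%nat with (S (S (2 * n))) by lia.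
  exact (f_equal (fun y => F (F y)) IH).
Qed.

Lemma iter_double_1 (F : R -> R) x n : Nat.iter (2 * n + 1) F x = F (Nat.iter n (fun x => F (F x)) x).
Proof.
  rewrite Nat.add_1_r. change (F (Nat.iter (2 * n) F x) = F (Nat.iter n (fun x => F (F x)) x)).
  apply (f_equal F), iter_double.
Qed.

Lemma iter_lim_of_double (F : R -> R) x (l : R) : continuous F l -> F l = l ->
  is_lim_seq (fun n => Nat.iter n (fun x => F (F x)) x) l -> is_lim_seq (fun n => Nat.iter n F x) l.
Proof.
  intros Hc E HL. apply is_lim_seq_even_odd.
  - apply (is_lim_seq_ext (fun n => Nat.iter n (fun x => F (F x)) x)); [|exact HL].
    intros n. symmetry. apply iter_double.
  - apply (is_lim_seq_ext (fun n => F (Nat.iter n (fun x => F (F x)) x))).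
    + intros n. symmetry. apply iter_double_1.
    + rewrite <- E. apply is_lim_seq_continuous; [|exact HL].
      apply continuity_pt_filterlim, Hc.
Qed.

(** The left half of the interval is carried to the right half by F, which transfers the sign
    of F (F x) - x. *)
Lemma sink_crossing r d F : flip (S r) d F -> sink d F ->
  crossing (fun x => F (F x)) (- (d / 2)) 0 d.
Proof.
  intros H HS. assert (H' := H). destruct H' as (Hd & F0 & _).
  split; [lra|]. split; [rewrite !F0; reflexivity|]. split; [|split; [|split]].
  - intros x Hx. unfold itv in Hx. apply (flip_sq_cont r d); [exact H|lra].
  - intros x y Hx Hy Hxy. unfold itv in *. apply (flip_sq_incr r d); try assumption; lra.
  - intros x Hx. assert (B := flip_neg r d F x H ltac:(lra)).
    assert (S1 := HS (F x) ltac:(lra)).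
    assert (B1 := flip_in_d r d F (F x) H ltac:(lra)).
    apply (flip_decr_inv r d F); try assumption; lra.
  - intros x Hx. apply HS, Hx.
Qed.

Lemma sink_stable r d F : flip (S r) d F -> sink d F -> stable_fixed_point F 0.
Proof.
  intros H HS. assert (H' := H). destruct H' as (Hd & F0 & _).
  assert (HX := sink_crossing r d F H HS).
  assert (HIn : forall x, Rabs x < d / 2 -> itv (- (d / 2)) d x).
  { intros x Hx. apply Rabs_lt_between in Hx. unfold itv. lra. }
  split; [exact F0|]. split.
  - intros eps. assert (He := cond_pos eps).
    destruct (pos_min2 (eps / 2) (d / 2)) as (dl & Hdl & A & B); [lra..|].
    exists (mkposreal _ Hdl). intros x Hx n. simpl in Hx. rewrite Rminus_0_r in *.
    assert (Hk : forall k, Rabs (Nat.iter k (fun x => F (F x)) x) <= Rabs x).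
    { intros k. assert (T := proj1 (crossing_attract _ _ _ _ HX x (HIn x ltac:(lra))) k).
      rewrite !Rminus_0_r in T. exact T. }
    destruct (Nat.Even_or_Odd n) as [[k ->]|[k ->]].
    + rewrite iter_double. specialize (Hk k). lra.
    + rewrite iter_double_1. specialize (Hk k).
      assert (T := flip_abs r d F (Nat.iter k (fun x => F (F x)) x) H).
      assert (T' : - (d / 2) <= Nat.iter k (fun x => F (F x)) x <= d / 2) by (apply Rabs_le_between; lra).
      specialize (T ltac:(lra)). lra.
  - assert (Hd2 : 0 < d / 2) by lra. exists (mkposreal _ Hd2). intros x Hx. simpl in Hx.
    rewrite Rminus_0_r in Hx.
    apply iter_lim_of_double; [apply (flip_cont r d); [exact H|lra]|exact F0|].
    apply (crossing_attract _ _ _ _ HX x (HIn x Hx)).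
Qed.

Lemma cycle_crossing_pos r d F q : flip (S r) d F -> cycle d F q ->
  crossing (fun x => F (F x)) 0 q d.
Proof.
  intros H (Hq & E & _ & HB & HA).
  split; [exact Hq|]. split; [exact E|]. split; [|split; [|split]].
  - intros x Hx. unfold itv in Hx. apply (flip_sq_cont r d); [exact H|lra].
  - intros x y Hx Hy Hxy. unfold itv in *. apply (flip_sq_incr r d); try assumption; lra.
  - exact HB.
  - exact HA.
Qed.

Lemma cycle_neg r d F q : flip (S r) d F -> cycle d F q -> q < d / 4 -> - (d / 2) < F q < 0.
Proof.
  intros H (Hq & _) Hq4. assert (B := flip_pos r d F q H ltac:(lra)). lra.
Qed.

Lemma cycle_crossing_neg r d F q : flip (S r) d F -> cycle d F q -> q < d / 4 ->
  crossing (fun x => F (F x)) (- (d / 2)) (F q) 0.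
Proof.
  intros H HC Hq4. assert (Hp := cycle_neg r d F q H HC Hq4).
  destruct HC as (Hq & E & _ & HB & HA).
  split; [exact Hp|]. split; [rewrite E; reflexivity|]. split; [|split; [|split]].
  - intros x Hx. unfold itv in Hx. apply (flip_sq_cont r d); [exact H|lra].
  - intros x y Hx Hy Hxy. unfold itv in *. apply (flip_sq_incr r d); try assumption; lra.
  - intros x Hx. assert (B := flip_neg r d F x H ltac:(lra)).
    assert (B0 := flip_decr r d F x (F q) H ltac:(lra) ltac:(lra) ltac:(lra)). rewrite E in B0.
    assert (S1 := HA (F x) ltac:(lra)).
    assert (B1 := flip_in_d r d F (F x) H ltac:(lra)).
    apply (flip_decr_inv r d F); try assumption; lra.
  - intros x Hx. assert (B := flip_neg r d F x H ltac:(lra)).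
    assert (B0 := flip_decr r d F (F q) x H ltac:(lra) ltac:(lra) ltac:(lra)). rewrite E in B0.
    assert (S1 := HB (F x) ltac:(lra)).
    assert (B1 := flip_in_d r d F (F x) H ltac:(lra)).
    apply (flip_decr_inv r d F); try assumption; lra.
Qed.

Lemma cycle_unstable r d F q : flip (S r) d F -> cycle d F q -> unstable_fixed_point F 0.
Proof.
  intros H HC. assert (H' := H). destruct H' as (Hd & F0 & _).
  split; [exact F0|]. intros HL.
  assert (HX := cycle_crossing_pos r d F q H HC). destruct HC as (Hq & _).
  assert (Hq2 : 0 < q / 2) by lra.
  destruct (HL (mkposreal _ Hq2)) as [dl Hdl]. assert (Hdp := cond_pos dl).
  destruct (pos_min2 (dl / 2) (q / 2)) as (x & Hx & A & B); [lra..|].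
  assert (T := proj2 (crossing_attract _ _ _ _ HX x ltac:(unfold itv; lra))).
  apply is_lim_seq_spec in T. destruct (T (mkposreal _ Hq2)) as [n Hn].
  specialize (Hn n (Nat.le_refl n)). simpl in Hn.
  assert (T2 := Hdl x). rewrite Rminus_0_r, Rabs_pos_eq in T2 by lra.
  specialize (T2 ltac:(lra) (2 * n)%nat). rewrite iter_double in T2. simpl in T2.
  rewrite Rminus_0_r in T2. apply Rabs_lt_between in Hn. apply Rabs_lt_between in T2. lra.
Qed.

Lemma cycle_stable2 r d F q (N : R -> Prop) : flip (S r) d F -> cycle d F q -> q < d / 4 ->
  N q -> N (F q) -> stable_period2 F N q (F q).
Proof.
  intros H HC Hq4 H1 H2. assert (Hp := cycle_neg r d F q H HC Hq4).
  assert (X1 := cycle_crossing_pos r d F q H HC). assert (X2 := cycle_crossing_neg r d F q H HC Hq4).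
  destruct HC as (Hq & E & _).
  split; [exact H1|]. split; [exact H2|]. split; [lra|]. split; [reflexivity|]. split; [exact E|].
  split; [apply (crossing_stable _ _ _ _ X1)|apply (crossing_stable _ _ _ _ X2)].
Qed.

(** A backward orbit that starts on the cycle or beyond it stays there, because F o F is
    increasing and fixes both points of the cycle; strictly inside, the inverse branch contracts
    to 0.  Stated for any [X] that contains the inside, to serve for both N and M. *)
Lemma basin_repulsion_cycle r d F q (X : R -> Prop) : flip (S r) d F -> cycle d F q -> q < d / 4 ->
  (forall x, X x -> - d < x < d) -> (forall x, F q < x < q -> X x) ->
  forall x, basin_repulsion F X 0 x <-> F q < x < q.
Proof.
  intros H HC Hq4 HX HXq x. assert (Hp := cycle_neg r d F q H HC Hq4).
  assert (HC' := HC). destruct HC' as (Hq & E & _ & HB & HA).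
  split.
  - intros (u & <- & HN & HF & HL).
    assert (A2 : forall n, F (F (u (S (S n)))) = u n).
    { intros n. rewrite (HF (S n)). apply HF. }
    assert (Hcase : forall c, c <> 0 -> F (F c) = c -> - d < c < d ->
       ~ (Rabs c <= Rabs (u 0%nat) /\ 0 < c * u 0%nat)).
    { intros c Hc0 Ec Hc [T1 T2].
      assert (I : forall n, Rabs c <= Rabs (u (2 * n)%nat) /\ 0 < c * u (2 * n)%nat).
      { induction n as [|n [I1 I2]]; [split; assumption|].
        replace (2 * S n)%nat with (S (S (2 * n))) by lia.
        assert (Hv := HX _ (HN (S (S (2 * n))))). assert (Ev := A2 (2 * n)%nat).
        set (v := u (S (S (2 * n)))) in *. set (w := u (2 * n)%nat) in *.
        destruct (Rlt_dec 0 c) as [Hcp|Hcn].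
        - assert (Hw : c <= w) by (rewrite !Rabs_pos_eq in I1 by nra; exact I1).
          assert (Hvc : c <= v).
          { destruct (Rle_lt_dec c v) as [T|T]; [exact T|].
            assert (Q := flip_sq_incr r d F v c H ltac:(lra) ltac:(lra) T). lra. }
          split; [rewrite !Rabs_pos_eq by lra; exact Hvc|nra].
        - assert (Hw : w <= c) by (rewrite !Rabs_left1 in I1 by nra; lra).
          assert (Hvc : v <= c).
          { destruct (Rle_lt_dec v c) as [T|T]; [exact T|].
            assert (Q := flip_sq_incr r d F c v H ltac:(lra) ltac:(lra) T). lra. }
          split; [rewrite !Rabs_left1 by lra; lra|nra]. }
      apply is_lim_seq_spec in HL. assert (Hcp := Rabs_pos_lt c Hc0).
      destruct (HL (mkposreal _ Hcp)) as [n Hn]. specialize (Hn (2 * n)%nat ltac:(lia)).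
      simpl in Hn. rewrite Rminus_0_r in Hn. specialize (I n). simpl in I. lra. }
    destruct (Rlt_dec (F q) (u 0%nat)) as [T1|T1].
    + split; [exact T1|]. destruct (Rlt_dec (u 0%nat) q) as [T2|T2]; [exact T2|exfalso].
      apply (Hcase q); try lra. split; [rewrite !Rabs_pos_eq; lra|nra].
    + exfalso. apply (Hcase (F q)); try lra; [rewrite E; reflexivity|].
      split; [rewrite !Rabs_left1; lra|nra].
  - intros Hx. destruct (flip_inverse r d F H) as (K & HKF & HFK & HKC & _ & HKd & _).
    assert (HK : forall y, F q < y < q -> F q < K y < q).
    { intros y Hy. destruct (HFK y ltac:(lra)) as [T1 T2].
      split; apply (flip_decr_inv r d F _ _ H); lra. }
    assert (HI : forall n, F q < Nat.iter n K x < q).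
    { intros n. apply (iter_in (fun y => F q < y < q) K); [exact HK|exact Hx]. }
    exists (fun n => Nat.iter n K x). split; [reflexivity|]. split; [intros n; apply HXq, HI|].
    split; [intros n; simpl; apply HFK; specialize (HI n); lra|].
    assert (K0 : K 0 = 0).
    { assert (T := HKF 0 ltac:(lra)). destruct H as (_ & F0 & _). rewrite F0 in T. exact T. }
    assert (HFK' : forall y, F q < y < q -> F (K y) = y) by (intros; apply HFK; lra).
    assert (HcK : forall y, F q < y < q -> continuous K y).
    { intros y Hy. apply (Cs_on_continuous _ _ K y HKC). unfold itv. lra. }
    apply iter_lim_of_double; [apply HcK; lra|exact K0|].
    apply (crossing_attract _ (F q) 0 q); [|exact Hx].
    split; [lra|]. split; [rewrite !K0; reflexivity|].
    assert (HKK : forall y, F q < y < q -> F (F (K (K y))) = y).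
    { intros y Hy. rewrite (HFK' (K y)); [apply HFK', Hy|apply HK, Hy]. }
    split; [|split; [|split]]; unfold itv.
    + intros y Hy. apply (continuous_comp K K); [apply HcK, Hy|apply HcK, HK, Hy].
    + intros y z Hy Hz Hyz.
      assert (T1 := HK _ (HK y Hy)). assert (T2 := HK _ (HK z Hz)).
      assert (T3 := HK y Hy). assert (T4 := HK z Hz).
      apply HKd; [lra|lra|]. apply HKd; lra.
    + intros y Hy. assert (T1 : F q < K (K y) < q) by (apply HK, HK; lra).
      assert (XN := cycle_crossing_neg r d F q H HC Hq4).
      destruct XN as (_ & _ & _ & _ & _ & XA).
      destruct (Rlt_le_dec y (K (K y))) as [T|T]; [exact T|].
      assert (T3 : F q < K (K y) < 0) by lra.
      specialize (XA _ T3). cbv beta in XA. rewrite HKK in XA; lra.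
    + intros y Hy. assert (T1 : F q < K (K y) < q) by (apply HK, HK; lra).
      destruct (Rlt_le_dec (K (K y)) y) as [T|T]; [exact T|].
      assert (T3 : 0 < K (K y) < q) by lra.
      specialize (HB _ T3). rewrite HKK in HB; lra.
Qed.

(** The inequalities make F map [n, b] into (n, b), and they persist under small
    perturbations of F. *)
Definition trap (d : R) (F : R -> R) (n b : R) : Prop :=
  - (d / 2) < n < 0 /\ 0 < b < d / 4 /\ n < F b /\ F n < b.

Lemma trap_in r d F n b x : flip (S r) d F -> trap d F n b -> n <= x <= b -> n < F x < b.
Proof.
  intros H (H1 & H2 & H3 & H4) Hx. split.
  - destruct (proj2 Hx) as [T|T]; [|subst; exact H3].
    assert (Q := flip_decr r d F x b H). lra.
  - destruct (proj1 Hx) as [T|T]; [|subst; exact H4].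
    assert (Q := flip_decr r d F n x H). lra.
Qed.

Lemma trap_sq r d F n b : flip (S r) d F -> trap d F n b -> F (F b) < b.
Proof.
  intros H HT. assert (H0 := HT). destruct H0 as (H1 & H2 & _).
  assert (T1 := trap_in r d F n b b H HT ltac:(lra)).
  assert (T2 := trap_in r d F n b (F b) H HT ltac:(lra)). lra.
Qed.

Lemma cycle_lt r d F q b : flip (S r) d F -> cycle d F q -> 0 < b < d -> F (F b) < b -> q < b.
Proof.
  intros H (Hq & E & _ & HB & HA) Hb HS.
  destruct (Rlt_le_dec q b) as [T|[T|T]]; [exact T| |].
  - specialize (HB b ltac:(lra)). lra.
  - subst. lra.
Qed.

Lemma trap_cycle r d F n b q : flip (S r) d F -> trap d F n b -> cycle d F q ->
  q < b /\ n < F q < 0 /\ q < d / 4.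
Proof.
  intros H HT HC. assert (H0 := HT). destruct H0 as (H1 & H2 & _).
  assert (Hqb := cycle_lt r d F q b H HC ltac:(lra) (trap_sq r d F n b H HT)).
  assert (Hp := cycle_neg r d F q H HC ltac:(lra)).
  assert (Hq := proj1 HC).
  assert (T := trap_in r d F n b q H HT ltac:(lra)). lra.
Qed.

(** Even iterates converge to one point of the cycle and odd ones to the other. *)
Lemma basin_attraction_cycle r d F n b q : flip (S r) d F -> trap d F n b -> cycle d F q ->
  forall x, basin_attraction2 F (itv n b) q (F q) x <-> itv n b x /\ x <> 0.
Proof.
  intros H HT HC x. destruct (trap_cycle r d F n b q H HT HC) as (Hqb & Hp & Hq4).
  assert (X1 := cycle_crossing_pos r d F q H HC). assert (X2 := cycle_crossing_neg r d F q H HC Hq4).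
  assert (H' := H). destruct H' as (Hd & F0 & _).
  assert (HT' := HT). destruct HT' as (Hn & Hb & _).
  destruct HC as (Hq & E & _).
  split.
  - intros [HN HL]. split; [apply (HN 0%nat)|]. intros ->.
    assert (HL' : is_lim_seq (fun _ => Rmin (Rabs q) (Rabs (F q))) 0).
    { apply (is_lim_seq_ext (fun n => Rmin (Rabs (Nat.iter n F 0 - q)) (Rabs (Nat.iter n F 0 - F q)))); [|exact HL].
      intros k. rewrite (iter_fixed F 0 k F0). f_equal; unfold Rminus; rewrite Rplus_0_l; apply Rabs_Ropp. }
    assert (T := is_lim_seq_unique _ _ HL'). rewrite Lim_seq_const in T. injection T as T.
    assert (0 < Rmin (Rabs q) (Rabs (F q))); [|lra].
    apply Rmin_glb_lt; apply Rabs_pos_lt; lra.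
  - intros [Hx Hx0]. unfold itv in Hx. split.
    + intros k. apply (iter_in (itv n b) F); [|exact Hx].
      intros y Hy. unfold itv in Hy. apply (trap_in r d F n b y H HT). lra.
    + assert (Q : forall c, (c = q \/ c = F q) ->
         is_lim_seq (fun k => Nat.iter k (fun x => F (F x)) x) c ->
         is_lim_seq (fun n => Rmin (Rabs (Nat.iter n F x - q)) (Rabs (Nat.iter n F x - F q))) 0).
      { intros c Hc HL.
        assert (HcI : - d < c < d) by (destruct Hc; subst; lra).
        assert (Sq : forall (v : nat -> R) l, (l = q \/ l = F q) -> is_lim_seq v l ->
            is_lim_seq (fun n => Rmin (Rabs (v n - q)) (Rabs (v n - F q))) 0).
        { intros v l Hl Hv.
          apply (is_lim_seq_le_le (fun _ => 0) _ (fun n => Rabs (v n - l))).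
          - intros k. split; [apply Rmin_glb; apply Rabs_pos|].
            destruct Hl; subst l; [apply Rmin_l|apply Rmin_r].
          - apply is_lim_seq_const.
          - apply (is_lim_seq_abs_0 (fun n => v n - l)). replace 0 with (l - l) by ring.
            apply is_lim_seq_minus'; [exact Hv|apply is_lim_seq_const]. }
        apply is_lim_seq_even_odd.
        - apply (Sq (fun k => Nat.iter (2 * k) F x) c Hc).
          apply (is_lim_seq_ext (fun k => Nat.iter k (fun x => F (F x)) x)); [|exact HL].
          intros k. symmetry. apply iter_double.
        - apply (Sq (fun k => Nat.iter (2 * k + 1) F x) (F c)).
          + destruct Hc; subst c; [right; reflexivity|left; exact E].
          + apply (is_lim_seq_ext (fun k => F (Nat.iter k (fun x => F (F x)) x))).
            * intros k. symmetry. apply iter_double_1.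
            * apply is_lim_seq_continuous; [|exact HL].
              apply continuity_pt_filterlim, (flip_cont r d); [exact H|lra]. }
      destruct (Rlt_dec 0 x) as [Hp0|Hn0].
      * apply (Q q); [left; reflexivity|].
        apply (crossing_attract _ _ _ _ X1). unfold itv. lra.
      * apply (Q (F q)); [right; reflexivity|].
        apply (crossing_attract _ _ _ _ X2). unfold itv. lra.
Qed.

Lemma flip_only_fixed r d F x : flip (S r) d F -> - (2 * d) < x < 2 * d -> (F x = x <-> x = 0).
Proof.
  intros H Hx. split.
  - intros E. destruct (Rtotal_order x 0) as [T|[T|T]]; [|exact T|].
    + assert (B := flip_neg r d F x H ltac:(lra)). lra.
    + assert (B := flip_pos r d F x H ltac:(lra)). lra.
  - intros ->. apply H.
Qed.

(** * Conjugacies from coordinates; the stable fixed point *)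

Lemma Cs_increasing s l u h x y : Cs_on (S s) (itv l u) h ->
  (forall x, itv l u x -> 0 < Derive h x) -> l < x -> y < u -> x < y -> h x < h y.
Proof.
  intros H Hp Hx Hy Hxy.
  apply (increasing_itv h (Derive h) (itv l u)); try (unfold itv; lra).
  - apply itv_convex.
  - intros z Hz. eapply Cs_on_derive; eassumption.
  - exact Hp.
Qed.

Lemma Cs_increasing_inj s l u h x y : Cs_on (S s) (itv l u) h ->
  (forall x, itv l u x -> 0 < Derive h x) -> itv l u x -> itv l u y -> h x = h y -> x = y.
Proof.
  intros H Hp Hx Hy E. unfold itv in *. destruct (Rtotal_order x y) as [T|[T|T]]; [|exact T|].
  - assert (Q := Cs_increasing s l u h x y H Hp). lra.
  - assert (Q := Cs_increasing s l u h y x H Hp). lra.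
Qed.

Lemma Cs_increasing_rev s l u h x y : Cs_on (S s) (itv l u) h ->
  (forall x, itv l u x -> 0 < Derive h x) -> itv l u x -> itv l u y -> h x < h y -> x < y.
Proof.
  intros H Hp Hx Hy E. unfold itv in *. destruct (Rtotal_order x y) as [T|[T|T]]; [exact T| |].
  - subst; lra.
  - assert (Q := Cs_increasing s l u h y x H Hp). lra.
Qed.

Lemma Cs_IVT s l u h a b w : Cs_on s (itv l u) h -> l < a -> b < u -> a <= b ->
  h a <= w <= h b -> exists x, a <= x <= b /\ h x = w.
Proof.
  intros H Ha Hb Hab Hw. apply IVT_between; try assumption.
  intros x Hx. apply (Cs_on_continuous s (itv l u)); [exact H|unfold itv; lra].
Qed.

(** The map h = psi^-1 (c phi + e).  That the two coordinates have matching ranges is left as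
    a pair of hypotheses, since the reason differs from one regime to the next: bounded
    coordinates, unbounded on one side, or onto the line. *)
Lemma transport s l u l' u' n b v y (phi psi : R -> R) c e : 0 < c ->
  Cs_on (S s) (itv l u) phi -> (forall x, itv l u x -> 0 < Derive phi x) ->
  Cs_on (S s) (itv l' u') psi -> (forall x, itv l' u' x -> 0 < Derive psi x) ->
  (forall x, itv n b x -> itv l u x) -> (forall x, itv v y x -> itv l' u' x) ->
  (forall x, itv n b x -> exists t, itv v y t /\ psi t = c * phi x + e) ->
  (forall t, itv v y t -> exists x, itv n b x /\ psi t = c * phi x + e) ->
  exists h, Cs_on (S s) (itv n b) h /\ (forall x, itv n b x -> 0 < Derive h x) /\
    (forall x, itv n b x -> itv v y (h x) /\ psi (h x) = c * phi x + e) /\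
    (forall t, itv v y t -> exists x, itv n b x /\ h x = t).
Proof.
  intros Hc Hphi Hphi' Hpsi Hpsi' HN HV H1 H2.
  pose (W := fun w => exists t, itv v y t /\ psi t = w).
  assert (HW : Cs_diffeo (S s) (itv v y) W psi).
  { apply Cs_diffeo_onto_image.
    - apply open_itv.
    - intros x Hx. exists x. auto.
    - intros w Hw. exact Hw.
    - apply (Cs_on_subset _ (itv l' u')); assumption.
    - intros x Hx. apply Hpsi', HV, Hx.
    - intros x z Hx Hz E. apply (Cs_increasing_inj s l' u' psi x z); auto. }
  destruct HW as (k & Hk1 & Hk2 & _ & HkC).
  assert (HWo : open W).
  { apply (open_image (itv v y) W psi).
    - apply open_itv.
    - intros x Hx. exists x. auto.
    - intros w Hw. exact Hw.
    - apply (Cs_on_le 1 (S s)); [lia|]. apply (Cs_on_subset _ (itv l' u')); assumption.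
    - intros x Hx. apply Hpsi', HV, Hx. }
  assert (HWx : forall x, itv n b x -> W (c * phi x + e)).
  { intros x Hx. destruct (H1 x Hx) as [t [A B]]. exists t. auto. }
  set (h := fun x => k (c * phi x + e)).
  assert (Hh : forall x, itv n b x -> itv v y (h x) /\ psi (h x) = c * phi x + e).
  { intros x Hx. apply (Hk2 _ (HWx x Hx)). }
  assert (Hphin : Cs_on (S s) (itv n b) phi) by (apply (Cs_on_subset _ (itv l u)); assumption).
  assert (HhC : Cs_on (S s) (itv n b) h).
  { apply (Cs_on_comp (S s) (itv n b) W k (fun x => c * phi x + e)); try assumption; try apply open_itv.
    apply Cs_on_plus; [apply open_itv| |apply Cs_on_const, open_itv].
    apply Cs_on_scal; [apply open_itv|exact Hphin]. }
  exists h. split; [exact HhC|]. split; [|split; [exact Hh|]].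
  - intros x Hx. destruct (Hh x Hx) as [A B].
    assert (D1 := Cs_on_derive s _ h x HhC Hx).
    assert (D2 := Cs_on_derive s _ psi (h x) Hpsi (HV _ A)).
    assert (D3 := Cs_on_derive s _ phi x Hphin Hx).
    assert (D4 := is_derive_comp psi h x _ _ D2 D1).
    assert (D5 : is_derive (fun x => psi (h x)) x (c * Derive phi x + 0)).
    { apply (is_derive_ext_on (itv n b) (fun x => c * phi x + e)); [apply open_itv|exact Hx| |].
      - intros z Hz. symmetry. apply Hh, Hz.
      - apply (is_derive_plus (fun x => c * phi x) (fun _ => e)).
        + apply (is_derive_scal phi), D3.
        + apply (is_derive_const e x). }
    assert (E : Derive h x * Derive psi (h x) = c * Derive phi x + 0).
    { apply is_derive_unique in D4. apply is_derive_unique in D5. rewrite <- D5. symmetry. exact D4. }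
    assert (P1 := Hpsi' _ (HV _ A)). assert (P2 := Hphi' x (HN x Hx)).
    assert (0 < c * Derive phi x) by (apply Rmult_lt_0_compat; assumption). nra.
  - intros t Ht. destruct (H2 t Ht) as [x [Hx E]]. exists x. split; [exact Hx|].
    unfold h. rewrite <- E. apply Hk1, Ht.
Qed.

Lemma Cs_conjugate_le s t (U V : R -> Prop) F G : (s <= t)%nat ->
  Cs_conjugate t U V F G -> Cs_conjugate s U V F G.
Proof.
  intros Hs (h & (k & H1 & H2 & H3 & H4) & H). exists h. split; [|exact H].
  exists k. repeat split; try apply H1; try apply H2; try assumption;
  try (eapply Cs_on_le in H3; [apply H3|]; eassumption);
  try (eapply Cs_on_le in H4; [apply H4|]; eassumption).
Qed.

Lemma conj_of_transport s n b v y F G h :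
  Cs_on (S s) (itv n b) h -> (forall x, itv n b x -> 0 < Derive h x) ->
  (forall x, itv n b x -> itv v y (h x)) ->
  (forall t, itv v y t -> exists x, itv n b x /\ h x = t) ->
  (forall x, itv n b x -> itv n b (F x) -> h (F x) = G (h x)) ->
  Cs_conjugate (S s) (itv n b) (itv v y) F G.
Proof.
  intros HC Hp Hi Hs Hq. exists h. split; [|exact Hq].
  apply Cs_diffeo_onto_image; try assumption; [apply open_itv|].
  intros x z Hx Hz E. apply (Cs_increasing_inj s n b h x z); assumption.
Qed.

(** F maps (l, b) into itself because F l = b, and all orbits in it tend to 0. *)
Lemma sink_linearization s d F b : flip (S (S s)) d F -> sink d F -> -1 < Derive F 0 ->
  0 < b < d / 4 -> exists l phi, - (2 * b) <= l < 0 /\ F l = b /\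
    Cs_on (S (S s)) (itv l b) phi /\ (forall x, itv l b x -> 0 < Derive phi x) /\
    (forall x, itv l b x -> itv l b (F x) /\ phi (F x) = Derive F 0 * phi x).
Proof.
  intros H HS Hl Hb. destruct (flip_inverse _ d F H) as (K & HKF & HFK & _ & HKp & _).
  assert (H' := H). destruct H' as (Hd & F0 & HC & HB).
  destruct (HFK b ltac:(lra)) as [HKb EKb].
  assert (HKn := HKp b ltac:(lra)).
  set (l := K b) in *.
  assert (HU : forall x, itv l b x -> itv l b (F x)).
  { unfold itv. intros x Hx. split.
    - assert (T1 := flip_decr _ d F x b H ltac:(lra) ltac:(lra) ltac:(lra)).
      assert (T2 := flip_pos _ d F b H ltac:(lra)).
      assert (T3 := HS b ltac:(lra)).
      assert (T4 : l < F b) by (apply (flip_decr_inv _ d F _ _ H); lra). lra.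
    - assert (T1 := flip_decr _ d F l x H ltac:(lra) ltac:(lra) ltac:(lra)). lra. }
  assert (Hlam : -2 <= Derive F 0 <= - / 2) by (apply HB; unfold itv; lra).
  destruct (linearization s F (itv l b) 0 (Derive F 0)) as (phi & P1 & P2 & P3).
  - apply open_itv.
  - unfold itv; lra.
  - exact HU.
  - apply (Cs_on_subset _ (itv (- (2 * d)) (2 * d))); [|exact HC]. unfold itv. intros; lra.
  - exact F0.
  - reflexivity.
  - lra.
  - rewrite Rabs_left; lra.
  - intros x Hx. unfold itv in Hx. assert (B := HB x ltac:(unfold itv; lra)). nra.
  - intros x Hx. unfold itv in Hx.
    apply iter_lim_of_double; [apply (flip_cont _ d _ 0 H); lra|exact F0|].
    apply (crossing_attract _ _ _ _ (sink_crossing _ d F H HS)). unfold itv. lra.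
  - exists l, phi. repeat split; try assumption; try lra; try apply P1; try assumption;
    try apply HU; try apply P3; assumption.
Qed.

(** The constant c is fixed by h(b) = y.  The left end point [v] of the image satisfies
    psi(v) = c phi(n), and the inequalities F b > n, F n < b place it between G^-1(y) and G(y);
    this is a bound independent of the maps. *)
Lemma sink_conjugacy s dF F n b dG G y : flip (S (S s)) dF F -> sink dF F ->
  flip (S (S s)) dG G -> sink dG G -> Derive F 0 = Derive G 0 -> -1 < Derive F 0 ->
  trap dF F n b -> 0 < y < dG / 4 ->
  exists v, - (2 * y) < v < - (y / 2) /\ Cs_conjugate (S (S s)) (itv n b) (itv v y) F G.
Proof.
  intros HF SF HG SG El Hl HT Hy. assert (HT' := HT). destruct HT' as (Hn & Hb & HFb & HFn).
  set (b' := (b + dF / 4) / 2). set (y' := (y + dG / 4) / 2).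
  assert (Hb' : b < b' < dF / 4) by (unfold b'; lra).
  assert (Hy' : y < y' < dG / 4) by (unfold y'; lra).
  destruct (sink_linearization s dF F b' HF SF Hl) as (l & phi & Hl1 & Fl & Pc & Pd & Pe); [lra|].
  destruct (sink_linearization s dG G y' HG SG) as (l' & psi & Hl1' & Gl & Qc & Qd & Qe); [lra|lra|].
  rewrite <- El in Qe. set (lam := Derive F 0) in *.
  assert (Hlam : lam <= - / 2).
  { destruct HF as (_ & _ & _ & B). apply B. unfold itv. lra. }
  assert (F0 : F 0 = 0) by apply HF. assert (G0 : G 0 = 0) by apply HG.
  assert (phi0 : phi 0 = 0).
  { destruct (Pe 0) as [_ E]; [unfold itv; lra|]. rewrite F0 in E. nra. }
  assert (psi0 : psi 0 = 0).
  { destruct (Qe 0) as [_ E]; [unfold itv; lra|]. rewrite G0 in E. nra. }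
  assert (Hln : l < n) by (apply (flip_decr_inv _ dF F _ _ HF); lra).
  assert (phib : 0 < phi b) by (rewrite <- phi0; apply (Cs_increasing _ _ _ phi _ _ Pc Pd); lra).
  assert (psiy : 0 < psi y) by (rewrite <- psi0; apply (Cs_increasing _ _ _ psi _ _ Qc Qd); lra).
  set (c := psi y / phi b). assert (Hc : 0 < c) by (apply Rdiv_lt_0_compat; assumption).
  assert (Hcb : c * phi b = psi y) by (unfold c; field; lra).
  destruct (flip_inverse _ dG G HG) as (K & HKG & HGK & _ & HKp & _).
  destruct (HGK y ltac:(lra)) as [HKy EKy].
  assert (HKn := HKp y ltac:(lra)).
  assert (HlK : l' < K y) by (apply (flip_decr_inv _ dG G _ _ HG); lra).
  assert (EK : psi y = lam * psi (K y)).
  { rewrite <- EKy at 1. apply Qe. unfold itv; lra. }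
  assert (HFnp : 0 < F n) by (assert (B := flip_neg _ dF F n HF ltac:(lra)); lra).
  assert (En : phi (F n) = lam * phi n) by (apply Pe; unfold itv; lra).
  assert (EFb : phi (F b) = lam * phi b) by (apply Pe; unfold itv; lra).
  assert (HFbl : l < F b < 0) by (assert (B := flip_pos _ dF F b HF ltac:(lra)); lra).
  assert (EGy : psi (G y) = lam * psi y) by (apply Qe; unfold itv; lra).
  assert (HGy := flip_pos _ dG G y HG ltac:(lra)).
  assert (HGyl : l' < G y) by (apply (Qe y); unfold itv; lra).
  assert (L1 : psi (K y) < c * phi n).
  { assert (T : phi (F n) < phi b) by (apply (Cs_increasing _ _ _ phi _ _ Pc Pd); lra).
    assert (c * (lam * phi n) < c * phi b) by (apply Rmult_lt_compat_l; lra). nra. }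
  assert (L2 : c * phi n < psi (G y)).
  { assert (T : phi n < phi (F b)) by (apply (Cs_increasing _ _ _ phi _ _ Pc Pd); lra).
    assert (c * phi n < c * (lam * phi b)) by (apply Rmult_lt_compat_l; lra). nra. }
  assert (HKGy : K y < G y) by (apply (Cs_increasing_rev _ _ _ psi _ _ Qc Qd); unfold itv; lra).
  destruct (Cs_IVT _ _ _ psi (K y) (G y) (c * phi n) Qc) as [v [Hv Ev]]; try lra.
  assert (Hv1 : K y < v) by (apply (Cs_increasing_rev _ _ _ psi _ _ Qc Qd); unfold itv; lra).
  assert (Hv2 : v < G y) by (apply (Cs_increasing_rev _ _ _ psi _ _ Qc Qd); unfold itv; lra).
  exists v. split; [lra|].
  destruct (transport (S s) l b' l' y' n b v y phi psi c 0) as (h & Hh1 & Hh2 & Hh3 & Hh4); try assumption.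
  - unfold itv; intros; lra.
  - unfold itv; intros; lra.
  - intros x Hx. unfold itv in Hx.
    assert (T1 : phi n < phi x) by (apply (Cs_increasing _ _ _ phi _ _ Pc Pd); lra).
    assert (T2 : phi x < phi b) by (apply (Cs_increasing _ _ _ phi _ _ Pc Pd); lra).
    assert (T3 : c * phi n < c * phi x) by (apply Rmult_lt_compat_l; lra).
    assert (T4 : c * phi x < c * phi b) by (apply Rmult_lt_compat_l; lra).
    destruct (Cs_IVT _ _ _ psi v y (c * phi x) Qc) as [t [Ht Et]]; try lra.
    exists t. split; [|lra].
    split; apply (Cs_increasing_rev _ _ _ psi _ _ Qc Qd); unfold itv; lra.
  - intros t Ht. unfold itv in Ht.
    assert (T1 : psi v < psi t) by (apply (Cs_increasing _ _ _ psi _ _ Qc Qd); lra).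
    assert (T2 : psi t < psi y) by (apply (Cs_increasing _ _ _ psi _ _ Qc Qd); lra).
    assert (Ect : c * (psi t / c) = psi t) by (field; lra).
    destruct (Cs_IVT _ _ _ phi n b (psi t / c) Pc) as [x [Hx Ex]]; try lra.
    { split; apply (Rmult_le_reg_l c); lra. }
    exists x. rewrite Ex. split; [|lra].
    split; apply (Cs_increasing_rev _ _ _ phi _ _ Pc Pd); unfold itv; try lra;
      apply (Rmult_lt_reg_l c); rewrite ?Ex; lra.
  - apply (conj_of_transport (S s) n b v y F G h); try assumption.
    + intros x Hx. apply Hh3, Hx.
    + intros x Hx HFx. destruct (Hh3 x Hx) as [A1 A2]. destruct (Hh3 _ HFx) as [B1 B2].
      unfold itv in *.
      destruct (Pe x ltac:(unfold itv; lra)) as [_ E1].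
      destruct (Qe (h x) ltac:(unfold itv; lra)) as [C1 E2].
      apply (Cs_increasing_inj _ _ _ psi _ _ Qc Qd); [unfold itv; lra|exact C1|].
      rewrite B2, E2, A2, E1. ring.
Qed.

(** * The basins of repulsion and of attraction beyond the bifurcation *)

(** For the set of values of a coordinate that an expanding map multiplies by [k]. *)
Lemma unbounded_below_of_scaling (S : R -> Prop) k v0 : 1 < k -> S v0 -> v0 < 0 ->
  (forall v, S v -> S (k * v)) -> forall w, exists v, S v /\ v <= w.
Proof.
  intros Hk Hv0 Hn HS w.
  destruct (Pow_x_infinity k) with (b := Rabs w / - v0) as [N HN].
  { rewrite Rabs_pos_eq; lra. }
  exists (k ^ N * v0). split.
  - clear HN. induction N as [|N IH]; simpl; [rewrite Rmult_1_l; exact Hv0|].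
    rewrite Rmult_assoc. apply HS, IH.
  - specialize (HN N (Nat.le_refl N)). rewrite Rabs_pos_eq in HN by (apply pow_le; lra).
    assert (Hw := Rle_abs (- w)). rewrite Rabs_Ropp in Hw.
    apply Rge_le in HN. apply Rmult_le_compat_r with (r := - v0) in HN; [|lra].
    replace (Rabs w / - v0 * - v0) with (Rabs w) in HN by (field; lra). lra.
Qed.

(** The inverse branch contracts (F q, q) to 0 and is linearized there.  F multiplies the
    coordinate by F'(0), of square larger than 1, so both ends of its range are infinite. *)
Lemma repulsion_linearization s d F q : flip (S (S s)) d F -> cycle d F q -> q < d / 4 ->
  Derive F 0 < -1 ->
  exists phi, Cs_on (S (S s)) (itv (F q) q) phi /\ (forall x, itv (F q) q x -> 0 < Derive phi x) /\
    (forall x, itv (F q) q x -> itv (F q) q (F x) /\ phi (F x) = Derive F 0 * phi x) /\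
    (forall w, exists x, itv (F q) q x /\ phi x = w).
Proof.
  intros H HC Hq4 Hl. assert (Hp := cycle_neg _ d F q H HC Hq4).
  assert (HBR := basin_repulsion_cycle _ d F q (itv (F q) q) H HC Hq4).
  assert (XP := cycle_crossing_pos _ d F q H HC). assert (XN := cycle_crossing_neg _ d F q H HC Hq4).
  destruct (flip_inverse _ d F H) as (K & HKF & HFK & HKC & _ & _ & DK).
  assert (H' := H). destruct H' as (Hd & F0 & HCF & HB).
  destruct HC as (Hq & Eq & _).
  assert (HFU : forall x, itv (F q) q x -> itv (F q) q (F x)).
  { unfold itv. intros x Hx. 
    assert (T1 := flip_decr _ d F x q H ltac:(lra) ltac:(lra) ltac:(lra)).
    assert (T2 := flip_decr _ d F (F q) x H ltac:(lra) ltac:(lra) ltac:(lra)). lra. }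
  assert (HKU : forall y, itv (F q) q y -> itv (F q) q (K y)).
  { unfold itv. intros y Hy. destruct (HFK y ltac:(lra)) as [T1 T2].
    split; apply (flip_decr_inv _ d F _ _ H); lra. }
  assert (K0 : K 0 = 0).
  { assert (T := HKF 0 ltac:(lra)). rewrite F0 in T. exact T. }
  assert (EK0 : Derive K 0 = / Derive F 0).
  { rewrite (is_derive_unique K 0 _ (DK 0 ltac:(lra))), K0. reflexivity. }
  assert (Hli : -1 < / Derive F 0 < 0).
  { split; [|apply Rinv_lt_0_compat; lra].
    apply (Rmult_lt_reg_l (- Derive F 0)); [lra|].
    replace (- Derive F 0 * / Derive F 0) with (-1) by (field; lra). lra. }
  destruct (linearization s K (itv (F q) q) 0 (/ Derive F 0)) as (phi & P1 & P2 & P3).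
  - apply open_itv.
  - unfold itv; lra.
  - exact HKU.
  - apply (Cs_on_subset _ (itv (- d) d)); [|exact HKC]. unfold itv. intros; lra.
  - exact K0.
  - exact EK0.
  - lra.
  - rewrite Rabs_left; lra.
  - intros y Hy. assert (HKy := HKU y Hy). unfold itv in Hy, HKy.
    rewrite (is_derive_unique K y _ (DK y ltac:(lra))).
    assert (B := HB (K y) ltac:(unfold itv; lra)).
    assert (/ Derive F (K y) < 0) by (apply Rinv_lt_0_compat; lra). nra.
  - intros y Hy.
    destruct (proj2 (HBR ltac:(unfold itv; intros; lra) ltac:(auto) y) Hy) as (u & <- & Hu & HFu & HLu).
    apply (is_lim_seq_ext u); [|exact HLu].
    induction n as [|n IH]; [reflexivity|]. simpl. rewrite <- IH.
    rewrite <- (HFu n) . symmetry. apply HKF. assert (T := Hu (S n)). unfold itv in T. lra.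
  - assert (P4 : forall x, itv (F q) q x -> itv (F q) q (F x) /\ phi (F x) = Derive F 0 * phi x).
    { intros x Hx. split; [apply HFU, Hx|].
      assert (T := P3 (F x) (HFU x Hx)). unfold itv in Hx. rewrite HKF in T by lra. rewrite T. field. lra. }
    exists phi. split; [exact P1|]. split; [exact P2|]. split; [exact P4|].
    assert (phi0 : phi 0 = 0).
    { destruct (P4 0) as [_ E]; [unfold itv; lra|]. rewrite F0 in E. nra. }
    set (lam := Derive F 0) in *.
    assert (Hll : 1 < lam * lam) by nra.
    assert (Low : forall w, exists v, (exists x, itv (F q) q x /\ phi x = v) /\ v <= w).
    { apply (unbounded_below_of_scaling _ (lam * lam) (phi (F q / 2))); [exact Hll| | |].
      - exists (F q / 2). split; [unfold itv; lra|reflexivity].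
      - rewrite <- phi0. apply (Cs_increasing _ _ _ phi _ _ P1 P2); lra.
      - intros v (x & Hx & <-). exists (F (F x)).
        destruct (P4 x Hx) as [A1 A2]. destruct (P4 _ A1) as [B1 B2]. split; [exact B1|].
        rewrite B2, A2. ring. }
    assert (Up : forall w, exists v, (exists x, itv (F q) q x /\ - phi x = v) /\ v <= w).
    { apply (unbounded_below_of_scaling _ (lam * lam) (- phi (q / 2))); [exact Hll| | |].
      - exists (q / 2). split; [unfold itv; lra|reflexivity].
      - assert (phi 0 < phi (q / 2)) by (apply (Cs_increasing _ _ _ phi _ _ P1 P2); lra). lra.
      - intros v (x & Hx & <-). exists (F (F x)).
        destruct (P4 x Hx) as [A1 A2]. destruct (P4 _ A1) as [B1 B2]. split; [exact B1|].
        rewrite B2, A2. ring. }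
    intros w. destruct (Low w) as (v1 & (x1 & Hx1 & <-) & L1).
    destruct (Up (- w)) as (v2 & (x2 & Hx2 & <-) & L2).
    assert (Hx12 : x1 <= x2).
    { destruct (Rle_lt_dec x1 x2) as [T|T]; [exact T|]. unfold itv in *.
      assert (phi x2 < phi x1) by (apply (Cs_increasing _ _ _ phi _ _ P1 P2); lra). lra. }
    unfold itv in *.
    destruct (Cs_IVT _ _ _ phi x1 x2 w P1) as [x [Hx Ex]]; try lra.
    exists x. split; [lra|exact Ex].
Qed.

Lemma repulsion_conjugacy s dF F q dG G q' : flip (S (S s)) dF F -> cycle dF F q -> q < dF / 4 ->
  flip (S (S s)) dG G -> cycle dG G q' -> q' < dG / 4 -> Derive F 0 = Derive G 0 -> Derive F 0 < -1 ->
  Cs_conjugate (S (S s)) (itv (F q) q) (itv (G q') q') F G.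
Proof.
  intros HF CF Hq HG CG Hq' El Hl.
  destruct (repulsion_linearization s dF F q HF CF Hq Hl) as (phi & Pc & Pd & Pe & Ps).
  destruct (repulsion_linearization s dG G q' HG CG Hq') as (psi & Qc & Qd & Qe & Qs); [lra|].
  rewrite <- El in Qe.
  destruct (transport (S s) (F q) q (G q') q' (F q) q (G q') q' phi psi 1 0)
    as (h & Hh1 & Hh2 & Hh3 & Hh4); auto; try lra.
  - intros t Ht. destruct (Ps (psi t)) as [x [Hx Ex]]. exists x. split; [exact Hx|lra].
  - apply (conj_of_transport (S s) _ _ _ _ F G h); try assumption.
    + intros x Hx. apply Hh3, Hx.
    + intros x Hx HFx. destruct (Hh3 x Hx) as [A1 A2]. destruct (Hh3 _ HFx) as [B1 B2].
      destruct (Pe x Hx) as [_ E1]. destruct (Qe (h x) A1) as [C1 E2].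
      apply (Cs_increasing_inj _ _ _ psi _ _ Qc Qd); [exact B1|exact C1|].
      rewrite B2, E2, A2, E1. ring.
Qed.

Lemma flip_multiplier r d F x : flip (S r) d F -> - d < x < d -> 0 < Derive F x * Derive F (F x).
Proof.
  intros H Hx. assert (T := flip_in_d r d F x H Hx).
  destruct H as (Hd & _ & _ & B).
  assert (B1 := B x ltac:(unfold itv; lra)). assert (B2 := B (F x) ltac:(unfold itv; lra)). nra.
Qed.

(** F o F is linearized at [q] on all of (0, d).  Points of (0, q) have preimages under F o F
    in (0, q), where the coordinate is multiplied by the inverse of the multiplier: it is
    unbounded below. *)
Lemma attraction_linearization s d F q : flip (S (S s)) d F -> cycle d F q ->
  exists phi, Cs_on (S (S s)) (itv 0 d) phi /\ (forall x, itv 0 d x -> 0 < Derive phi x) /\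
    (forall x, itv 0 d x -> itv 0 d (F (F x)) /\
        phi (F (F x)) = (Derive F q * Derive F (F q)) * phi x) /\ phi q = 0 /\
    (forall w, w <= 0 -> exists x, 0 < x <= q /\ phi x = w).
Proof.
  intros H HC. assert (XP := cycle_crossing_pos _ d F q H HC).
  assert (H' := H). destruct H' as (Hd & F0 & HCF & HB0).
  assert (HC' := HC). destruct HC' as (Hq & E & Hm & HB & HA).
  set (m := Derive F q * Derive F (F q)) in *.
  assert (Hm0 : 0 < m) by (apply (flip_multiplier _ d F q H); lra).
  assert (DA : forall x, itv 0 d x -> is_derive (fun x => F (F x)) x (Derive F x * Derive F (F x))).
  { unfold itv. intros x Hx. apply (flip_sq_der _ d F x H). lra. }
  assert (HU : forall x, itv 0 d x -> itv 0 d (F (F x))).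
  { unfold itv. intros x Hx. split.
    - assert (T := flip_sq_incr _ d F 0 x H ltac:(lra) ltac:(lra) ltac:(lra)).
      rewrite !F0 in T. exact T.
    - destruct (Rlt_le_dec x q) as [T|[T|T]].
      + assert (Q := flip_sq_incr _ d F x q H ltac:(lra) ltac:(lra) T). lra.
      + assert (Q := HA x ltac:(lra)). lra.
      + subst x. lra. }
  destruct (linearization s (fun x => F (F x)) (itv 0 d) q m) as (phi & P1 & P2 & P3).
  - apply open_itv.
  - exact Hq.
  - exact HU.
  - apply (Cs_on_subset _ (itv (- d) d)); [|apply (flip_sq_Cs _ d F H)]. unfold itv. intros; lra.
  - exact E.
  - apply is_derive_unique, DA. exact Hq.
  - lra.
  - rewrite Rabs_pos_eq; lra.
  - intros x Hx. rewrite (is_derive_unique _ _ _ (DA x Hx)). apply Rmult_lt_0_compat; [exact Hm0|].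
    apply (flip_multiplier _ d F x H). unfold itv in Hx. lra.
  - intros x Hx. apply (crossing_attract _ _ _ _ XP x Hx).
  - assert (phiq : phi q = 0).
    { assert (T := P3 q Hq). cbv beta in T. rewrite E in T. nra. }
    exists phi. split; [exact P1|]. split; [exact P2|]. split; [intros x Hx; split; auto|].
    split; [exact phiq|].
    assert (Low : forall w, exists v, (exists x, 0 < x < q /\ phi x = v) /\ v <= w).
    { apply (unbounded_below_of_scaling _ (/ m) (phi (q / 2))).
      - rewrite <- Rinv_1. apply Rinv_lt_contravar; lra.
      - exists (q / 2). split; [lra|reflexivity].
      - rewrite <- phiq. apply (Cs_increasing _ _ _ phi _ _ P1 P2); lra.
      - intros v (x & Hx & <-).
        destruct (IVT_between (fun x => F (F x)) 0 x x) as [z [Hz Ez]].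
        + lra.
        + intros t Ht. apply (flip_sq_cont _ d F t H). lra.
        + assert (T := HB x Hx). rewrite !F0. lra.
        + assert (Hz0 : 0 < z).
          { destruct (proj1 Hz) as [T|T]; [exact T|]. subst z. rewrite !F0 in Ez. lra. }
          exists z. split; [lra|].
          assert (T := P3 z ltac:(unfold itv; lra)). cbv beta in T. rewrite Ez in T.
          rewrite T. field. lra. }
    intros w Hw. destruct (Low w) as (v1 & (x1 & Hx1 & <-) & L1).
    destruct (Cs_IVT _ _ _ phi x1 q w P1) as [x [Hx Ex]]; try lra.
    exists x. split; [lra|exact Ex].
Qed.

(** Conjugacy of the second iterates on the right half; the constant is fixed by h(b) = y. *)
Lemma attraction_transport s dF F q b dG G q' y : flip (S (S s)) dF F -> cycle dF F q ->
  flip (S (S s)) dG G -> cycle dG G q' ->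
  Derive F q * Derive F (F q) = Derive G q' * Derive G (G q') ->
  q < b < dF -> q' < y < dG ->
  exists h, Cs_on (S (S s)) (itv 0 b) h /\ (forall x, itv 0 b x -> 0 < Derive h x) /\
    (forall x, itv 0 b x -> itv 0 y (h x)) /\
    (forall t, itv 0 y t -> exists x, itv 0 b x /\ h x = t) /\ 
    (forall x, itv 0 b x -> h (F (F x)) = G (G (h x))).
Proof.
  intros HF CF HG CG Em Hb Hy.
  destruct (attraction_linearization s dF F q HF CF) as (phi & Pc & Pd & Pe & Pq & Ps).
  destruct (attraction_linearization s dG G q' HG CG) as (psi & Qc & Qd & Qe & Qq & Qs).
  rewrite <- Em in Qe. set (m := Derive F q * Derive F (F q)) in *.
  assert (Hq := proj1 CF). assert (Hq' := proj1 CG).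
  assert (phib : 0 < phi b) by (rewrite <- Pq; apply (Cs_increasing _ _ _ phi _ _ Pc Pd); lra).
  assert (psiy : 0 < psi y) by (rewrite <- Qq; apply (Cs_increasing _ _ _ psi _ _ Qc Qd); lra).
  set (c := psi y / phi b). assert (Hc : 0 < c) by (apply Rdiv_lt_0_compat; assumption).
  assert (Hcb : c * phi b = psi y) by (unfold c; field; lra).
  destruct (transport (S s) 0 dF 0 dG 0 b 0 y phi psi c 0) as (h & Hh1 & Hh2 & Hh3 & Hh4); try assumption.
  - unfold itv; intros; lra.
  - unfold itv; intros; lra.
  - intros x Hx. unfold itv in Hx.
    destruct (Rle_lt_dec (c * phi x) 0) as [T|T].
    + destruct (Qs (c * phi x) T) as [t [Ht Et]]. exists t. split; [unfold itv; lra|lra].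
    + assert (T2 : phi x < phi b) by (apply (Cs_increasing _ _ _ phi _ _ Pc Pd); lra).
      assert (T4 : c * phi x < c * phi b) by (apply Rmult_lt_compat_l; lra).
      destruct (Cs_IVT _ _ _ psi q' y (c * phi x) Qc) as [t [Ht Et]]; try lra.
      exists t. split; [|lra]. unfold itv. split; [lra|].
      apply (Cs_increasing_rev _ _ _ psi _ _ Qc Qd); unfold itv; lra.
  - intros t Ht. unfold itv in Ht.
    assert (Ect : c * (psi t / c) = psi t) by (field; lra).
    destruct (Rle_lt_dec (psi t / c) 0) as [T|T].
    + destruct (Ps (psi t / c) T) as [x [Hx Ex]]. exists x. rewrite Ex. split; [unfold itv; lra|lra].
    + assert (T2 : psi t < psi y) by (apply (Cs_increasing _ _ _ psi _ _ Qc Qd); lra).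
      assert (T3 : psi t / c < phi b) by (apply (Rmult_lt_reg_l c); lra).
      destruct (Cs_IVT _ _ _ phi q b (psi t / c) Pc) as [x [Hx Ex]]; try lra.
      exists x. rewrite Ex. split; [|lra]. unfold itv. split; [lra|].
      apply (Cs_increasing_rev _ _ _ phi _ _ Pc Pd); unfold itv; lra.
  - exists h. split; [exact Hh1|]. split; [exact Hh2|]. split; [intros x Hx; apply Hh3, Hx|].
    split; [exact Hh4|].
    intros x Hx. unfold itv in Hx.
      destruct (Pe x ltac:(unfold itv; lra)) as [A1 A2].
      assert (HAx : itv 0 b (F (F x))).
      { unfold itv in *. split; [lra|]. destruct CF as (_ & E & _ & HB & HA).
        destruct (Rlt_le_dec x q) as [T|[T|T]].
        - assert (Q := flip_sq_incr _ dF F x q HF ltac:(lra) ltac:(lra) T). lra.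
        - assert (Q := HA x ltac:(lra)). lra.
        - subst x. lra. }
      destruct (Hh3 x Hx) as [B1 B2]. destruct (Hh3 _ HAx) as [C1 C2].
      unfold itv in B1, C1. destruct (Qe (h x) ltac:(unfold itv; lra)) as [D1 D2].
      apply (Cs_increasing_inj _ _ _ psi _ _ Qc Qd); [unfold itv; lra|exact D1|].
      rewrite C2, D2, B2, A2. ring.
Qed.

(** On the left of 0 the relation G h = h F forces the value G^-1 (h (F x)); [K] is G^-1. *)
Definition side_ext (h F K : R -> R) (x : R) : R :=
  if Rlt_dec 0 x then h x else if Req_dec_T x 0 then 0 else K (h (F x)).

Definition punctured (n b : R) : R -> Prop := fun x => itv n b x /\ x <> 0.

Lemma open_punctured n b : open (punctured n b).
Proof. apply (open_and (itv n b) (fun x => x <> 0)); [apply open_itv|apply open_neq]. Qed.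

(** If h conjugates the second iterates on the right half, its extension H by G^-1 h F
    conjugates F and G: on the left G H = h F, and on the right H F = G^-1 h F F = G^-1 G G h = G h.
    The position of [v] follows from F (F x) < F n < b for x < b.  The formula for the derivative
    on the left serves to study smoothness at 0. *)
Lemma side_extension s dF F n b dG G y h : flip (S s) dF F -> trap dF F n b ->
  flip (S s) dG G -> 0 < y < dG / 4 ->
  Cs_on (S s) (itv 0 b) h -> (forall x, itv 0 b x -> 0 < Derive h x) ->
  (forall x, itv 0 b x -> itv 0 y (h x)) ->
  (forall t, itv 0 y t -> exists x, itv 0 b x /\ h x = t) ->
  (forall x, itv 0 b x -> h (F (F x)) = G (G (h x))) ->
  exists v H, - (2 * y) < v < - (y / 16) /\
    (forall x, 0 < x -> H x = h x) /\ H 0 = 0 /\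
    (forall x, n < x < 0 -> is_derive H x (Derive F x * Derive h (F x) * / Derive G (H x))) /\
    Cs_on (S s) (punctured n b) H /\ (forall x, punctured n b x -> 0 < Derive H x) /\
    (forall x, punctured n b x -> punctured v y (H x)) /\
    (forall t, punctured v y t -> exists x, punctured n b x /\ H x = t) /\
    (forall x z, itv n b x -> itv n b z -> H x = H z -> x = z) /\
    (forall x, itv n b x -> H (F x) = G (H x)) /\ trap dG G v y.
Proof.
  intros HF HT HG Hy HhC Hhp Hhi Hhs Hhc.
  destruct (flip_inverse _ dG G HG) as (K & HKG & HGK & HKC & HKp & HKdec & DK).
  assert (HF' := HF). destruct HF' as (HdF & F0 & HCF & HBF).
  assert (HG' := HG). destruct HG' as (HdG & G0 & HCG & HBG).
  assert (HT' := HT). destruct HT' as (Hn & Hb & HFb & HFn).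
  assert (HFnp : 0 < F n) by (assert (B := flip_neg _ dF F n HF ltac:(lra)); lra).
  assert (Hhinc : forall x z, 0 < x -> z < b -> x < z -> h x < h z).
  { intros x z Hx Hz Hxz. apply (Cs_increasing s 0 b h x z HhC Hhp Hx Hz Hxz). }
  set (H := side_ext h F K).
  assert (Hpos : forall x, 0 < x -> H x = h x).
  { intros x Hx. unfold H, side_ext. destruct (Rlt_dec 0 x); [reflexivity|lra]. }
  assert (H0 : H 0 = 0).
  { unfold H, side_ext. destruct (Rlt_dec 0 0); [lra|]. destruct (Req_dec_T 0 0); [reflexivity|lra]. }
  assert (Hneg : forall x, x < 0 -> H x = K (h (F x))).
  { intros x Hx. unfold H, side_ext. destruct (Rlt_dec 0 x); [lra|].
    destruct (Req_dec_T x 0); [lra|reflexivity]. }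
  assert (HFx : forall x, n < x < 0 -> 0 < F x < F n).
  { intros x Hx. assert (B := flip_neg _ dF F x HF ltac:(lra)).
    assert (T := flip_decr _ dF F n x HF ltac:(lra) ltac:(lra) ltac:(lra)). lra. }
  set (v := K (h (F n))).
  assert (HhFn : itv 0 y (h (F n))) by (apply Hhi; unfold itv; lra).
  assert (HhFn2 : y / 8 < h (F n)).
  { destruct (Hhs (y / 2) ltac:(unfold itv; lra)) as [x [Hx Ex]]. unfold itv in Hx.
    assert (T1 := Hhc x Hx). rewrite Ex in T1.
    assert (T2 := flip_pos _ dG G (y / 2) HG ltac:(lra)).
    assert (T3 := flip_neg _ dG G (G (y / 2)) HG ltac:(lra)).
    assert (Q0 := flip_pos _ dF F x HF ltac:(lra)).
    assert (Q1 : F (F x) < F n).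
    { assert (Q := flip_decr _ dF F x b HF ltac:(lra) ltac:(lra) ltac:(lra)).
      apply (flip_decr _ dF F _ _ HF); lra. }
    assert (Q2 := flip_neg _ dF F (F x) HF ltac:(lra)).
    assert (Q3 := Hhinc (F (F x)) (F n) ltac:(lra) HFn Q1). lra. }
  assert (Hv : - (2 * y) < v < - (y / 16)).
  { unfold itv in HhFn. assert (T := HKp (h (F n)) ltac:(lra)). fold v in T. lra. }
  assert (Hvl : - (2 * y) < v) by lra.
  assert (HKn : forall x, n < x < 0 -> v < H x < 0).
  { intros x Hx. rewrite Hneg by lra. assert (T := HFx x Hx).
    assert (T2 := Hhi (F x) ltac:(unfold itv; lra)). unfold itv in T2, HhFn.
    assert (T3 := HKp (h (F x)) ltac:(lra)). split; [|lra].
    apply HKdec; try lra. apply Hhinc; lra. }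
  assert (HpI : forall x, 0 < x < b -> 0 < H x < y).
  { intros x Hx. rewrite Hpos by lra. apply Hhi. exact Hx. }
  assert (DHn : forall x, n < x < 0 -> is_derive H x (Derive F x * Derive h (F x) * / Derive G (H x))).
  { intros x Hx. apply (is_derive_ext_on (itv n 0) (fun x => K (h (F x)))); [apply open_itv|exact Hx| |].
    - intros z Hz. symmetry. apply Hneg, Hz.
    - assert (T := HFx x Hx). assert (T2 := Hhi (F x) ltac:(unfold itv; lra)). unfold itv in T2.
      rewrite Hneg by lra.
      apply (is_derive_comp K (fun x => h (F x))).
      + apply DK. lra.
      + apply (is_derive_comp h F).
        * apply (Cs_on_derive s (itv 0 b)); [exact HhC|unfold itv; lra].
        * apply (flip_der _ dF F x HF). lra. }
  assert (DHp : forall x, 0 < x < b -> is_derive H x (Derive h x)).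
  { intros x Hx. apply (is_derive_ext_on (itv 0 b) h); [apply open_itv|exact Hx| |].
    - intros z Hz. symmetry. apply Hpos, Hz.
    - apply (Cs_on_derive s (itv 0 b)); [exact HhC|exact Hx]. }
  assert (Hpun : forall x, punctured n b x -> n < x < 0 \/ 0 < x < b).
  { unfold punctured, itv. intros x [T1 T2]. destruct (Rtotal_order x 0) as [T|[T|T]]; lra. }
  assert (HCn : Cs_on (S s) (itv n 0) H).
  { apply (Cs_on_ext (S s) (itv n 0) (fun x => K (h (F x)))); [apply open_itv| |].
    - intros x Hx. symmetry. apply Hneg, Hx.
    - apply (Cs_on_comp (S s) (itv n 0) (itv 0 y) K (fun x => h (F x))); try apply open_itv.
      + intros x Hx. apply Hhi. assert (T := HFx x Hx). unfold itv. lra.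
      + apply (Cs_on_subset _ (itv (- dG) dG)); [|exact HKC]. unfold itv. intros; lra.
      + apply (Cs_on_comp (S s) (itv n 0) (itv 0 b) h F); try apply open_itv; try assumption.
        * intros x Hx. assert (T := HFx x Hx). unfold itv. lra.
        * apply (Cs_on_subset _ (itv (- (2 * dF)) (2 * dF))); [|exact HCF]. unfold itv. intros; lra. }
  assert (HCp : Cs_on (S s) (itv 0 b) H).
  { apply (Cs_on_ext (S s) (itv 0 b) h); [apply open_itv| |exact HhC].
    intros x Hx. symmetry. apply Hpos, Hx. }
  assert (Hder : forall x, punctured n b x -> 0 < Derive H x).
  { intros x Hx. destruct (Hpun x Hx) as [T|T].
    - rewrite (is_derive_unique _ _ _ (DHn x T)).
      assert (T2 := HFx x T). assert (T3 := Hhp (F x) ltac:(unfold itv; lra)).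
      assert (T4 := HBF x ltac:(unfold itv; lra)). assert (T5 := HKn x T).
      assert (T6 := HBG (H x) ltac:(unfold itv; lra)).
      assert (T7 : / Derive G (H x) < 0) by (apply Rinv_lt_0_compat; lra).
      assert (Derive F x * Derive h (F x) < 0) by nra. nra.
    - rewrite (is_derive_unique _ _ _ (DHp x T)). apply Hhp, T. }
  assert (Hinc : forall x z, n < x -> z < b -> x < z -> H x < H z).
  { assert (In : forall x z, n < x -> z < 0 -> x < z -> H x < H z).
    { intros x z Hx Hz Hxz. apply (Cs_increasing s n 0 H x z HCn); try assumption.
      intros t Ht. apply Hder. unfold punctured, itv in *. lra. }
    intros x z Hx Hz Hxz.
    destruct (Rtotal_order x 0) as [T|[T|T]].
    - destruct (Rtotal_order z 0) as [T'|[T'|T']].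
      + apply In; assumption.
      + subst z. rewrite H0. apply HKn. lra.
      + assert (Q1 := HKn x ltac:(lra)). assert (Q2 := HpI z ltac:(lra)). lra.
    - subst x. rewrite H0. apply HpI. lra.
    - rewrite !Hpos by lra. apply Hhinc; lra. }
  exists v, H. split; [lra|]. split; [exact Hpos|]. split; [exact H0|].
  split; [exact DHn|]. split; [|split; [exact Hder|split; [|split; [|split; [|split]]]]].
  - intros x Hx. destruct (Hpun x Hx) as [T|T]; [apply HCn, T|apply HCp, T].
  - intros x Hx. unfold punctured, itv. destruct (Hpun x Hx) as [T|T];
    [assert (Q := HKn x T)|assert (Q := HpI x T)]; lra.
  - intros t [Ht Ht0]. unfold itv in Ht. destruct (Rlt_dec 0 t) as [T|T].
    + destruct (Hhs t ltac:(unfold itv; lra)) as [x [Hx Ex]]. exists x. unfold itv in Hx.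
      split; [unfold punctured, itv; lra|]. rewrite Hpos by lra. exact Ex.
    + assert (Q := flip_neg _ dG G t HG ltac:(lra)).
      assert (Qv : G v = h (F n)) by (apply HGK; unfold itv in HhFn; lra).
      assert (Q2 := flip_decr _ dG G v t HG ltac:(lra) ltac:(lra) ltac:(lra)).
      unfold itv in HhFn.
      destruct (Hhs (G t) ltac:(unfold itv; lra)) as [z [Hz Ez]]. unfold itv in Hz.
      assert (HzF : z < F n) by (apply (Cs_increasing_rev s 0 b h z (F n) HhC Hhp); unfold itv; lra).
      destruct (IVT_between (fun x => - F x) n 0 (- z)) as [x [Hx Ex]]; [lra| |lra|].
      { intros x Hx. apply (continuous_opp F), (flip_cont _ dF _ x HF). lra. }
      assert (Hx' : n < x < 0).
      { split.
        - destruct (proj1 Hx) as [A|A]; [exact A|]. subst x. lra.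
        - destruct (proj2 Hx) as [A|A]; [exact A|]. subst x. rewrite F0 in Ex. lra. }
      exists x. split; [unfold punctured, itv; lra|].
      rewrite Hneg by lra. replace (F x) with z by lra. rewrite Ez. apply HKG. lra.
  - intros x z Hx Hz E. unfold itv in *. destruct (Rtotal_order x z) as [T|[T|T]]; [|exact T|].
    + assert (Q := Hinc x z ltac:(lra) ltac:(lra) T). lra.
    + assert (Q := Hinc z x ltac:(lra) ltac:(lra) T). lra.
  - intros x Hx. unfold itv in Hx. destruct (Rtotal_order x 0) as [T|[T|T]].
    + assert (Q := HFx x ltac:(lra)). rewrite (Hneg x T), (Hpos (F x)) by lra.
      symmetry. apply HGK. assert (Q2 := Hhi (F x) ltac:(unfold itv; lra)). unfold itv in Q2. lra.
    + subst x. rewrite F0, H0, G0. reflexivity.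
    + assert (Q := flip_pos _ dF F x HF ltac:(lra)).
      rewrite (Hneg (F x)), (Hpos x) by lra. rewrite Hhc by (unfold itv; lra). apply HKG.
      assert (Q2 := Hhi x ltac:(unfold itv; lra)). unfold itv in Q2.
      assert (Q3 := flip_pos _ dG G (h x) HG ltac:(lra)). lra.
  - assert (Qv : G v = h (F n)) by (apply HGK; unfold itv in HhFn; lra).
    unfold itv in HhFn. split; [lra|]. split; [lra|]. split; [|lra].
    (* v < G y because F n > F (F b) *)
    assert (Ey : G y = K (G (G y))).
    { symmetry. apply HKG. assert (Q := flip_pos _ dG G y HG ltac:(lra)). lra. }
    assert (QG := flip_pos _ dG G y HG ltac:(lra)).
    assert (QG1 := flip_neg _ dG G (G y) HG ltac:(lra)).
    rewrite Ey. apply HKdec; [lra|lra|].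
    destruct (Rlt_le_dec (G (G y)) (h (F n))) as [T|T]; [exact T|exfalso].
    (* a point z strictly between F (F b) and F n is F (F x) for some x < b *)
    assert (QF := flip_pos _ dF F b HF ltac:(lra)).
    assert (QF1 := flip_neg _ dF F (F b) HF ltac:(lra)).
    assert (HAb : F (F b) < F n) by (apply (flip_decr _ dF F _ _ HF); lra).
    set (z := (F (F b) + F n) / 2). assert (Hz : F (F b) < z < F n) by (unfold z; lra).
    assert (Hhz := Hhinc z (F n) ltac:(lra) HFn ltac:(lra)).
    assert (Hhz2 := Hhi z ltac:(unfold itv; lra)). unfold itv in Hhz2.
    assert (B1 := HKp (h z) ltac:(lra)).
    destruct (HGK (h z) ltac:(lra)) as [_ E1]. destruct (HGK (K (h z)) ltac:(lra)) as [C2 E2].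
    set (t := K (K (h z))) in *.
    assert (Ht0 : 0 < t).
    { destruct (Rtotal_order t 0) as [T'|[T'|T']]; [|rewrite T' in E2; lra|exact T'].
      assert (Q := flip_neg _ dG G t HG ltac:(lra)). lra. }
    assert (Hty : t < y).
    { assert (Q := flip_pos _ dG G t HG ltac:(lra)).
      destruct (Rlt_le_dec t y) as [T'|[T'|T']]; [exact T'| |].
      - assert (Q' := flip_sq_incr _ dG G y t HG ltac:(lra) ltac:(lra) T'). rewrite E2, E1 in Q'. lra.
      - rewrite <- T' in E2. rewrite E2, E1 in T. lra. }
    destruct (Hhs t ltac:(unfold itv; lra)) as [x [Hx Ex]].
    assert (Q := Hhc x Hx). rewrite Ex, E2, E1 in Q. unfold itv in Hx.
    assert (Q1 := flip_sq_incr _ dF F x b HF ltac:(lra) ltac:(lra) ltac:(lra)).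
    assert (Q3 := flip_pos _ dF F x HF ltac:(lra)).
    assert (Q4 := flip_neg _ dF F (F x) HF ltac:(lra)).
    assert (Q2 := Hhinc (F (F x)) z ltac:(lra) ltac:(lra) ltac:(lra)). lra.
Qed.

(** * Fatou coordinates of germs tangent to the identity *)

(** The last three inequalities make [d] small enough for the cubic term to dominate. *)
Definition parabolic (d ga C : R) (A A' : R -> R) : Prop :=
  0 < d /\ 0 < ga /\ 0 < C /\
  (forall x, 0 < x < d -> is_derive A x (A' x) /\ continuous A' x /\ 0 < A' x) /\
  (forall x, 0 < x < d -> Rabs (A x - x + ga * x ^ 3) <= C * x ^ 4) /\
  (forall x, 0 < x < d -> Rabs (A' x - 1 + 3 * ga * x ^ 2) <= C * x ^ 3) /\
  C * d <= ga / 2 /\ (ga + C) * d ^ 2 <= / 8 /\ d <= 1.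

Lemma parabolic_step d ga C A A' x : parabolic d ga C A A' -> 0 < x < d ->
  x / 2 < A x < x /\ ga / 2 * x ^ 3 <= x - A x.
Proof.
  intros (Hd & Hg & HC & _ & HA & _ & H1 & H2 & H3) Hx.
  specialize (HA x Hx). apply Rabs_le_between in HA.
  assert (Hx3 : 0 < x ^ 3) by (apply pow_lt; lra).
  assert (E4 : x ^ 4 = x * x ^ 3) by ring.
  assert (T1 : C * x ^ 4 <= ga / 2 * x ^ 3).
  { rewrite E4, <- Rmult_assoc. apply Rmult_le_compat_r; [lra|].
    apply Rle_trans with (2 := H1). apply Rmult_le_compat_l; lra. }
  assert (T2 : (ga + C) * x ^ 2 <= / 8).
  { apply Rle_trans with (2 := H2). apply Rmult_le_compat_l; [lra|].
    apply pow_incr. lra. }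
  assert (T3 : ga * x ^ 3 + C * x ^ 4 < x / 2).
  { assert (x ^ 4 <= x ^ 3) by (rewrite E4; nra).
    assert (C * x ^ 4 <= C * x ^ 3) by (apply Rmult_le_compat_l; lra).
    assert ((ga + C) * x ^ 3 <= x / 8).
    { replace (x ^ 3) with (x ^ 2 * x) by ring. rewrite <- Rmult_assoc.
      replace (x / 8) with (/ 8 * x) by field. apply Rmult_le_compat_r; lra. }
    lra. }
  assert (0 < ga * x ^ 3) by (apply Rmult_lt_0_compat; lra).
  split; lra.
Qed.

Lemma ln_bounds u : Rabs u <= / 2 -> u - 2 * u ^ 2 <= ln (1 + u) <= u.
Proof.
  intros Hu. apply Rabs_le_between in Hu.
  assert (U : forall t, 0 < t -> ln t <= t - 1).
  { intros t Ht. assert (T := exp_ineq1_le (ln t)). rewrite exp_ln in T by exact Ht. lra. }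
  split.
  - assert (T := U (/ (1 + u)) ltac:(apply Rinv_0_lt_compat; lra)).
    rewrite ln_Rinv in T by lra.
    assert (E : / (1 + u) - 1 = - u + u ^ 2 / (1 + u)) by (field; lra).
    assert (u ^ 2 / (1 + u) <= 2 * u ^ 2); [|lra].
    unfold Rdiv. rewrite Rmult_comm. apply Rmult_le_compat_r; [nra|].
    rewrite <- (Rinv_inv 2). apply Rinv_le_contravar; lra.
  - assert (T := U (1 + u) ltac:(lra)). lra.
Qed.

(** This is ln (A'(x) x^3 / A(x)^3), written so that its cubic size becomes visible. *)
Definition cocycle (A A' : R -> R) (x : R) : R := ln (A' x) - 3 * ln (A x / x).

(** The quadratic terms - 3 ga x^2 of ln A'(x) and of 3 ln (A(x) / x) cancel. *)
Lemma cocycle_bound d ga C A A' : parabolic d ga C A A' ->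
  exists C1, 0 < C1 /\ forall x, 0 < x < d -> Rabs (cocycle A A' x) <= C1 * x ^ 3.
Proof.
  intros HP. assert (HP' := HP). destruct HP' as (Hd & Hg & HC & _ & HA & HA' & H1 & H2 & H3).
  exists (4 * C + 40 * (ga + C) ^ 2).
  assert (HgC : 0 < (ga + C) ^ 2) by (apply pow_lt; lra).
  split; [nra|]. intros x Hx.
  specialize (HA x Hx). specialize (HA' x Hx).
  assert (Hx2 : 0 < x ^ 2) by (apply pow_lt; lra).
  assert (Hx3 : 0 < x ^ 3) by (apply pow_lt; lra).
  assert (Hx32 : x ^ 3 <= x ^ 2) by (replace (x ^ 3) with (x * x ^ 2) by ring; nra).
  assert (T2 : (ga + C) * x ^ 2 <= / 8).
  { apply Rle_trans with (2 := H2). apply Rmult_le_compat_l; [lra|]. apply pow_incr. lra. }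
  set (u := A' x - 1). set (t := A x / x - 1).
  assert (Ht : Rabs (t + ga * x ^ 2) <= C * x ^ 3).
  { replace (t + ga * x ^ 2) with ((A x - x + ga * x ^ 3) / x) by (unfold t; field; lra).
    unfold Rdiv. rewrite Rabs_mult, Rabs_inv, (Rabs_pos_eq x) by lra.
    apply (Rmult_le_reg_r x); [lra|]. rewrite Rmult_assoc, Rinv_l, Rmult_1_r by lra.
    apply Rle_trans with (1 := HA). right. ring. }
  replace (A' x - 1 + 3 * ga * x ^ 2) with (u + 3 * ga * x ^ 2) in HA' by (unfold u; ring).
  apply Rabs_le_between in Ht. apply Rabs_le_between in HA'.
  assert (HCx : C * x ^ 3 <= C * x ^ 2) by (apply Rmult_le_compat_l; lra).
  assert (Hgx : 0 < ga * x ^ 2) by (apply Rmult_lt_0_compat; lra).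
  assert (HCx0 : 0 < C * x ^ 2) by (apply Rmult_lt_0_compat; lra).
  assert (HCx3 : 0 < C * x ^ 3) by (apply Rmult_lt_0_compat; lra).
  set (M := (ga + C) * x ^ 2) in *.
  assert (EM : M = ga * x ^ 2 + C * x ^ 2) by (unfold M; ring).
  assert (Bt : - M <= t <= M) by lra.
  assert (Bu : - (3 * M) <= u <= 3 * M) by lra.
  assert (Lt := ln_bounds t ltac:(apply Rabs_le_between; lra)).
  assert (Lu := ln_bounds u ltac:(apply Rabs_le_between; lra)).
  replace (1 + t) with (A x / x) in Lt by (unfold t; ring).
  replace (1 + u) with (A' x) in Lu by (unfold u; ring).
  assert (t2 : t ^ 2 <= M ^ 2) by nra. assert (u2 : u ^ 2 <= 9 * M ^ 2) by nra.
  assert (HM : M ^ 2 <= (ga + C) ^ 2 * x ^ 3).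
  { unfold M. replace (((ga + C) * x ^ 2) ^ 2) with ((ga + C) ^ 2 * (x * x ^ 3)) by ring.
    apply Rmult_le_compat_l; [lra|]. nra. }
  unfold cocycle. apply Rabs_le_between.
  replace ((4 * C + 40 * (ga + C) ^ 2) * x ^ 3) with (4 * (C * x ^ 3) + 40 * ((ga + C) ^ 2 * x ^ 3)) by ring.
  split; lra.
Qed.

Fixpoint birkhoff (w A : R -> R) (n : nat) (x : R) : R :=
  match n with
  | O => 0
  | S n => birkhoff w A n x + w (Nat.iter n A x)
  end.

Lemma birkhoff_shift w A n x : birkhoff w A (S n) x = w x + birkhoff w A n (A x).
Proof.
  induction n as [|n IH]; [simpl; ring|].
  change (birkhoff w A (S (S n)) x) with (birkhoff w A (S n) x + w (Nat.iter (S n) A x)).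
  rewrite IH. simpl. rewrite (iter_swap A n x). ring.
Qed.

(** As |w x| <= C2 (x - A x), the sums along an orbit are dominated by a telescoping sum, and
    the tails by the points of the orbit. *)
Lemma birkhoff_limit (w A : R -> R) d C2 : 0 < d -> 0 <= C2 ->
  (forall x, 0 < x < d -> 0 < A x < x) ->
  (forall x y, 0 < x < d -> 0 < y < d -> x < y -> A x < A y) ->
  (forall x, 0 < x < d -> continuous A x) -> 
  (forall x, 0 < x < d -> continuous w x) ->
  (forall x, 0 < x < d -> is_lim_seq (fun n => Nat.iter n A x) 0) ->
  (forall x, 0 < x < d -> Rabs (w x) <= C2 * (x - A x)) ->
  exists u : R -> R, (forall x, 0 < x < d -> continuous u x /\ Rabs (u x) <= C2 * x /\
     u x = w x + u (A x)).
Proof.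
  intros Hd HC HA HAm HAc Hwc HL Hw.
  assert (HI : forall x n, 0 < x < d -> 0 < Nat.iter n A x < d).
  { intros x n Hx. apply (iter_in (fun x => 0 < x < d) A); [|exact Hx].
    intros y Hy. specialize (HA y Hy). lra. }
  assert (HE : forall x, 0 < x < d -> exists L : R, is_lim_seq (fun n => birkhoff w A n x) L /\
     forall n, Rabs (birkhoff w A n x - L) <= C2 * Nat.iter n A x).
  { intros x Hx.
    apply (pinched_limit (fun n => birkhoff w A n x) (fun n => C2 * Nat.iter n A x));
      [apply lim_scal_0, HL, Hx| | |]; intros n; assert (Q := HI x n Hx);
      specialize (Hw _ Q); apply Rabs_le_between in Hw; simpl; try lra.
    apply Rmult_le_pos; lra. }
  set (u := fun x => real (Lim_seq (fun n => birkhoff w A n x))).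
  assert (Hu : forall x, 0 < x < d -> is_lim_seq (fun n => birkhoff w A n x) (u x) /\
     forall n, Rabs (birkhoff w A n x - u x) <= C2 * Nat.iter n A x).
  { intros x Hx. destruct (HE x Hx) as [L [L1 L2]]. unfold u.
    rewrite (is_lim_seq_unique _ _ L1). split; assumption. }
  exists u. intros x Hx.
  assert (HAx : 0 < A x < d) by (specialize (HA x Hx); lra).
  split; [|split].
  - set (b := (x + d) / 2). assert (Hb : x < b < d) by (unfold b; lra).
    assert (Hm : forall n t, 0 < t < b -> 0 < Nat.iter n A t < Nat.iter n A b).
    { induction n as [|n IH]; intros t Ht; simpl; [exact Ht|].
      assert (T := IH t Ht). assert (Tb := HI b n ltac:(lra)).
      split; [apply HA; lra|apply HAm; lra]. }
    destruct (CVU_dom_bound (fun n => birkhoff w A n) u (itv 0 b) (fun n => C2 * Nat.iter n A b)) as [_ HU].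
    + apply lim_scal_0, HL. lra.
    + intros n t Ht. unfold itv in Ht. apply Rle_trans with (C2 * Nat.iter n A t).
      * apply Hu. lra.
      * apply Rmult_le_compat_l; [exact HC|]. left. apply Hm, Ht.
    + assert (Hci : forall n t, 0 < t < d -> continuous (fun t => Nat.iter n A t) t).
      { induction n as [|n IH]; intros t Ht; simpl; [apply continuous_id|].
        apply (continuous_comp (fun t => Nat.iter n A t) A); [apply IH, Ht|apply HAc, HI, Ht]. }
      assert (Hcb : forall n t, 0 < t < d -> continuous (birkhoff w A n) t).
      { induction n as [|n IH]; intros t Ht.
        - apply continuous_const.
        - apply (continuous_plus (birkhoff w A n) (fun t => w (Nat.iter n A t))); [apply IH, Ht|].
          apply (continuous_comp (fun t => Nat.iter n A t) w); [apply Hci, Ht|apply Hwc, HI, Ht]. }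
      apply continuity_pt_filterlim.
      apply (CVU_cont_open (fun n => birkhoff w A n) (itv 0 b)); try assumption.
      * apply open_itv.
      * intros n t Ht. unfold itv in Ht. apply continuity_pt_filterlim, Hcb. lra.
      * unfold itv; lra.
  - assert (T := proj2 (Hu x Hx) O). simpl in T.
    replace (0 - u x) with (- u x) in T by ring. rewrite Rabs_Ropp in T. exact T.
  - assert (L1 := proj1 (Hu x Hx)). apply is_lim_seq_incr_1 in L1.
    assert (L2 : is_lim_seq (fun n => birkhoff w A (S n) x) (w x + u (A x))).
    { apply (is_lim_seq_ext (fun n => w x + birkhoff w A n (A x))).
      - intros n. symmetry. apply birkhoff_shift.
      - apply is_lim_seq_plus'; [apply is_lim_seq_const|apply Hu, HAx]. }
    assert (E := is_lim_seq_unique _ _ L1). rewrite (is_lim_seq_unique _ _ L2) in E.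
    injection E as E. symmetry. exact E.
Qed.

(** The vector field x^3 / e(x) is invariant under A when u = ln e solves u = w + u o A with
    the cocycle w; phi is its time coordinate, so phi - phi o A has zero derivative. *)
Lemma fatou_coordinate d ga C A A' : parabolic d ga C A A' ->
  exists (phi e : R -> R) tau C2, 0 < tau /\ 0 < C2 /\
    (forall x, 0 < x < d -> is_derive phi x (e x / x ^ 3) /\ continuous e x /\ 0 < e x /\
       exp (- (C2 * x)) <= e x <= exp (C2 * x)) /\
    (forall x, 0 < x < d -> phi (A x) = phi x - tau).
Proof.
  intros HP. destruct (cocycle_bound d ga C A A' HP) as (C1 & HC1 & HB).
  assert (HS := fun x => parabolic_step d ga C A A' x HP).
  destruct HP as (Hd & Hg & HC & HDA & _).
  set (w := cocycle A A').
  assert (HA : forall x, 0 < x < d -> 0 < A x < x) by (intros x Hx; specialize (HS x Hx); lra).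
  assert (HAc : forall x, 0 < x < d -> continuous A x).
  { intros x Hx. apply (is_derive_continuous _ _ (A' x)), HDA, Hx. }
  set (C2 := 2 * C1 / ga).
  assert (HC2 : 0 < C2) by (unfold C2; apply Rdiv_lt_0_compat; lra).
  destruct (birkhoff_limit w A d C2) as [u Hu]; try assumption; [lra| | | | |].
  - apply (increasing_itv A A' (fun x => 0 < x < d)); [intros; lra|intros; apply HDA; assumption..].
  - intros x Hx. assert (T := HS x Hx). destruct (HDA x Hx) as (D1 & D2 & D3).
    assert (Hln : forall f : R -> R, continuous f x -> 0 < f x -> continuous (fun x => ln (f x)) x).
    { intros f Hf Hp. apply (continuous_comp f ln); [exact Hf|].
      apply continuity_pt_filterlim. apply derivable_continuous_pt. exists (/ f x).
      apply derivable_pt_lim_ln, Hp. }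
    apply (continuous_minus (fun x => ln (A' x)) (fun x => 3 * ln (A x / x))).
    + apply Hln; assumption.
    + apply (continuous_mult (fun _ => 3) (fun x => ln (A x / x))); [apply continuous_const|].
      apply Hln.
      * apply (continuous_mult A (fun x => / x)); [apply HAc, Hx|apply continuous_Rinv; lra].
      * apply Rdiv_lt_0_compat; lra.
  - intros x Hx. apply (attract_above (fun x => if Rlt_dec 0 x then A x else 0) 0 d) in Hx as Hx'.
    + destruct Hx' as [Q1 Q2]. apply (is_lim_seq_ext (fun n => Nat.iter n (fun x => if Rlt_dec 0 x then A x else 0) x)); [|exact Q2].
      induction n as [|n IH]; [reflexivity|]. simpl. rewrite IH. specialize (Q1 n). rewrite IH in Q1.
      destruct (Rlt_dec 0 (Nat.iter n A x)); [reflexivity|lra].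
    + intros y Hy. destruct (proj1 Hy) as [Ty|Ty].
      * apply (continuous_ext_on (fun z => 0 < z) A); [apply open_gt|exact Ty| |apply HAc; lra].
        intros z Hz. destruct (Rlt_dec 0 z); [reflexivity|lra].
      * subst y. intros P HPl. destruct (Rlt_dec 0 0) as [T|_]; [lra|].
        destruct HPl as [eps He].
        assert (Hm : 0 < Rmin eps d) by (apply Rmin_glb_lt; [apply cond_pos|exact Hd]).
        exists (mkposreal _ Hm). intros z Hz.
        assert (Hz' : Rabs (z - 0) < Rmin eps d) by exact Hz. rewrite Rminus_0_r in Hz'.
        assert (M1 := Rmin_l eps d). assert (M2 := Rmin_r eps d).
        apply He. change (Rabs ((if Rlt_dec 0 z then A z else 0) - 0) < eps). rewrite Rminus_0_r.
        destruct (Rlt_dec 0 z) as [T|T]; [|rewrite Rabs_R0; apply cond_pos].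
        rewrite Rabs_pos_eq in Hz' by lra. assert (Q := HA z ltac:(lra)). rewrite Rabs_pos_eq; lra.
    + intros y Hy. destruct (Rlt_dec 0 y); [apply HA, Hy|lra].
  - intros x Hx. apply Rle_trans with (1 := HB x Hx). assert (T := proj2 (HS x Hx)).
    unfold C2. replace (C1 * x ^ 3) with (2 * C1 / ga * (ga / 2 * x ^ 3)) by (field; lra).
    apply Rmult_le_compat_l; [|exact T]. fold C2. lra.
  - set (e := fun x => exp (u x)).
    assert (Hcp : 0 < d / 2) by lra.
    assert (Hball : forall x, oball (d / 2) (d / 2) x <-> 0 < x < d).
    { intros x. unfold oball. split; intros H; [apply Rabs_lt_between in H; lra|apply Rabs_lt_between; lra]. }
    assert (Hec : forall x, 0 < x < d -> continuous e x).
    { intros x Hx. apply (continuous_comp u exp).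
      - apply Hu, Hx.
      - apply (is_derive_continuous _ _ _ (is_derive_exp (u x))). }
    destruct (primitive_oball (fun x => e x / x ^ 3) (d / 2) (d / 2) Hcp) as [phi [_ Hphi]].
    { intros x Hx. apply Hball in Hx. apply (continuous_mult e (fun x => / x ^ 3)); [apply Hec, Hx|].
      apply continuous_Rinv_comp.
      - apply (@ex_derive_continuous R_AbsRing R_NormedModule). auto_derive. exact Logic.I.
      - apply pow_nonzero. lra. }
    assert (Hphi' : forall x, 0 < x < d -> is_derive phi x (e x / x ^ 3)).
    { intros x Hx. apply Hphi, Hball, Hx. }
    assert (Hpos : forall x, 0 < x < d -> 0 < e x / x ^ 3).
    { intros x Hx. apply Rdiv_lt_0_compat; [apply exp_pos|apply pow_lt; lra]. }
    assert (Hinc := increasing_itv phi (fun x => e x / x ^ 3) (fun x => 0 < x < d) ltac:(intros; lra) Hphi' Hpos).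
    assert (HD0 : forall x, 0 < x < d -> is_derive (fun x => phi x - phi (A x)) x 0).
    { intros x Hx. assert (HAx := HA x Hx).
      destruct (HDA x Hx) as (D1 & _ & D3).
      assert (Eq : A' x * (e (A x) / A x ^ 3) = e x / x ^ 3).
      { assert (Hr : 0 < A x / x) by (apply Rdiv_lt_0_compat; lra).
        unfold e. replace (u (A x)) with (u x + - w x) by (rewrite (proj2 (proj2 (Hu x Hx))); ring).
        rewrite exp_plus, exp_Ropp. unfold w, cocycle.
        replace (ln (A' x) - 3 * ln (A x / x)) with (ln (A' x) + - (INR 3 * ln (A x / x))) by (simpl; ring).
        rewrite exp_plus, exp_Ropp, exp_ln by exact D3.
        rewrite <- ln_pow by exact Hr. rewrite exp_ln by (apply pow_lt, Hr).
        field. repeat split; lra. }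
      replace 0 with (e x / x ^ 3 - A' x * (e (A x) / A x ^ 3)) by (rewrite Eq; ring).
      apply (is_derive_minus phi (fun x => phi (A x))); [apply Hphi', Hx|].
      apply (is_derive_comp phi A); [apply Hphi'; lra|exact D1]. }
    exists phi, e, (phi (d / 2) - phi (A (d / 2))), C2.
    assert (HAd := HA (d / 2) ltac:(lra)).
    split; [assert (T := Hinc (A (d / 2)) (d / 2) ltac:(lra) ltac:(lra) ltac:(lra)); lra|].
    split; [exact HC2|]. split.
    + intros x Hx. split; [apply Hphi', Hx|]. split; [apply Hec, Hx|]. split; [apply exp_pos|].
      destruct (Hu x Hx) as (_ & T & _). apply Rabs_le_between in T. unfold e.
      assert (Ex : forall a b, a <= b -> exp a <= exp b).
      { intros a b [T'|T']; [left; apply exp_increasing, T'|subst; lra]. }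
      split; apply Ex; lra.
    + intros x Hx.
      assert (T := const_of_derive_0 _ (fun x => 0 < x < d) ltac:(intros; lra) HD0 x (d / 2) Hx ltac:(lra)).
      cbv beta in T. lra.
Qed.

(** * Conjugacy of germs tangent to the identity *)

Definition rlim (f : R -> R) (l : R) : Prop := filterlim f (at_right 0) (locally l).

Lemma rlim_eps f l : rlim f l <->
  forall eps, 0 < eps -> exists d, 0 < d /\ forall x, 0 < x < d -> Rabs (f x - l) < eps.
Proof.
  split.
  - intros H eps He.
    destruct (H (fun y => Rabs (y - l) < eps)) as [d Hd].
    { exists (mkposreal _ He). intros y Hy. exact Hy. }
    exists d. split; [apply cond_pos|]. intros x Hx. apply Hd; [|apply Hx].
    change (Rabs (x - 0) < d). rewrite Rminus_0_r, Rabs_pos_eq; lra.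
  - intros H P [eps He]. destruct (H eps (cond_pos eps)) as [d [Hd Hx]].
    exists (mkposreal _ Hd). intros x Hb Hp. apply He. apply Hx.
    assert (Hb' : Rabs (x - 0) < d) by exact Hb.
    rewrite Rminus_0_r in Hb'. apply Rabs_lt_between in Hb'. lra.
Qed.

Lemma rlim_plus f g l m : rlim f l -> rlim g m -> rlim (fun x => f x + g x) (l + m).
Proof. intros Hf Hg. unfold rlim. eapply filterlim_comp_2; [exact Hf|exact Hg|exact (filterlim_plus l m)]. Qed.

Lemma rlim_mult f g l m : rlim f l -> rlim g m -> rlim (fun x => f x * g x) (l * m).
Proof. intros Hf Hg. unfold rlim. eapply filterlim_comp_2; [exact Hf|exact Hg|exact (filterlim_mult l m)]. Qed.

Lemma rlim_const l : rlim (fun _ => l) l.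
Proof. apply filterlim_const. Qed.

Lemma rlim_comp f g l : rlim f l -> continuous g l -> rlim (fun x => g (f x)) (g l).
Proof. intros Hf Hg. unfold rlim. eapply filterlim_comp; [exact Hf|exact Hg]. Qed.

Lemma rlim_opp f l : rlim f l -> rlim (fun x => - f x) (- l).
Proof.
  intros H. apply (rlim_comp f (fun x => - x) l H).
  apply (continuous_opp (fun x => x)), continuous_id.
Qed.

Lemma rlim_minus f g l m : rlim f l -> rlim g m -> rlim (fun x => f x - g x) (l - m).
Proof. intros Hf Hg. apply rlim_plus; [exact Hf|apply rlim_opp, Hg]. Qed.

Lemma rlim_inv f l : rlim f l -> l <> 0 -> rlim (fun x => / f x) (/ l).
Proof. intros H Hl. apply (rlim_comp f Rinv l H). apply continuous_Rinv, Hl. Qed.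

Lemma rlim_pow f l n : rlim f l -> rlim (fun x => f x ^ n) (l ^ n).
Proof.
  intros H. induction n as [|n IH]; [apply rlim_const|].
  apply (rlim_mult f (fun x => f x ^ n)); assumption.
Qed.

Lemma rlim_ext f g l d : 0 < d -> (forall x, 0 < x < d -> f x = g x) -> rlim f l -> rlim g l.
Proof.
  intros Hd E H. rewrite rlim_eps in *. intros eps He. destruct (H eps He) as [d1 [Hd1 H1]].
  destruct (pos_min2 d d1 Hd Hd1) as (e & He0 & A & B). exists e. split; [exact He0|]. intros x Hx.
  rewrite <- E by lra. apply H1. lra.
Qed.

Lemma rlim_id : rlim (fun x => x) 0.
Proof.
  apply rlim_eps. intros eps He. exists eps. split; [exact He|]. intros x Hx.
  rewrite Rminus_0_r, Rabs_pos_eq; lra.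
Qed.

Lemma rlim_squeeze f g k l d : 0 < d -> (forall x, 0 < x < d -> f x <= g x <= k x) ->
  rlim f l -> rlim k l -> rlim g l.
Proof.
  intros Hd E Hf Hk. rewrite rlim_eps in *. intros eps He.
  destruct (Hf eps He) as [d1 [Hd1 H1]]. destruct (Hk eps He) as [d2 [Hd2 H2]].
  destruct (pos_min3 d d1 d2 Hd Hd1 Hd2) as (e & He0 & A & B & B'). exists e. split; [exact He0|]. intros x Hx.
  specialize (E x ltac:(lra)). specialize (H1 x ltac:(lra)). specialize (H2 x ltac:(lra)).
  apply Rabs_lt_between in H1. apply Rabs_lt_between in H2. apply Rabs_lt_between. lra.
Qed.

Lemma rlim_subst f h l d : 0 < d -> rlim f l -> rlim h 0 -> (forall x, 0 < x < d -> 0 < h x) ->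
  rlim (fun x => f (h x)) l.
Proof.
  intros Hd Hf Hh Hp. rewrite rlim_eps in *. intros eps He.
  destruct (Hf eps He) as [d1 [Hd1 H1]]. destruct (Hh d1 Hd1) as [d2 [Hd2 H2]].
  destruct (pos_min2 d d2 Hd Hd2) as (e & He0 & A & B). exists e. split; [exact He0|]. intros x Hx.
  assert (P := Hp x ltac:(lra)). specialize (H2 x ltac:(lra)).
  rewrite Rminus_0_r, Rabs_pos_eq in H2 by lra. apply H1. lra.
Qed.

(** Comparison with the primitives - k / (2 x^2) of k / x^3, for k slightly above and below 1. *)
Lemma primitive_equiv d (phi e : R -> R) : 0 < d ->
  (forall x, 0 < x < d -> is_derive phi x (e x / x ^ 3)) -> rlim e 1 ->
  rlim (fun x => x ^ 2 * phi x) (- / 2).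
Proof.
  intros Hd Hphi He. rewrite rlim_eps in He. apply rlim_eps. intros eps Heps.
  destruct (He eps Heps) as [d1 [Hd1 H1]].
  destruct (pos_min2 (d / 2) (d1 / 2)) as (b & Hb & Hbd & Hbd1); [lra..|].
  assert (G : forall k x, 0 < x <= b -> is_derive (fun x => phi x + k / 2 * / x ^ 2) x ((e x - k) / x ^ 3)).
  { intros k x Hx. replace ((e x - k) / x ^ 3) with (e x / x ^ 3 + k / 2 * (- 2 / x ^ 3)) by (field; lra).
    apply (is_derive_plus phi (fun x => k / 2 * / x ^ 2)); [apply Hphi; lra|].
    apply (is_derive_scal (fun x => / x ^ 2)).
    auto_derive; [|field; lra]. rewrite ?Rmult_1_r. apply Rmult_integral_contrapositive_currified; lra. }
  assert (B1 : forall x, 0 < x < b -> phi x + (1 + eps) / 2 * / x ^ 2 >= phi b + (1 + eps) / 2 * / b ^ 2).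
  { intros x Hx. destruct (MVT_itv _ _ x b (proj2 Hx) (fun z Hz => G (1 + eps) z ltac:(lra))) as [c [Hc E]].
    cbv beta in E. assert (T := H1 c ltac:(lra)). apply Rabs_lt_between in T.
    assert (0 < / c ^ 3) by (apply Rinv_0_lt_compat, pow_lt; lra).
    assert ((e c - (1 + eps)) / c ^ 3 <= 0) by (unfold Rdiv; nra). nra. }
  assert (B2 : forall x, 0 < x < b -> phi x + (1 - eps) / 2 * / x ^ 2 <= phi b + (1 - eps) / 2 * / b ^ 2).
  { intros x Hx. destruct (MVT_itv _ _ x b (proj2 Hx) (fun z Hz => G (1 - eps) z ltac:(lra))) as [c [Hc E]].
    cbv beta in E. assert (T := H1 c ltac:(lra)). apply Rabs_lt_between in T.
    assert (0 < / c ^ 3) by (apply Rinv_0_lt_compat, pow_lt; lra).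
    assert (0 <= (e c - (1 - eps)) / c ^ 3) by (unfold Rdiv; nra). nra. }
  set (C1 := phi b + (1 + eps) / 2 * / b ^ 2) in *. set (C2 := phi b + (1 - eps) / 2 * / b ^ 2) in *.
  set (M := Rabs C1 + Rabs C2 + 1).
  assert (HM : 1 <= M) by (unfold M; assert (T := Rabs_pos C1); assert (T' := Rabs_pos C2); lra).
  destruct (pos_min3 b 1 (eps / (2 * M))) as (e0 & He0 & A3 & A4 & A2); [lra..|apply Rdiv_lt_0_compat; lra|].
  exists e0. split; [exact He0|]. intros x Hx.
  specialize (B1 x ltac:(lra)). specialize (B2 x ltac:(lra)).
  assert (Hx2 : 0 < x ^ 2) by (apply pow_lt; lra).
  assert (HxM : x ^ 2 * M < eps / 2).
  { apply Rle_lt_trans with (x * M); [apply Rmult_le_compat_r; nra|].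
    apply Rlt_le_trans with (eps / (2 * M) * M); [apply Rmult_lt_compat_r; lra|]. right. field. lra. }
  assert (E1 : x ^ 2 * C1 <= x ^ 2 * (phi x + (1 + eps) / 2 * / x ^ 2)) by (apply Rmult_le_compat_l; lra).
  assert (E2 : x ^ 2 * (phi x + (1 - eps) / 2 * / x ^ 2) <= x ^ 2 * C2) by (apply Rmult_le_compat_l; lra).
  replace (x ^ 2 * (phi x + (1 + eps) / 2 * / x ^ 2)) with (x ^ 2 * phi x + (1 + eps) / 2) in E1 by (field; lra).
  replace (x ^ 2 * (phi x + (1 - eps) / 2 * / x ^ 2)) with (x ^ 2 * phi x + (1 - eps) / 2) in E2 by (field; lra).
  assert (F1 : - (x ^ 2 * M) <= x ^ 2 * C1).
  { assert (T := Rle_abs (- C1)). rewrite Rabs_Ropp in T. assert (T2 := Rabs_pos C2).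
    assert (- M <= C1) by (unfold M; lra). nra. }
  assert (F2 : x ^ 2 * C2 <= x ^ 2 * M).
  { assert (T := Rle_abs C2). assert (T2 := Rabs_pos C1).
    apply Rmult_le_compat_l; [lra|]. unfold M; lra. }
  apply Rabs_lt_between. lra.
Qed.

Lemma unbounded_below_of_translation (S : R -> Prop) tau v0 : 0 < tau -> S v0 ->
  (forall v, S v -> S (v - tau)) -> forall w, exists v, S v /\ v <= w.
Proof.
  intros Ht H0 HS w.
  destruct (INR_archimed tau (v0 - w) Ht) as [n Hn].
  exists (v0 - INR n * tau). split; [|lra].
  clear Hn. induction n as [|n IH]; [simpl; rewrite Rmult_0_l, Rminus_0_r; exact H0|].
  rewrite S_INR. replace (v0 - (INR n + 1) * tau) with (v0 - INR n * tau - tau) by ring. apply HS, IH.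
Qed.

Lemma fatou_asymptotics d ga C A A' : parabolic d ga C A A' ->
  exists (phi e : R -> R) tau, 0 < tau /\
    Cs_on 1 (itv 0 d) phi /\ (forall x, itv 0 d x -> 0 < Derive phi x) /\
    (forall x, itv 0 d x -> Derive phi x = e x / x ^ 3 /\ 0 < e x) /\ rlim e 1 /\
    rlim (fun x => x ^ 2 * phi x) (- / 2) /\
    (forall x, itv 0 d x -> itv 0 d (A x) /\ A x < x /\ phi (A x) = phi x - tau) /\
    (forall w, exists x, itv 0 d x /\ phi x <= w).
Proof.
  intros HP. destruct (fatou_coordinate d ga C A A' HP) as (phi & e & tau & C2 & Ht & HC2 & He & Hphi).
  assert (HS := fun x => parabolic_step d ga C A A' x HP).
  assert (Hd : 0 < d) by apply HP.
  assert (HA : forall x, itv 0 d x -> itv 0 d (A x) /\ A x < x).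
  { unfold itv. intros x Hx. specialize (HS x Hx). lra. }
  exists phi, e, tau. split; [exact Ht|].
  assert (HD : forall x, itv 0 d x -> Derive phi x = e x / x ^ 3).
  { intros x Hx. apply is_derive_unique, He, Hx. }
  assert (He1 : rlim e 1).
  { assert (Hexp : forall k, rlim (fun x => exp (k * x)) 1).
    { intros k. rewrite <- exp_0. replace 0 with (k * 0) by ring.
      apply (rlim_comp (fun x => k * x) exp).
      - apply rlim_mult; [apply rlim_const|apply rlim_id].
      - apply (is_derive_continuous _ _ _ (is_derive_exp (k * 0))). }
    apply (rlim_squeeze (fun x => exp (- C2 * x)) e (fun x => exp (C2 * x)) 1 d Hd); [|apply Hexp..].
    intros x Hx. replace (- C2 * x) with (- (C2 * x)) by ring. apply He, Hx. }
  split.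
  { apply (Cs_on_intro 0 (itv 0 d) phi (fun x => e x / x ^ 3)); [apply open_itv| |].
    - intros x Hx. apply He, Hx.
    - rewrite Cs_on_0. intros x Hx. apply (continuous_mult e (fun x => / x ^ 3)); [apply He, Hx|].
      unfold itv in Hx. apply continuous_Rinv_comp.
      + apply (@ex_derive_continuous R_AbsRing R_NormedModule). auto_derive. exact Logic.I.
      + apply pow_nonzero. lra. }
  split.
  { intros x Hx. rewrite HD by exact Hx. apply Rdiv_lt_0_compat; [apply He, Hx|apply pow_lt, Hx]. }
  split; [intros x Hx; split; [apply HD, Hx|apply He, Hx]|].
  split; [exact He1|]. split.
  { apply (primitive_equiv d phi e Hd); [|exact He1]. intros x Hx. apply He, Hx. }
  split; [intros x Hx; split; [apply HA, Hx|split; [apply HA, Hx|apply Hphi, Hx]]|].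
  intros w. destruct (unbounded_below_of_translation (fun v => exists x, itv 0 d x /\ phi x = v) tau (phi (d / 2)) Ht)
    with (w := w) as (v & (x & Hx & <-) & Hv).
  - exists (d / 2). split; [unfold itv; lra|reflexivity].
  - intros v (x & Hx & <-). exists (A x). split; [apply HA, Hx|apply Hphi, Hx].
  - exists x. split; assumption.
Qed.

(** From x^2 phi(x) -> -1/2, and likewise for psi, the relation psi(h x) = c phi(x) + e0 gives
    h(x)/x -> c^(-1/2).  Hence h'(x) = c (e(x) / k(h x)) (h(x)/x)^3 has a positive limit. *)
Lemma parabolic_transport dA gA CA A A' dB gB CB B B' b y :
  parabolic dA gA CA A A' -> parabolic dB gB CB B B' -> 0 < b < dA -> 0 < y < dB ->
  exists h, Cs_on 1 (itv 0 b) h /\ (forall x, itv 0 b x -> 0 < Derive h x) /\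
    (forall x, itv 0 b x -> itv 0 y (h x)) /\
    (forall t, itv 0 y t -> exists x, itv 0 b x /\ h x = t) /\ 
    (forall x, itv 0 b x -> h (A x) = B (h x)) /\ rlim h 0 /\
    exists l, 0 < l /\ rlim (Derive h) l.
Proof.
  intros HA HB Hb Hy.
  destruct (fatou_asymptotics _ _ _ _ _ HA) as (phi & e & tau & Ht & Pc & Pd & Pe & Pe1 & P2 & Pt & Pu).
  destruct (fatou_asymptotics _ _ _ _ _ HB) as (psi & k & sig & Hs & Qc & Qd & Qe & Qe1 & Q2 & Qt & Qu).
  set (c := sig / tau). assert (Hc : 0 < c) by (apply Rdiv_lt_0_compat; assumption).
  set (e0 := psi y - c * phi b).
  destruct (transport 0 0 dA 0 dB 0 b 0 y phi psi c e0) as (h & Hh1 & Hh2 & Hh3 & Hh4); try assumption.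
  - unfold itv; intros; lra.
  - unfold itv; intros; lra.
  - intros x Hx. unfold itv in Hx.
    assert (T : phi x < phi b) by (apply (Cs_increasing _ _ _ phi _ _ Pc Pd); lra).
    assert (T2 : c * phi x < c * phi b) by (apply Rmult_lt_compat_l; lra).
    destruct (Qu (c * phi x + e0)) as [t0 [Ht0 Et0]].
    assert (T3 : t0 < y) by (apply (Cs_increasing_rev _ _ _ psi _ _ Qc Qd); unfold itv, e0 in *; lra).
    unfold itv in Ht0.
    destruct (Cs_IVT _ _ _ psi t0 y (c * phi x + e0) Qc) as [t [Ht' Et]]; try (unfold e0 in *; lra).
    exists t. split; [|exact Et]. split; [lra|].
    apply (Cs_increasing_rev _ _ _ psi _ _ Qc Qd); unfold itv, e0 in *; lra.
  - intros t Ht'. unfold itv in Ht'.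
    assert (Ect : c * ((psi t - e0) / c) = psi t - e0) by (field; lra).
    assert (T : psi t < psi y) by (apply (Cs_increasing _ _ _ psi _ _ Qc Qd); lra).
    assert (T3 : (psi t - e0) / c < phi b) by (apply (Rmult_lt_reg_l c); unfold e0 in *; lra).
    destruct (Pu ((psi t - e0) / c)) as [x0 [Hx0 Ex0]].
    assert (T4 : x0 < b) by (apply (Cs_increasing_rev _ _ _ phi _ _ Pc Pd); unfold itv in *; lra).
    unfold itv in Hx0.
    destruct (Cs_IVT _ _ _ phi x0 b ((psi t - e0) / c) Pc) as [x [Hx Ex]]; try lra.
    exists x. rewrite Ex. split; [|lra]. split; [lra|].
    apply (Cs_increasing_rev _ _ _ phi _ _ Pc Pd); unfold itv; lra.
  - exists h. split; [exact Hh1|]. split; [exact Hh2|]. split; [intros x Hx; apply Hh3, Hx|].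
    split; [exact Hh4|].
    assert (Hinc : forall x z, 0 < x -> z < b -> x < z -> h x < h z).
    { intros x z Hx Hz Hxz. apply (Cs_increasing 0 0 b h x z Hh1 Hh2 Hx Hz Hxz). }
    assert (Hh0 : rlim h 0).
    { apply rlim_eps. intros eps He. 
      destruct (pos_min2 (eps / 2) (y / 2)) as (m & Hm & Hm1 & Hm2); [lra..|].
      destruct (Hh4 m) as [x0 [Hx0 Ex0]]; [unfold itv; lra|]. unfold itv in Hx0.
      exists x0. split; [lra|]. intros x Hx.
      assert (T := Hinc x x0 ltac:(lra) ltac:(lra) ltac:(lra)).
      destruct (Hh3 x ltac:(unfold itv; lra)) as [T2 _]. unfold itv in T2.
      rewrite Rminus_0_r, Rabs_pos_eq; lra. }
    split; [|split; [exact Hh0|]].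
    + intros x Hx. unfold itv in Hx. destruct (Pt x ltac:(unfold itv; lra)) as (A1 & A2 & A3).
      unfold itv in A1. assert (HAx : itv 0 b (A x)) by (unfold itv; lra).
      destruct (Hh3 x Hx) as [B1 B2]. destruct (Hh3 _ HAx) as [C1 C2]. unfold itv in B1, C1.
      destruct (Qt (h x) ltac:(unfold itv; lra)) as (D1 & D2 & D3).
      apply (Cs_increasing_inj _ _ _ psi _ _ Qc Qd); [unfold itv; lra|exact D1|].
      rewrite C2, D3, B2, A3. unfold c. field. lra.
    + assert (Hhp : forall x, 0 < x < b -> 0 < h x).
      { intros x Hx. apply Hh3. exact Hx. }
      (* (h x / x)^2 tends to 1/c *)
      assert (N1 : rlim (fun x => h x ^ 2 * psi (h x)) (- / 2)).
      { apply (rlim_subst (fun t => t ^ 2 * psi t) h (- / 2) b); try assumption; lra. }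
      assert (N2 : rlim (fun x => c * (x ^ 2 * phi x) + e0 * x ^ 2) (c * - / 2 + e0 * 0 ^ 2)).
      { apply rlim_plus.
        - apply rlim_mult; [apply rlim_const|exact P2].
        - apply rlim_mult; [apply rlim_const|apply rlim_pow, rlim_id]. }
      assert (N3 : rlim (fun x => (h x / x) ^ 2) (/ c)).
      { replace (/ c) with (- / 2 * / (c * - / 2 + e0 * 0 ^ 2)) by (field; lra).
        assert (Q := rlim_mult _ _ _ _ N1 (rlim_inv _ _ N2 ltac:(lra))).
        rewrite rlim_eps in N2. destruct (N2 (c / 4)) as [d1 [Hd1 N2']]; [lra|].
        destruct (pos_min2 b d1 (proj1 Hb) Hd1) as (e1 & He1 & T1 & T2).
        apply (rlim_ext _ _ _ e1) with (3 := Q); [exact He1|]. intros x Hx.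
        specialize (N2' x ltac:(lra)). apply Rabs_lt_between in N2'.
        destruct (Hh3 x ltac:(unfold itv; lra)) as [_ Ex]. rewrite Ex.
        assert (Hx2 : 0 < x ^ 2) by (apply pow_lt; lra).
        assert (Hz : c * (x ^ 2 * phi x) + e0 * x ^ 2 <> 0) by lra.
        assert (Hz2 : c * phi x + e0 <> 0).
        { intros E. apply Hz. replace (c * (x ^ 2 * phi x) + e0 * x ^ 2) with (x ^ 2 * (c * phi x + e0)) by ring.
          rewrite E. ring. }
        replace (c * (x ^ 2 * phi x) + e0 * x ^ 2) with (x ^ 2 * (c * phi x + e0)) by ring.
        field. split; [lra|exact Hz2]. }
      assert (N4 : rlim (fun x => h x / x) (sqrt (/ c))).
      { apply (rlim_ext (fun x => sqrt ((h x / x) ^ 2)) _ _ b); [lra| |].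
        - intros x Hx. apply sqrt_pow2. apply Rdiv_le_0_compat; [left; apply Hhp, Hx|lra].
        - apply (rlim_comp _ sqrt); [exact N3|]. apply continuity_pt_filterlim.
          apply continuity_pt_sqrt. left. apply Rinv_0_lt_compat, Hc. }
      assert (Hsq : 0 < sqrt (/ c)) by (apply sqrt_lt_R0, Rinv_0_lt_compat, Hc).
      exists (c * (1 * / 1 * sqrt (/ c) ^ 3)).
      split; [apply Rmult_lt_0_compat; [exact Hc|]; assert (0 < sqrt (/ c) ^ 3) by (apply pow_lt; exact Hsq); lra|].
      apply (rlim_ext (fun x => c * (e x * / k (h x) * (h x / x) ^ 3)) _ _ b); [lra| |].
      * intros x Hx. destruct (Hh3 x ltac:(unfold itv; lra)) as [B1 B2]. unfold itv in B1.
        destruct (Pe x ltac:(unfold itv; lra)) as [E1 E1p].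
        destruct (Qe (h x) ltac:(unfold itv; lra)) as [E2 E2p].
        assert (D1 := Cs_on_derive 0 _ h x Hh1 ltac:(unfold itv; lra)).
        assert (D2 := Cs_on_derive 0 _ psi (h x) Qc ltac:(unfold itv; lra)).
        assert (D3 := Cs_on_derive 0 _ phi x Pc ltac:(unfold itv; lra)).
        assert (D4 := is_derive_comp psi h x _ _ D2 D1).
        assert (D5 : is_derive (fun x => psi (h x)) x (c * Derive phi x + 0)).
        { apply (is_derive_ext_on (itv 0 b) (fun x => c * phi x + e0)); [apply open_itv|exact Hx| |].
          - intros z Hz. symmetry. apply Hh3, Hz.
          - apply (is_derive_plus (fun x => c * phi x) (fun _ => e0)).
            + apply (is_derive_scal phi), D3.
            + apply (is_derive_const e0 x). }
        assert (E : Derive h x * Derive psi (h x) = c * Derive phi x + 0).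
        { apply is_derive_unique in D4. apply is_derive_unique in D5. rewrite <- D5. symmetry. exact D4. }
        rewrite E1, E2 in E.
        assert (Hq : k (h x) / h x ^ 3 <> 0).
        { apply Rgt_not_eq, Rdiv_lt_0_compat; [exact E2p|apply pow_lt; lra]. }
        apply (Rmult_eq_reg_r (k (h x) / h x ^ 3)); [|exact Hq]. rewrite E. field.
        repeat split; lra.
      * apply rlim_mult; [apply rlim_const|]. apply rlim_mult; [|apply rlim_pow, N4].
        apply rlim_mult; [exact Pe1|]. apply rlim_inv; [|lra].
        apply (rlim_subst k h 1 b); try assumption; lra.
Qed.

(** * The conjugacy at the bifurcation value *)

(** Repeated use turns a bound on the highest derivative into Taylor bounds at all orders. *)
Lemma taylor_step h (h' : R -> R) d C k : h 0 = 0 ->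
  (forall x, Rabs x < d -> is_derive h x (h' x)) ->
  (forall x, Rabs x < d -> Rabs (h' x) <= C * Rabs x ^ k) ->
  forall x, Rabs x < d -> Rabs (h x) <= C * Rabs x ^ S k.
Proof.
  intros H0 Hd HB x Hx.
  assert (HC : forall c, Rabs c <= Rabs x -> Rabs (h' c) <= C * Rabs x ^ k).
  { intros c Hc. apply Rle_trans with (1 := HB c ltac:(lra)).
    assert (0 <= C * Rabs x ^ k) by (apply Rle_trans with (2 := HB x Hx); apply Rabs_pos).
    destruct (Rle_lt_dec 0 C) as [T|T].
    - apply Rmult_le_compat_l; [exact T|]. apply pow_incr. split; [apply Rabs_pos|exact Hc].
    - assert (P := pow_le (Rabs c) k (Rabs_pos c)). nra. }
  assert (HD : forall c, Rabs c <= Rabs x -> is_derive h c (h' c)) by (intros; apply Hd; lra).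
  assert (M : exists c, Rabs c <= Rabs x /\ h x = h' c * x).
  { destruct (Rtotal_order x 0) as [T|[T|T]].
    - destruct (MVT_itv h h' x 0 T) as [c [Hc E]].
      + intros z Hz. apply HD. rewrite !Rabs_left1; lra.
      + exists c. split; [rewrite !Rabs_left1; lra|]. rewrite H0 in E. lra.
    - exists 0. subst x. split; [lra|]. rewrite H0. ring.
    - destruct (MVT_itv h h' 0 x T) as [c [Hc E]].
      + intros z Hz. apply HD. rewrite !Rabs_pos_eq; lra.
      + exists c. split; [rewrite !Rabs_pos_eq; lra|]. rewrite H0 in E. lra. }
  destruct M as [c [Hc E]]. rewrite E, Rabs_mult. simpl. rewrite (Rmult_comm (Rabs x)), <- Rmult_assoc.
  apply Rmult_le_compat_r; [apply Rabs_pos|apply HC, Hc].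
Qed.

Lemma Cs_on_derive_n s U h k x : Cs_on s U h -> (k < s)%nat -> U x ->
  is_derive (Derive_n h k) x (Derive_n h (S k) x).
Proof.
  intros H Hk Hx. apply Derive_correct. apply (proj1 (H x Hx) (S k)). lia.
Qed.

(** If F'(0) = -1, then at 0 the second derivative of F o F vanishes and the third one is
    - (3 F''(0)^2 + 2 F'''(0)) < 0. *)
Lemma flip_parabolic r d F : flip (S (S (S (S r)))) d F -> Derive F 0 = -1 ->
  3 * Derive_n F 2 0 ^ 2 + 2 * Derive_n F 3 0 > 0 ->
  exists d0 ga C, 0 < d0 < d /\
    parabolic d0 ga C (fun x => F (F x)) (fun x => Derive F x * Derive F (F x)).
Proof.
  intros H Hl Hc. assert (HA := flip_sq_Cs _ d F H).
  assert (Hsd := fun x => flip_sq_der _ d F x H). assert (Hmu := fun x => flip_multiplier _ d F x H).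
  assert (HFi := fun x => flip_in_d _ d F x H).
  destruct H as (Hd & F0 & HCF & HB).
  set (A := fun x => F (F x)) in *.
  assert (HA4 : Cs_on 4 (itv (- d) d) A) by (apply (Cs_on_le 4 (S (S (S (S r))))); [lia|exact HA]).
  assert (DA : forall k x, (k < 4)%nat -> Rabs x < d -> is_derive (Derive_n A k) x (Derive_n A (S k) x)).
  { intros k x Hk Hx. apply (Cs_on_derive_n 4 (itv (- d) d)); [exact HA4|exact Hk|].
    apply Rabs_lt_between in Hx. exact Hx. }
  assert (DF : forall x, - (2 * d) < x < 2 * d ->
     is_derive F x (Derive_n F 1 x) /\ is_derive (Derive_n F 1) x (Derive_n F 2 x) /\
     is_derive (Derive_n F 2) x (Derive_n F 3 x)).
  { intros x Hx. assert (T := fun k Hk => Cs_on_derive_n _ _ F k x HCF Hk Hx).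
    split; [|split]; [apply (T 0%nat)|apply (T 1%nat)|apply (T 2%nat)]; lia. }
  assert (SD := fun x (Hx : - d < x < d) =>
    square_derivatives F (Derive_n F 1) (Derive_n F 2) (Derive_n F 3) x
      (DF x ltac:(lra)) (DF (F x) (HFi x Hx))).
  assert (E1 : forall x, - d < x < d -> Derive_n A 1 x = Derive_n F 1 x * Derive_n F 1 (F x)).
  { intros x Hx. apply is_derive_unique, SD, Hx. }
  assert (E2 : forall x, - d < x < d -> Derive_n A 2 x =
    Derive_n F 2 (F x) * Derive_n F 1 x ^ 2 + Derive_n F 1 (F x) * Derive_n F 2 x).
  { intros x Hx. change (Derive_n A 2 x) with (Derive (Derive_n A 1) x).
    rewrite (Derive_ext_on _ _ _ x (open_itv (- d) d) Hx E1). apply is_derive_unique, SD, Hx. }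
  assert (E3 : Derive_n A 3 0 = - (3 * Derive_n F 2 0 ^ 2 + 2 * Derive_n F 3 0)).
  { change (Derive_n A 3 0) with (Derive (Derive_n A 2) 0).
    assert (H0 : - d < 0 < d) by lra.
    rewrite (Derive_ext_on _ _ _ 0 (open_itv (- d) d) H0 E2).
    rewrite (is_derive_unique _ _ _ (proj2 (proj2 (SD 0 H0)))), F0.
    change (Derive_n F 1 0) with (Derive F 0). rewrite Hl. ring. }
  assert (E10 : Derive_n A 1 0 = 1).
  { rewrite E1 by lra. rewrite F0. change (Derive_n F 1 0) with (Derive F 0). rewrite Hl. ring. }
  assert (E20 : Derive_n A 2 0 = 0).
  { rewrite E2 by lra. rewrite F0. change (Derive_n F 1 0) with (Derive F 0). rewrite Hl. ring. }
  set (ga := (3 * Derive_n F 2 0 ^ 2 + 2 * Derive_n F 3 0) / 6).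
  assert (Hga : 0 < ga) by (unfold ga; lra).
  destruct (bounded_oball (Derive_n A 4) 0 d (d / 2)) as [C [HC0 HC]]; [|lra|].
  { intros x Hx. unfold oball in Hx. rewrite Rminus_0_r in Hx. apply Rabs_lt_between in Hx.
    apply (HA4 x Hx). }
  assert (HC' : forall x, Rabs x < d / 2 -> Rabs (Derive_n A 4 x) <= C * Rabs x ^ 0).
  { intros x Hx. simpl. rewrite Rmult_1_r. apply HC. rewrite Rminus_0_r. lra. }
  assert (T3 : forall x, Rabs x < d / 2 -> Rabs (Derive_n A 3 x + 6 * ga) <= C * Rabs x ^ 1).
  { apply (taylor_step (fun x => Derive_n A 3 x + 6 * ga) (Derive_n A 4)); [rewrite E3; unfold ga; field| |exact HC'].
    intros x Hx. replace (Derive_n A 4 x) with (Derive_n A 4 x + 0) by ring.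
    apply (is_derive_plus (Derive_n A 3) (fun _ => 6 * ga)); [apply DA; [lia|lra]|apply (is_derive_const (6 * ga) x)]. }
  assert (T2 : forall x, Rabs x < d / 2 -> Rabs (Derive_n A 2 x + 6 * ga * x) <= C * Rabs x ^ 2).
  { apply (taylor_step (fun x => Derive_n A 2 x + 6 * ga * x) (fun x => Derive_n A 3 x + 6 * ga)); [rewrite E20; ring| |exact T3].
    intros x Hx. apply (is_derive_plus (Derive_n A 2) (fun x => 6 * ga * x)); [apply DA; [lia|lra]|].
    auto_derive; [exact Logic.I|ring]. }
  assert (T1 : forall x, Rabs x < d / 2 -> Rabs (Derive_n A 1 x - 1 + 3 * ga * x ^ 2) <= C * Rabs x ^ 3).
  { apply (taylor_step (fun x => Derive_n A 1 x - 1 + 3 * ga * x ^ 2) (fun x => Derive_n A 2 x + 6 * ga * x)); [rewrite E10; ring| |exact T2].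
    intros x Hx. replace (Derive_n A 2 x + 6 * ga * x) with (Derive_n A 2 x - 0 + 6 * ga * x) by ring.
    apply (is_derive_plus (fun x => Derive_n A 1 x - 1) (fun x => 3 * ga * x ^ 2)).
    - apply (is_derive_minus (Derive_n A 1) (fun _ => 1)); [apply DA; [lia|lra]|apply (is_derive_const 1 x)].
    - auto_derive; [exact Logic.I|ring]. }
  assert (T0 : forall x, Rabs x < d / 2 -> Rabs (A x - x + ga * x ^ 3) <= C * Rabs x ^ 4).
  { apply (taylor_step (fun x => A x - x + ga * x ^ 3) (fun x => Derive_n A 1 x - 1 + 3 * ga * x ^ 2)); [unfold A; rewrite !F0; ring| |exact T1].
    intros x Hx. apply (is_derive_plus (fun x => A x - x) (fun x => ga * x ^ 3)).
    - apply (is_derive_minus A (fun x => x)); [apply (DA 0%nat); [lia|lra]|apply (is_derive_id x)].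
    - auto_derive; [exact Logic.I|ring]. }
  destruct (pos_min4 (d / 2) (ga / (2 * C)) (/ (8 * (ga + C))) 1) as (d0 & Hd0 & A1 & A2 & A3 & A4);
    [lra|apply Rdiv_lt_0_compat; lra|apply Rinv_0_lt_compat; lra|lra|].
  exists d0, ga, C. split; [lra|].
  split; [exact Hd0|]. split; [exact Hga|]. split; [exact HC0|]. split; [|split; [|split; [|split; [|split]]]].
  - intros x Hx. split; [apply Hsd; lra|]. split; [|apply Hmu; lra].
    assert (Hx' : itv (- d) d x) by (unfold itv; lra).
    apply (continuous_ext_on (itv (- d) d) (Derive_n A 1)); [apply open_itv|exact Hx'|exact E1|].
    apply (is_derive_continuous _ _ (Derive_n A 2 x)), DA; [lia|]. rewrite Rabs_pos_eq; lra.
  - intros x Hx. assert (T := T0 x). rewrite Rabs_pos_eq in T by lra. apply T. lra.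
  - intros x Hx. assert (T := T1 x). rewrite Rabs_pos_eq in T by lra.
    rewrite E1 in T by lra. apply T. lra.
  - apply Rle_trans with (C * (ga / (2 * C))); [apply Rmult_le_compat_l; lra|]. right. field. lra.
  - apply Rle_trans with ((ga + C) * (/ (8 * (ga + C)) * 1)).
    + apply Rmult_le_compat_l; [lra|]. simpl. rewrite Rmult_1_r. apply Rmult_le_compat; lra.
    + right. field. lra.
  - lra.
Qed.

Lemma C1_of_punctured n b h l : n < 0 < b -> Cs_on 1 (punctured n b) h -> continuous h 0 ->
  (forall eps, 0 < eps -> exists d, 0 < d /\ forall x, Rabs x < d -> x <> 0 -> Rabs (Derive h x - l) < eps) ->
  is_derive h 0 l /\ Cs_on 1 (itv n b) h.
Proof.
  intros Hnb HC Hc HL.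
  assert (HD : forall x, punctured n b x -> is_derive h x (Derive h x)) by (intros; eapply Cs_on_derive; eassumption).
  assert (D0 : is_derive h 0 l).
  { apply is_derive_Reals. intros eps He.
    destruct (HL eps He) as [d1 [Hd1 H1]].
    destruct (pos_min3 d1 (- n) b) as (m & Hm & M1 & M2 & M3); [lra..|].
    exists (mkposreal _ Hm). intros t Ht0 Ht. simpl in Ht. rewrite Rplus_0_l.
    apply Rabs_lt_between in Ht.
    assert (Hco : forall z, itv n b z -> continuity_pt h z).
    { intros z Hz. apply continuity_pt_filterlim. destruct (Req_dec z 0) as [->|Hz0]; [exact Hc|].
      apply (Cs_on_continuous 1 (punctured n b)); [exact HC|split; assumption]. }
    destruct (MVT_gen h 0 t (fun z => if Req_dec_T z 0 then l else Derive h z)) as [c [Hct E]].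
    - intros z Hz. destruct (Req_dec_T z 0) as [Z|Z].
      + exfalso. unfold Rmin, Rmax in Hz. destruct (Rle_dec 0 t); lra.
      + apply HD. split; [|exact Z]. unfold itv. unfold Rmin, Rmax in Hz. destruct (Rle_dec 0 t); lra.
    - intros z Hz. apply Hco. unfold itv. unfold Rmin, Rmax in Hz. destruct (Rle_dec 0 t); lra.
    - rewrite E. rewrite Rminus_0_r.
      replace ((if Req_dec_T c 0 then l else Derive h c) * t / t - l) with ((if Req_dec_T c 0 then l else Derive h c) - l) by (field; exact Ht0).
      destruct (Req_dec_T c 0) as [Z|Z]; [rewrite Rminus_diag, Rabs_R0; exact He|].
      apply H1; [|exact Z]. apply Rabs_lt_between. unfold Rmin, Rmax in Hct. destruct (Rle_dec 0 t); lra. }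
  split; [exact D0|].
  rewrite Cs_on_step, Cs_on_0. split.
  - intros x Hx. destruct (Req_dec x 0) as [->|Hx0]; [exists l; exact D0|].
    exists (Derive h x). apply HD. split; assumption.
  - intros x Hx. destruct (Req_dec x 0) as [->|Hx0].
    + intros P [eps HP]. rewrite (is_derive_unique _ _ _ D0) in HP.
      destruct (HL eps (cond_pos eps)) as [d1 [Hd1 H1]].
      exists (mkposreal _ Hd1). intros z Hz.
      assert (Hz' : Rabs (z - 0) < d1) by exact Hz. rewrite Rminus_0_r in Hz'.
      apply HP. change (Rabs (Derive h z - l) < eps).
      destruct (Req_dec z 0) as [->|Hz0]; [|apply H1; assumption].
      rewrite (is_derive_unique _ _ _ D0), Rminus_diag, Rabs_R0. apply cond_pos.
    + rewrite Cs_on_step, Cs_on_0 in HC. apply HC. split; assumption.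
Qed.

(** At 0 the left derivative of the extension is G^-1'(0) l F'(0) = (-1) l (-1), equal to the
    right derivative l. *)
Lemma parabolic_conjugacy r dF F n b dG G y d1 g1 C1 d2 g2 C2 :
  flip (S r) dF F -> flip (S r) dG G -> trap dF F n b -> 0 < y < dG / 4 ->
  Derive F 0 = -1 -> Derive G 0 = -1 ->
  parabolic d1 g1 C1 (fun x => F (F x)) (fun x => Derive F x * Derive F (F x)) ->
  parabolic d2 g2 C2 (fun x => G (G x)) (fun x => Derive G x * Derive G (G x)) ->
  b < d1 -> y < d2 ->
  exists v, - (2 * y) < v < - (y / 16) /\ Cs_conjugate 1 (itv n b) (itv v y) F G.
Proof.
  intros HF HG HT Hy LF LG PF PG Hb1 Hy2.
  assert (HF1 : flip 1 dF F).
  { destruct HF as (a1 & a2 & a3 & a4). split; [exact a1|split; [exact a2|split; [|exact a4]]].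
    apply (Cs_on_le 1 (S r)); [lia|exact a3]. }
  assert (HG1 : flip 1 dG G).
  { destruct HG as (a1 & a2 & a3 & a4). split; [exact a1|split; [exact a2|split; [|exact a4]]].
    apply (Cs_on_le 1 (S r)); [lia|exact a3]. }
  assert (HT' := HT). destruct HT' as (Hn & Hb & HFb & HFn).
  destruct (parabolic_transport _ _ _ _ _ _ _ _ _ _ b y PF PG) as (h & Hh1 & Hh2 & Hh3 & Hh4 & Hh5 & Hh6 & l & Hl & Hh7); [lra|lra|].
  destruct (side_extension 0 dF F n b dG G y h HF1 HT HG1 Hy Hh1 Hh2 Hh3 Hh4 Hh5)
    as (v & H & Hv & Hp & H0 & Hd & HC & HD & Hi & Hs & Hinj & Hconj & _).
  exists v. split; [exact Hv|].
  assert (F0 : F 0 = 0) by apply HF. assert (G0 : G 0 = 0) by apply HG.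
  assert (HcF : continuous F 0) by (apply (flip_cont _ dF _ 0 HF); lra).
  assert (HcF' : continuous (Derive F) 0).
  { destruct HF1 as (_ & _ & a3 & _). rewrite Cs_on_step, Cs_on_0 in a3. apply a3. unfold itv; lra. }
  assert (HcG' : continuous (Derive G) 0).
  { destruct HG1 as (_ & _ & a3 & _). rewrite Cs_on_step, Cs_on_0 in a3. apply a3. unfold itv; lra. }
  (* limits from the left, written on the reflected variable *)
  assert (NF : rlim (fun t => F (- t)) 0).
  { assert (T : rlim (fun t => F (- t)) (F (- 0))).
    { apply (rlim_comp (fun t => - t) F (- 0)); [apply rlim_opp, rlim_id|]. rewrite Ropp_0. exact HcF. }
    rewrite Ropp_0, F0 in T. exact T. }
  assert (Npos : forall t, 0 < t < - n -> 0 < F (- t) < b).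
  { intros t Ht. assert (T := flip_neg _ dF F (- t) HF ltac:(lra)).
    assert (T2 := flip_decr _ dF F n (- t) HF ltac:(lra) ltac:(lra) ltac:(lra)). lra. }
  assert (NH : rlim (fun t => H (- t)) 0).
  { apply (rlim_squeeze (fun t => - (2 * h (F (- t)))) _ (fun _ => 0) 0 (- n)); [lra| | |apply rlim_const].
    - intros t Ht. assert (T := Npos t Ht). assert (T2 := Hconj (- t) ltac:(unfold itv; lra)).
      rewrite Hp in T2 by lra.
      destruct (Hi (- t)) as [T3 T4]; [split; [unfold itv; lra|lra]|]. unfold itv in T3.
      assert (T5 := Hh3 (F (- t)) ltac:(unfold itv; lra)). unfold itv in T5.
      destruct (Rtotal_order (H (- t)) 0) as [Z|[Z|Z]].
      + assert (Q := flip_neg _ dG G (H (- t)) HG ltac:(lra)). lra.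
      + lra.
      + assert (Q := flip_pos _ dG G (H (- t)) HG ltac:(lra)). lra.
    - replace 0 with (- (2 * 0)) by ring. apply rlim_opp, rlim_mult; [apply rlim_const|].
      apply (rlim_subst h (fun t => F (- t)) 0 (- n)); try assumption; [lra|]. intros t Ht. apply Npos, Ht. }
  assert (ND : rlim (fun t => Derive H (- t)) l).
  { apply (rlim_ext (fun t => Derive F (- t) * Derive h (F (- t)) * / Derive G (H (- t))) _ _ (- n)); [lra| |].
    - intros t Ht. symmetry. apply is_derive_unique, Hd. lra.
    - replace l with (-1 * l * / -1) by field.
      apply rlim_mult; [apply rlim_mult|].
      + assert (T : rlim (fun t => Derive F (- t)) (Derive F (- 0))).
        { apply (rlim_comp (fun t => - t) (Derive F) (- 0)); [apply rlim_opp, rlim_id|].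
          rewrite Ropp_0. exact HcF'. }
        rewrite Ropp_0, LF in T. exact T.
      + apply (rlim_subst (Derive h) (fun t => F (- t)) l (- n)); try assumption; [lra|]. intros t Ht. apply Npos, Ht.
      + apply rlim_inv; [|lra]. rewrite <- LG. apply (rlim_comp (fun t => H (- t)) (Derive G)); [exact NH|exact HcG']. }
  assert (PD : rlim (Derive H) l).
  { apply (rlim_ext (Derive h) _ _ b); [lra| |exact Hh7].
    intros x Hx. apply (Derive_ext_on (itv 0 b)); [apply open_itv|exact Hx|].
    intros z Hz. symmetry. apply Hp, Hz. }
  assert (PH : rlim H 0).
  { apply (rlim_ext h _ _ b); [lra| |exact Hh6]. intros x Hx. symmetry. apply Hp. lra. }
  assert (two_sided : forall (f : R -> R) m, rlim f m -> rlim (fun t => f (- t)) m -> forall eps, 0 < eps ->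
     exists d, 0 < d /\ forall x, Rabs x < d -> x <> 0 -> Rabs (f x - m) < eps).
  { intros f m R1 R2 eps He. rewrite rlim_eps in R1, R2.
    destruct (R1 eps He) as [e1 [He1 Q1]]. destruct (R2 eps He) as [e2 [He2 Q2]].
    destruct (pos_min2 e1 e2 He1 He2) as (e & He0 & M1 & M2).
    exists e. split; [exact He0|]. intros x Hx Hx0. apply Rabs_lt_between in Hx.
    destruct (Rlt_dec 0 x) as [T|T]; [apply Q1; lra|].
    replace x with (- - x) by ring. apply Q2. lra. }
  destruct (C1_of_punctured n b H l) as [D0 HC1].
  - lra.
  - exact HC.
  - intros P [eps HP]. destruct (two_sided H 0 PH NH eps (cond_pos eps)) as [d [Hd0 Hd1]].
    exists (mkposreal _ Hd0). intros z Hz.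
    assert (Hz' : Rabs (z - 0) < d) by exact Hz. rewrite Rminus_0_r in Hz'.
    apply HP. rewrite H0. change (Rabs (H z - 0) < eps).
    destruct (Req_dec z 0) as [->|Hz0]; [|apply Hd1; assumption].
    rewrite H0, Rminus_diag, Rabs_R0. apply cond_pos.
  - apply (two_sided (Derive H) l); assumption.
  - exists H. split.
    + apply Cs_diffeo_onto_image; try assumption.
      * apply open_itv.
      * intros x Hx. destruct (Req_dec x 0) as [->|Hx0].
        -- rewrite H0. unfold itv. lra.
        -- apply Hi. split; assumption.
      * intros t Ht. destruct (Req_dec t 0) as [->|Ht0].
        -- exists 0. split; [unfold itv; lra|exact H0].
        -- destruct (Hs t) as [x [Hx Ex]]; [split; assumption|]. exists x. split; [apply Hx|exact Ex].
      * intros x Hx. destruct (Req_dec x 0) as [->|Hx0].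
        -- rewrite (is_derive_unique _ _ _ D0). exact Hl.
        -- apply HD. split; assumption.
    + intros x Hx _. apply Hconj, Hx.
Qed.

(** * Families of decreasing maps *)

(** Joint continuity, stated on pairs to make the general lemmas on continuity applicable. *)
Definition cont2 (f : R -> R -> R) (x mu : R) : Prop :=
  continuous (fun z : R * R => f (fst z) (snd z)) (x, mu).

Lemma cont2_iff f x mu : cont2 f x mu <-> continuity_2d_pt f x mu.
Proof. symmetry. apply continuity_2d_pt_filterlim. Qed.

Lemma cont2_box f x mu eps : cont2 f x mu -> 0 < eps ->
  exists d, 0 < d /\ forall u v, Rabs (u - x) < d -> Rabs (v - mu) < d ->
    Rabs (f u v - f x mu) < eps.
Proof.
  intros H He. apply cont2_iff in H. destruct (H (mkposreal _ He)) as [d Hd].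
  exists d. split; [apply cond_pos|exact Hd].
Qed.

Lemma cont2_plus f g x mu : cont2 f x mu -> cont2 g x mu -> cont2 (fun x mu => f x mu + g x mu) x mu.
Proof.
  intros Hf Hg. apply (continuous_plus (fun z : R * R => f (fst z) (snd z)) (fun z => g (fst z) (snd z)));
  assumption.
Qed.

Lemma cont2_mult f g x mu : cont2 f x mu -> cont2 g x mu -> cont2 (fun x mu => f x mu * g x mu) x mu.
Proof.
  intros Hf Hg. apply (continuous_mult (fun z : R * R => f (fst z) (snd z)) (fun z => g (fst z) (snd z)));
  assumption.
Qed.

Lemma cont2_const c x mu : cont2 (fun _ _ => c) x mu.
Proof. apply continuous_const. Qed.

Lemma cont2_fst x mu : cont2 (fun x _ => x) x mu.
Proof. apply continuous_fst. Qed.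

Lemma cont2_snd (k : R -> R) x mu : continuous k mu -> cont2 (fun _ mu => k mu) x mu.
Proof.
  intros H. apply (continuous_comp (fun z : R * R => snd z) k); [apply continuous_snd|exact H].
Qed.

Lemma cont2_pow f n x mu : cont2 f x mu -> cont2 (fun x mu => f x mu ^ n) x mu.
Proof.
  intros H. induction n as [|n IH]; [apply cont2_const|].
  apply (cont2_mult f (fun x mu => f x mu ^ n)); assumption.
Qed.

Lemma cont2_comp (g f : R -> R -> R) x mu : cont2 f x mu -> cont2 g (f x mu) mu ->
  cont2 (fun x mu => g (f x mu) mu) x mu.
Proof.
  intros Hf Hg. apply (continuous_comp_2 (fun z : R * R => f (fst z) (snd z)) (fun z => snd z) g).
  - exact Hf.
  - apply continuous_snd.
  - exact Hg.
Qed.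

Lemma cont2_section f x mu : cont2 f x mu -> continuous (fun m => f x m) mu.
Proof.
  intros H. apply (continuous_comp_2 (fun _ : R => x) (fun m => m) f).
  - apply continuous_const.
  - apply continuous_id.
  - exact H.
Qed.

Definition dxk (f : R -> R -> R) (k : nat) (x mu : R) : R := Derive_n (fun z => f z mu) k x.

Definition flip_family (r : nat) (dl : R) (f : R -> R -> R) : Prop :=
  0 < dl /\ (forall mu, Rabs mu < dl -> f 0 mu = 0) /\
  (forall mu, Rabs mu < dl -> Cs_on r (itv (- dl) dl) (fun z => f z mu)) /\
  (forall k, (k <= 3)%nat -> cont2 (dxk f k) 0 0) /\
  dxk f 1 0 0 = -1 /\ 3 * dxk f 2 0 0 ^ 2 + 2 * dxk f 3 0 0 > 0.

(** The hypotheses of [square_dynamics] are open conditions at (0, 0), so that one interval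
    serves for all small parameters. *)
Lemma flip_family_uniform r dl f : flip_family (S (S (S r))) dl f ->
  exists d mu1, 0 < d /\ 2 * d < dl /\ 0 < mu1 <= dl /\ forall mu, Rabs mu < mu1 ->
    flip (S (S (S r))) d (fun z => f z mu) /\
    (-1 <= Derive (fun z => f z mu) 0 -> sink d (fun z => f z mu)) /\
    (Derive (fun z => f z mu) 0 < -1 -> (exists x, 0 < x < d /\ f (f x mu) mu < x) ->
     exists q, cycle d (fun z => f z mu) q).
Proof.
  intros (Hdl & Hf0 & HC & Hcont & H1 & Hc).
  set (c := 3 * dxk f 2 0 0 ^ 2 + 2 * dxk f 3 0 0) in *.
  assert (C0 : cont2 f 0 0) by (apply (Hcont 0%nat); lia).
  assert (f00 : f 0 0 = 0) by (apply Hf0; rewrite Rabs_R0; lra).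
  assert (C1 := Hcont 1%nat ltac:(lia)). assert (C2 := Hcont 2%nat ltac:(lia)). assert (C3 := Hcont 3%nat ltac:(lia)).
  set (A3 := fun x mu => dxk f 3 (f x mu) mu * dxk f 1 x mu ^ 3
      + 3 * dxk f 2 (f x mu) mu * dxk f 1 x mu * dxk f 2 x mu + dxk f 1 (f x mu) mu * dxk f 3 x mu).
  assert (CA : cont2 A3 0 0).
  { unfold A3. repeat apply cont2_plus; repeat apply cont2_mult; try assumption;
      try apply cont2_const; try (apply cont2_pow; assumption);
      apply (cont2_comp _ f); try assumption; rewrite f00; assumption. }
  assert (A30 : A3 0 0 = - c) by (unfold A3, c; rewrite f00, H1; ring).
  destruct (cont2_box _ _ _ (/ 2) C1 ltac:(lra)) as [e1 [He1 B1]].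
  destruct (cont2_box _ _ _ 1 C2 ltac:(lra)) as [e2 [He2 B2]].
  destruct (cont2_box _ _ _ (c / 2) CA ltac:(lra)) as [e3 [He3 B3]].
  rewrite H1 in B1. rewrite A30 in B3.
  set (B := Rabs (dxk f 2 0 0) + 1). assert (HB : 0 < B) by (unfold B; assert (T := Rabs_pos (dxk f 2 0 0)); lra).
  set (K := 3 * c / 2). set (m := c / 2).
  assert (HK : 0 < K) by (unfold K; lra). assert (Hm : 0 < m) by (unfold m; lra).
  assert (HBK : 0 < 8 * B * K) by (apply Rmult_lt_0_compat; lra).
  destruct (pos_min4 dl e1 e2 e3 Hdl He1 He2 He3) as (e & He & Q1 & Q2 & Q3 & Q4).
  destruct (pos_min3 (e / 4) (/ (2 * B)) (m / (8 * B * K))) as (d & Hd & P1 & P2 & P3);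
    [lra|apply Rinv_0_lt_compat; lra|apply Rdiv_lt_0_compat; lra|].
  exists d, e. split; [exact Hd|]. split; [lra|]. split; [lra|].
  intros mu Hmu. set (F := fun z => f z mu).
  assert (HF : flip (S (S (S r))) d F).
  { split; [exact Hd|]. split; [apply Hf0; lra|]. split.
    - apply (Cs_on_subset _ (itv (- dl) dl)); [|apply HC; lra]. unfold itv. intros x Hx. lra.
    - intros x Hx. unfold itv in Hx. assert (T := B1 x mu). rewrite !Rminus_0_r in T.
      assert (T' : Rabs (dxk f 1 x mu - -1) < / 2) by (apply T; [apply Rabs_lt_between|]; lra).
      change (dxk f 1 x mu) with (Derive F x) in T'. apply Rabs_lt_between in T'. lra. }
  split; [exact HF|].
  destruct (square_dynamics F (Derive_n F 1) (Derive_n F 2) (Derive_n F 3) d B K m) as [S1 S2].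
  - exact Hd.
  - lra.
  - exact HK.
  - exact Hm.
  - apply HF.
  - intros x Hx. apply Rabs_lt_between in Hx.
    assert (T := fun k Hk => Cs_on_derive_n _ _ F k x (proj1 (proj2 (proj2 HF))) Hk Hx).
    split; [|split]; [apply (T 0%nat)|apply (T 1%nat)|apply (T 2%nat)]; lia.
  - intros x Hx. apply Rabs_lt_between in Hx. apply (proj2 (proj2 (proj2 HF))). exact Hx.
  - intros x Hx. apply Rabs_lt_between in Hx. apply Rabs_lt_between.
    apply (flip_in_d _ d F x HF Hx).
  - assert (T := B2 0 mu). rewrite Rminus_diag, Rabs_R0, Rminus_0_r in T.
    specialize (T ltac:(lra) ltac:(lra)). change (dxk f 2 0 mu) with (Derive_n F 2 0) in T.
    replace (Derive_n F 2 0) with ((Derive_n F 2 0 - dxk f 2 0 0) + dxk f 2 0 0) by ring.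
    eapply Rle_trans; [apply Rabs_triang|]. unfold B. lra.
  - apply Rle_trans with (B * (/ (2 * B))); [apply Rmult_le_compat_l; lra|]. right. field. lra.
  - apply Rle_trans with (8 * B * K * (m / (8 * B * K))); [apply Rmult_le_compat_l; lra|]. right. field. lra.
  - intros x Hx. assert (T := B3 x mu). rewrite !Rminus_0_r in T.
    assert (T' : Rabs (A3 x mu - - c) < c / 2) by (apply T; [rewrite Rabs_pos_eq|]; lra).
    change (- K <= A3 x mu <= - m). apply Rabs_lt_between in T'. unfold K, m. lra.
  - assert (Hlam : -2 <= Derive F 0 <= - / 2) by (apply (proj2 (proj2 (proj2 HF))); unfold itv; lra).
    split.
    + intros Hl x Hx. apply S1; [change (Derive F 0 ^ 2 <= 1); nra|exact Hx].
    + intros Hl Hx. apply S2; [change (1 < Derive F 0 ^ 2); nra|exact Hx].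
Qed.

Lemma ex_diff_n_section (f : R -> R -> R) r dl :
  (forall x mu, Rabs x < dl -> Rabs mu < dl -> ex_diff_n f r x mu) ->
  forall k, (k <= r)%nat -> forall x mu, Rabs x < dl -> Rabs mu < dl ->
    ex_diff_n (dxk f k) (r - k) x mu.
Proof.
  intros H k. induction k as [|k IH]; intros Hk x mu Hx Hmu.
  - rewrite Nat.sub_0_r. apply H; assumption.
  - assert (T := IH ltac:(lia) x mu Hx Hmu).
    replace (r - k)%nat with (S (r - S k)) in T by lia.
    destruct T as (_ & _ & _ & T & _). exact T.
Qed.

Lemma ex_diff_n_cont2 g m x mu : ex_diff_n g m x mu -> cont2 g x mu.
Proof. intros H. apply cont2_iff. destruct m; apply H. Qed.

Lemma ex_diff_n_Cs (f : R -> R -> R) r dl :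
  (forall x mu, Rabs x < dl -> Rabs mu < dl -> ex_diff_n f r x mu) ->
  forall mu, Rabs mu < dl -> Cs_on r (itv (- dl) dl) (fun z => f z mu).
Proof.
  intros H mu Hmu x Hx. unfold itv in Hx. apply Rabs_lt_between in Hx. split.
  - intros [|k] Hk; [exact Logic.I|].
    assert (T := ex_diff_n_section f r dl H k ltac:(lia) x mu Hx Hmu).
    replace (r - k)%nat with (S (r - S k)) in T by lia.
    destruct T as (_ & T & _). exact T.
  - assert (T := ex_diff_n_section f r dl H r (Nat.le_refl r) x mu Hx Hmu).
    apply ex_diff_n_cont2 in T.
    apply (continuous_comp_2 (fun z : R => z) (fun _ => mu) (dxk f r)).
    + apply continuous_id.
    + apply continuous_const.
    + exact T.
Qed.

Lemma multiplier_C1 (f : R -> R -> R) r dl :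
  (forall x mu, Rabs x < dl -> Rabs mu < dl -> ex_diff_n f (S (S r)) x mu) ->
  forall mu, Rabs mu < dl ->
    is_derive (fun m => Derive (fun z => f z m) 0) mu (Derive (fun m => Derive (fun z => f z m) 0) mu) /\
    continuous (fun mu => Derive (fun m => Derive (fun z => f z m) 0) mu) mu.
Proof.
  intros H mu Hmu.
  assert (H0 : Rabs 0 < dl) by (rewrite Rabs_R0; apply Rle_lt_trans with (2 := Hmu), Rabs_pos).
  assert (T := ex_diff_n_section f (S (S r)) dl H 1 ltac:(lia) 0 mu H0 Hmu).
  replace (S (S r) - 1)%nat with (S r) in T by lia. destruct T as (_ & _ & T1 & _ & T2).
  split; [apply Derive_correct, T1|].
  apply ex_diff_n_cont2 in T2.
  apply (cont2_section (fun x mu => Derive (fun m => Derive (fun z => f z m) x) mu) 0 mu T2).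
Qed.

Lemma mixed_partial (f : R -> R -> R) r dl : 0 < dl ->
  (forall x mu, Rabs x < dl -> Rabs mu < dl -> ex_diff_n f (S (S r)) x mu) ->
  Derive (fun m => Derive (fun z => f z m) 0) 0 = partial_derive 1 1 f 0 0.
Proof.
  intros Hdl H.
  assert (H0 : Rabs 0 < dl) by (rewrite Rabs_R0; exact Hdl).
  symmetry. change (Derive (fun z => Derive (fun t => f z t) 0) 0 = Derive (fun z => Derive (fun t => f t z) 0) 0).
  apply Schwarz.
  - exists (mkposreal _ Hdl). intros u v Hu Hv. simpl in Hu, Hv. rewrite Rminus_0_r in Hu, Hv.
    destruct (H u v Hu Hv) as (_ & T1 & T2 & (_ & _ & T3 & _) & (_ & T4 & _ & _)).
    repeat split; assumption.
  - destruct (H 0 0 H0 H0) as (_ & _ & _ & _ & (_ & _ & _ & T & _)).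
    destruct r; apply T.
  - destruct (H 0 0 H0 H0) as (_ & _ & _ & (_ & _ & _ & _ & T) & _).
    destruct r; apply T.
Qed.

(** * Expansion along the cycle *)

Lemma rlim_eq (f : R -> R) l m : rlim f l -> l = m -> rlim f m.
Proof. intros H <-. exact H. Qed.

(** A name without a body, which keeps unification from unfolding large expressions. *)
Lemma opaque_copy (f : R -> R) : exists g : R -> R, forall x, g x = f x.
Proof. exists f. reflexivity. Qed.

Lemma rlim_pos f l : rlim f l -> 0 < l -> exists d, 0 < d /\ forall x, 0 < x < d -> 0 < f x.
Proof.
  intros H Hl. rewrite rlim_eps in H. destruct (H l Hl) as [d [Hd H1]].
  exists d. split; [exact Hd|]. intros x Hx. specialize (H1 x Hx). apply Rabs_lt_between in H1. lra.
Qed.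

Ltac rlim_tac := repeat first
  [ eassumption | apply rlim_const | apply rlim_pow | apply rlim_plus | apply rlim_minus
  | apply rlim_opp | apply rlim_mult ].

(** Let q = dl (1 + rho) and p = dl (rho - 1) with rho = tau dl be the points of the cycle.
    Adding and subtracting the relations p = F(q), q = F(p) gives (1 - lam) tau = c2 + dl^2 Y and
    -1 - lam = dl^2 n, and the multiplier m of the cycle satisfies 1 - m + 4 (1 + lam) = dl^4 T.
    Here Y, n and T are polynomials in dl, tau, the Taylor coefficients and the relative Taylor
    remainders e1, ..., e4, so that their limits can be read off. *)
Definition cyc_Y (dl tau rho c2 c3 c4 c5 e1 e2 : R) : R :=
  c2 * tau ^ 2 + c3 * (3 * tau + tau * rho ^ 2) + c4 * (1 + 6 * rho ^ 2 + rho ^ 4)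
  + dl * (c5 * (rho ^ 5 + 10 * rho ^ 3 + 5 * rho) + (e1 * (1 + rho) ^ 5 + e2 * (rho - 1) ^ 5) * / 2).

Definition cyc_n (dl tau rho c2 c3 c4 c5 e1 e2 : R) : R :=
  2 * c2 * tau + c3 * (1 + 3 * rho ^ 2)
  + dl ^ 2 * (4 * c4 * tau * (1 + rho ^ 2) + c5 * (1 + 10 * rho ^ 2 + 5 * rho ^ 4)
              + (e1 * (1 + rho) ^ 5 - e2 * (rho - 1) ^ 5) * / 2).

Definition cyc_sig (dl tau rho c2 c3 c4 c5 e3 e4 : R) : R :=
  4 * c2 * tau + 6 * c3 * (1 + rho ^ 2) + 8 * c4 * dl ^ 2 * tau * (3 + rho ^ 2)
  + dl ^ 2 * (5 * c5 * (2 + 12 * rho ^ 2 + 2 * rho ^ 4) + e3 * (1 + rho) ^ 4 + e4 * (rho - 1) ^ 4).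

Definition cyc_U (tau rho c3 c4 c5 e1 e2 e3 e4 : R) : R :=
  - 12 * c3 * tau ^ 2 - 24 * c4 * tau * (1 + rho ^ 2) + 8 * c4 * tau * (3 + rho ^ 2)
  - 6 * c5 * (1 + 10 * rho ^ 2 + 5 * rho ^ 4) - 3 * (e1 * (1 + rho) ^ 5 - e2 * (rho - 1) ^ 5)
  + 5 * c5 * (2 + 12 * rho ^ 2 + 2 * rho ^ 4) + e3 * (1 + rho) ^ 4 + e4 * (rho - 1) ^ 4.

Definition cyc_xi (dl rho c3 c4 c5 e : R) : R :=
  3 * c3 * rho ^ 2 + 4 * c4 * dl * rho ^ 3 + (5 * c5 + e) * dl ^ 2 * rho ^ 4.

Definition cyc_om (dl tau rho c3 c4 c5 e3 e4 : R) : R :=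
  6 * c3 * tau * (rho ^ 2 - 1) + 4 * c4 * (rho ^ 2 - 1) * (2 + 2 * rho ^ 2)
  + dl * ((5 * c5 + e4) * (1 + rho) * (rho - 1) ^ 4 + (5 * c5 + e3) * (rho - 1) * (1 + rho) ^ 4).

Definition cyc_T (dl tau rho c2 c3 c4 c5 e1 e2 e3 e4 : R) : R :=
  cyc_U tau rho c3 c4 c5 e1 e2 e3 e4
  - (4 * c2 ^ 2 * tau ^ 2 + 2 * c2 * cyc_om dl tau rho c3 c4 c5 e3 e4
     + cyc_xi dl (1 + rho) c3 c4 c5 e3 * cyc_xi dl (rho - 1) c3 c4 c5 e4)
  - 4 * c2 * (cyc_Y dl tau rho c2 c3 c4 c5 e1 e2 - cyc_n dl tau rho c2 c3 c4 c5 e1 e2 * tau)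
  + cyc_n dl tau rho c2 c3 c4 c5 e1 e2 * cyc_sig dl tau rho c2 c3 c4 c5 e3 e4
  - cyc_n dl tau rho c2 c3 c4 c5 e1 e2 ^ 2.

Definition quintic (lam c2 c3 c4 c5 x : R) : R :=
  lam * x + c2 * x ^ 2 + c3 * x ^ 3 + c4 * x ^ 4 + c5 * x ^ 5.
Definition quintic' (lam c2 c3 c4 c5 e x : R) : R :=
  lam + 2 * c2 * x + 3 * c3 * x ^ 2 + 4 * c4 * x ^ 3 + (5 * c5 + e) * x ^ 4.

Lemma cyc_sum_eq dl tau rho lam c2 c3 c4 c5 e1 e2 p q : 0 < dl -> rho = tau * dl ->
  q = dl * (1 + rho) -> p = dl * (rho - 1) ->
  p = quintic lam c2 c3 c4 (c5 + e1) q -> q = quintic lam c2 c3 c4 (c5 + e2) p ->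
  (1 - lam) * tau = c2 + dl ^ 2 * cyc_Y dl tau rho c2 c3 c4 c5 e1 e2.
Proof.
  intros Hdl Er Eq Ep Hp Hq.
  apply (Rmult_eq_reg_l (2 * dl ^ 2)); [|apply Rgt_not_eq; nra].
  assert (E := f_equal2 Rplus Hp Hq). clear Hp Hq.
  apply Rminus_diag_uniq. apply Rminus_diag_eq in E. rewrite <- E. clear E.
  unfold quintic, cyc_Y. rewrite Eq, Ep, Er. field.
Qed.

Lemma cyc_diff_eq dl tau rho lam c2 c3 c4 c5 e1 e2 p q : 0 < dl -> rho = tau * dl ->
  q = dl * (1 + rho) -> p = dl * (rho - 1) ->
  p = quintic lam c2 c3 c4 (c5 + e1) q -> q = quintic lam c2 c3 c4 (c5 + e2) p ->
  -1 - lam = dl ^ 2 * cyc_n dl tau rho c2 c3 c4 c5 e1 e2.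
Proof.
  intros Hdl Er Eq Ep Hp Hq.
  apply (Rmult_eq_reg_l (2 * dl)); [|lra].
  assert (E := f_equal2 Rminus Hp Hq). clear Hp Hq.
  apply Rminus_diag_uniq. apply Rminus_diag_eq in E. rewrite <- E. clear E.
  unfold quintic, cyc_n. rewrite Eq, Ep, Er. field.
Qed.

(** The terms of order dl^2 cancel by the relation for tau. *)
Lemma cyc_mult_eq dl tau rho lam c2 c3 c4 c5 e1 e2 e3 e4 p q : rho = tau * dl ->
  q = dl * (1 + rho) -> p = dl * (rho - 1) ->
  (1 - lam) * tau = c2 + dl ^ 2 * cyc_Y dl tau rho c2 c3 c4 c5 e1 e2 ->
  -1 - lam = dl ^ 2 * cyc_n dl tau rho c2 c3 c4 c5 e1 e2 ->
  1 - quintic' lam c2 c3 c4 c5 e3 q * quintic' lam c2 c3 c4 c5 e4 p - 4 * (-1 - lam)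
  = dl ^ 4 * cyc_T dl tau rho c2 c3 c4 c5 e1 e2 e3 e4.
Proof.
  intros Er Eq Ep E1 E2.
  assert (EB : -6 * cyc_n dl tau rho c2 c3 c4 c5 e1 e2 + cyc_sig dl tau rho c2 c3 c4 c5 e3 e4
     = - 8 * c2 * tau + dl ^ 2 * cyc_U tau rho c3 c4 c5 e1 e2 e3 e4).
  { unfold cyc_n, cyc_sig, cyc_U. rewrite Er. field. }
  set (xi := cyc_xi dl (1 + rho) c3 c4 c5 e3). set (ze := cyc_xi dl (rho - 1) c3 c4 c5 e4).
  set (om := cyc_om dl tau rho c3 c4 c5 e3 e4).
  set (x1 := 2 * c2 * (1 + rho) + dl * xi). set (z1 := 2 * c2 * (rho - 1) + dl * ze).
  assert (EX : quintic' lam c2 c3 c4 c5 e3 q = lam + dl * x1).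
  { unfold quintic', x1, xi, cyc_xi. rewrite Eq. ring. }
  assert (EZ : quintic' lam c2 c3 c4 c5 e4 p = lam + dl * z1).
  { unfold quintic', z1, ze, cyc_xi. rewrite Ep. ring. }
  assert (Exz : x1 + z1 = dl * cyc_sig dl tau rho c2 c3 c4 c5 e3 e4).
  { unfold x1, z1, xi, ze, cyc_xi, cyc_sig. rewrite Er. ring. }
  assert (Eom : (1 + rho) * ze + (rho - 1) * xi = dl * om).
  { unfold xi, ze, om, cyc_xi, cyc_om. rewrite Er. ring. }
  assert (EC : x1 * z1 = - 4 * c2 ^ 2 + dl ^ 2 * (4 * c2 ^ 2 * tau ^ 2 + 2 * c2 * om + xi * ze)).
  { unfold x1, z1.
    replace ((2 * c2 * (1 + rho) + dl * xi) * (2 * c2 * (rho - 1) + dl * ze)) with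
      (4 * c2 ^ 2 * (rho ^ 2 - 1) + 2 * c2 * dl * ((1 + rho) * ze + (rho - 1) * xi) + dl ^ 2 * (xi * ze)) by ring.
    rewrite Eom, Er. ring. }
  unfold cyc_T. fold xi ze om. rewrite EX, EZ.
  set (n := cyc_n dl tau rho c2 c3 c4 c5 e1 e2) in *. set (Y := cyc_Y dl tau rho c2 c3 c4 c5 e1 e2) in *.
  set (sg := cyc_sig dl tau rho c2 c3 c4 c5 e3 e4) in *. set (u := cyc_U tau rho c3 c4 c5 e1 e2 e3 e4) in *.
  clearbody n Y sg u xi ze om x1 z1.
  assert (El : lam = -1 - dl ^ 2 * n) by lra. rewrite El in *. clear El E2.
  assert (ED : 2 * tau - c2 = dl ^ 2 * (Y - n * tau)) by lra.
  replace (1 - (-1 - dl ^ 2 * n + dl * x1) * (-1 - dl ^ 2 * n + dl * z1) - 4 * (-1 - (-1 - dl ^ 2 * n)))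
  with (- 6 * (dl ^ 2 * n) - dl ^ 4 * n ^ 2 + (1 + dl ^ 2 * n) * dl * (x1 + z1) - dl ^ 2 * (x1 * z1)) by ring.
  rewrite Exz, EC.
  replace (-6 * (dl ^ 2 * n) - dl ^ 4 * n ^ 2 + (1 + dl ^ 2 * n) * dl * (dl * sg) -
    dl ^ 2 * (-4 * c2 ^ 2 + dl ^ 2 * (4 * c2 ^ 2 * tau ^ 2 + 2 * c2 * om + xi * ze)))
  with (dl ^ 2 * (-6 * n + sg) + dl ^ 2 * (4 * c2 ^ 2)
    + dl ^ 4 * (n * sg - n ^ 2 - (4 * c2 ^ 2 * tau ^ 2 + 2 * c2 * om + xi * ze))) by ring.
  rewrite EB.
  replace (dl ^ 2 * (-8 * c2 * tau + dl ^ 2 * u) + dl ^ 2 * (4 * c2 ^ 2))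
  with (dl ^ 2 * (- 4 * c2 * (2 * tau - c2)) + dl ^ 4 * u) by ring.
  rewrite ED. ring.
Qed.

(** Let nu = -1 - lam and kh = (1 - sqrt m) / 2, so that s = 2 nu - kh.  From
    4 kh (1 - kh) = 1 - m one gets nu - s = kh - nu = (1 - m - 4 nu + 4 nu^2) / (4 (1 - kh - nu)),
    of order dl^4, whereas s is of order dl^2: the quotient by s^2 has a finite limit. *)
Lemma cycle_parameter_limit (d0 : R) (q p lam c2 c3 c4 c5 e1 e2 e3 e4 m : R -> R) (C2 C3 C4 C5 : R) :
  0 < d0 -> 0 < C2 ^ 2 + C3 ->
  (forall mu, 0 < mu < d0 -> 0 < q mu /\ 0 < m mu /\
    p mu = quintic (lam mu) (c2 mu) (c3 mu) (c4 mu) (c5 mu + e1 mu) (q mu) /\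
    q mu = quintic (lam mu) (c2 mu) (c3 mu) (c4 mu) (c5 mu + e2 mu) (p mu) /\
    m mu = quintic' (lam mu) (c2 mu) (c3 mu) (c4 mu) (c5 mu) (e3 mu) (q mu)
         * quintic' (lam mu) (c2 mu) (c3 mu) (c4 mu) (c5 mu) (e4 mu) (p mu)) ->
  rlim q 0 -> rlim lam (-1) -> rlim c2 C2 -> rlim c3 C3 -> rlim c4 C4 -> rlim c5 C5 ->
  rlim e1 0 -> rlim e2 0 -> rlim e3 0 -> rlim e4 0 ->
  let s := fun mu => 2 * (-1 - lam mu) - (1 - sqrt (m mu)) / 2 in
  (exists d1, 0 < d1 /\ forall mu, 0 < mu < d1 -> 0 < s mu) /\ rlim s 0 /\
  rlim (fun mu => ((-1 - lam mu) - s mu) / s mu ^ 2)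
    ((5 * C2 ^ 4 + 13 * C2 ^ 2 * C3 + 12 * C2 * C4 + 4 * C5) / 4 / (C2 ^ 2 + C3) ^ 2).
Proof.
  intros Hd0 HC H Lq Ll L2 L3 L4 L5 Le1 Le2 Le3 Le4 s.
  (* p / q tends to -1 *)
  destruct (opaque_copy (fun mu => lam mu + c2 mu * q mu + c3 mu * q mu ^ 2 + c4 mu * q mu ^ 3
     + (c5 mu + e1 mu) * q mu ^ 4)) as [k Ek].
  assert (Lk : rlim k (-1)).
  { eapply rlim_eq.
    - eapply (rlim_ext _ k _ 1); [lra|intros x _; symmetry; apply Ek|]. rlim_tac.
    - ring. }
  assert (Epk : forall mu, 0 < mu < d0 -> p mu = q mu * k mu).
  { intros mu Hmu. destruct (H mu Hmu) as (_ & _ & E & _). rewrite E, Ek. unfold quintic. ring. }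
  destruct (opaque_copy (fun mu => (q mu - p mu) / 2)) as [dl Edl].
  destruct (opaque_copy (fun mu => (1 + k mu) * / (1 - k mu))) as [rho Erho].
  destruct (opaque_copy (fun mu => (p mu + q mu) / (2 * dl mu ^ 2))) as [tau Etau].
  destruct (rlim_pos (fun mu => - k mu) 1) as [d1 [Hd1 Hk]].
  { eapply rlim_eq; [rlim_tac|ring]. } { lra. }
  destruct (pos_min2 d0 d1) as (d2 & Hd2 & M1 & M2); [assumption..|].
  assert (B : forall mu, 0 < mu < d2 -> 0 < q mu /\ 0 < dl mu /\ rho mu = tau mu * dl mu /\
     q mu = dl mu * (1 + rho mu) /\ p mu = dl mu * (rho mu - 1)).
  { intros mu Hmu. destruct (H mu ltac:(lra)) as (Hq & _). specialize (Hk mu ltac:(lra)).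
    assert (Ep := Epk mu ltac:(lra)).
    assert (Ed : dl mu = q mu * (1 - k mu) / 2) by (rewrite Edl, Ep; field).
    assert (Hdl : 0 < dl mu) by (rewrite Ed; assert (0 < q mu * (1 - k mu)) by (apply Rmult_lt_0_compat; lra); lra).
    split; [exact Hq|]. split; [exact Hdl|].
    split; [rewrite Erho, Etau, Ep, Ed; field; repeat split; lra|].
    split; [rewrite Erho, Ed; field; lra|rewrite Erho, Ep, Ed; field; lra]. }
  assert (Ldl : rlim dl 0).
  { eapply rlim_eq.
    - eapply (rlim_ext (fun mu => q mu * (1 - k mu) * / 2) dl _ d2); [exact Hd2| |rlim_tac].
      intros mu Hmu. rewrite Edl, (Epk mu) by lra. field.
    - ring. }
  assert (Lrho : rlim rho 0).
  { eapply rlim_eq.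
    - eapply (rlim_ext _ rho _ 1); [lra|intros x _; symmetry; apply Erho|].
      apply rlim_mult; [rlim_tac|]. apply rlim_inv; [rlim_tac|lra].
    - field. }
  destruct (opaque_copy (fun mu => c2 mu * (1 + rho mu ^ 2) + c3 mu * dl mu * (rho mu ^ 3 + 3 * rho mu)
     + c4 mu * dl mu ^ 2 * (1 + 6 * rho mu ^ 2 + rho mu ^ 4)
     + dl mu ^ 3 * (c5 mu * (rho mu ^ 5 + 10 * rho mu ^ 3 + 5 * rho mu)
         + (e1 mu * (1 + rho mu) ^ 5 + e2 mu * (rho mu - 1) ^ 5) * / 2))) as [w Ew].
  assert (Lw : rlim w C2).
  { eapply rlim_eq.
    - eapply (rlim_ext _ w _ 1); [lra|intros x _; symmetry; apply Ew|]. rlim_tac.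
    - ring. }
  destruct (rlim_pos (fun mu => 1 - lam mu) 2) as [d3 [Hd3 Hlam]].
  { eapply rlim_eq; [rlim_tac|ring]. } { lra. }
  destruct (pos_min2 d2 d3) as (d4 & Hd4 & M3 & M4); [assumption..|].
  destruct (opaque_copy (fun mu => cyc_Y (dl mu) (tau mu) (rho mu) (c2 mu) (c3 mu) (c4 mu) (c5 mu) (e1 mu) (e2 mu))) as [Y EY].
  destruct (opaque_copy (fun mu => cyc_n (dl mu) (tau mu) (rho mu) (c2 mu) (c3 mu) (c4 mu) (c5 mu) (e1 mu) (e2 mu))) as [n En].
  destruct (opaque_copy (fun mu => cyc_T (dl mu) (tau mu) (rho mu) (c2 mu) (c3 mu) (c4 mu) (c5 mu) (e1 mu) (e2 mu) (e3 mu) (e4 mu))) as [T ET].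
  assert (Q : forall mu, 0 < mu < d4 -> (1 - lam mu) * tau mu = c2 mu + dl mu ^ 2 * Y mu /\
     -1 - lam mu = dl mu ^ 2 * n mu /\ 1 - m mu - 4 * (-1 - lam mu) = dl mu ^ 4 * T mu).
  { intros mu Hmu. destruct (H mu ltac:(lra)) as (_ & _ & H1 & H2 & H3).
    destruct (B mu ltac:(lra)) as (B1 & B2 & B3 & B4 & B5). rewrite EY, En, ET.
    assert (S1 := cyc_sum_eq _ _ _ _ _ _ _ _ _ _ _ _ B2 B3 B4 B5 H1 H2).
    assert (S2 := cyc_diff_eq _ _ _ _ _ _ _ _ _ _ _ _ B2 B3 B4 B5 H1 H2).
    split; [exact S1|]. split; [exact S2|]. rewrite H3. apply cyc_mult_eq; assumption. }
  assert (Ltau : rlim tau (C2 * / 2)).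
  { eapply rlim_eq.
    - apply (rlim_ext (fun mu => w mu * / (1 - lam mu)) tau _ d4 Hd4).
      + intros mu Hmu. destruct (Q mu Hmu) as (Q1 & _). specialize (Hlam mu ltac:(lra)).
        destruct (B mu ltac:(lra)) as (B1 & B2 & B3 & B4 & B5).
        apply (Rmult_eq_reg_l (1 - lam mu)); [|lra]. rewrite Q1, Ew, EY. unfold cyc_Y. rewrite B3. field. lra.
      + apply rlim_mult; [exact Lw|]. apply rlim_inv; [rlim_tac|lra].
    - field. }
  set (N0 := C2 ^ 2 + C3) in *.
  assert (Ln : rlim n N0).
  { eapply rlim_eq.
    - eapply (rlim_ext _ n _ 1); [lra|intros x _; symmetry; apply En|]. unfold cyc_n. rlim_tac.
    - unfold N0. field. }
  assert (LT : rlim T (C2 ^ 4 + 5 * C2 ^ 2 * C3 + 12 * C2 * C4 + 4 * C5 - 4 * C3 ^ 2)).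
  { eapply rlim_eq.
    - eapply (rlim_ext _ T _ 1); [lra|intros x _; symmetry; apply ET|].
      unfold cyc_T, cyc_U, cyc_om, cyc_xi, cyc_Y, cyc_n, cyc_sig. rlim_tac.
    - field. }
  destruct (opaque_copy (fun mu => (1 - sqrt (m mu)) / 2)) as [kh Ekh].
  assert (Lm : rlim m 1).
  { eapply rlim_eq.
    - apply (rlim_ext (fun mu => 1 - 4 * (dl mu ^ 2 * n mu) - dl mu ^ 4 * T mu) m _ d4 Hd4); [|rlim_tac].
      intros mu Hmu. destruct (Q mu Hmu) as (_ & Q2 & Q3). rewrite <- Q2, <- Q3. ring.
    - ring. }
  assert (Lkh : rlim kh 0).
  { eapply rlim_eq.
    - eapply (rlim_ext (fun mu => (1 - sqrt (m mu)) * / 2) kh _ 1); [lra|intros x _; symmetry; apply Ekh|].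
      apply rlim_mult; [|apply rlim_const]. apply rlim_minus; [apply rlim_const|].
      apply (rlim_comp m sqrt 1 Lm). apply continuity_pt_filterlim, continuity_pt_sqrt. lra.
    - rewrite sqrt_1. ring. }
  destruct (rlim_pos (fun mu => 1 - kh mu - dl mu ^ 2 * n mu) 1) as [d5 [Hd5 Hden]].
  { eapply rlim_eq; [rlim_tac|ring]. } { lra. }
  destruct (pos_min2 d4 d5) as (d6 & Hd6 & M5 & M6); [assumption..|].
  destruct (opaque_copy (fun mu => (T mu + 4 * n mu ^ 2) * / (4 * (1 - kh mu - dl mu ^ 2 * n mu)))) as [G EG].
  set (G0 := (5 * C2 ^ 4 + 13 * C2 ^ 2 * C3 + 12 * C2 * C4 + 4 * C5) / 4).
  assert (LG : rlim G G0).
  { eapply rlim_eq.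
    - eapply (rlim_ext _ G _ 1); [lra|intros x _; symmetry; apply EG|].
      apply rlim_mult; [rlim_tac|]. apply rlim_inv; [rlim_tac|lra].
    - unfold G0, N0. field. }
  assert (R : forall mu, 0 < mu < d6 -> kh mu - (-1 - lam mu) = dl mu ^ 4 * G mu).
  { intros mu Hmu. destruct (Q mu ltac:(lra)) as (_ & Q2 & Q3). specialize (Hden mu ltac:(lra)).
    destruct (H mu ltac:(lra)) as (_ & Hm & _).
    assert (E4 : 4 * kh mu * (1 - kh mu) = 1 - m mu).
    { rewrite Ekh. assert (Es := sqrt_sqrt (m mu) ltac:(lra)).
      replace (4 * ((1 - sqrt (m mu)) / 2) * (1 - (1 - sqrt (m mu)) / 2)) with (1 - sqrt (m mu) * sqrt (m mu)) by field.
      rewrite Es. ring. }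
    rewrite Q2 in *. apply (Rmult_eq_reg_l (4 * (1 - kh mu - dl mu ^ 2 * n mu))); [|lra].
    rewrite EG.
    replace (4 * (1 - kh mu - dl mu ^ 2 * n mu) * (dl mu ^ 4 * ((T mu + 4 * n mu ^ 2) * / (4 * (1 - kh mu - dl mu ^ 2 * n mu)))))
      with (dl mu ^ 4 * T mu + 4 * (dl mu ^ 4 * n mu ^ 2)) by (field; lra).
    rewrite <- Q3, <- E4. ring. }
  assert (Es : forall mu, 0 < mu < d6 -> s mu = dl mu ^ 2 * (n mu - dl mu ^ 2 * G mu)).
  { intros mu Hmu. destruct (Q mu ltac:(lra)) as (_ & Q2 & _). assert (R' := R mu Hmu).
    unfold s. rewrite <- Ekh. replace (dl mu ^ 2 * (n mu - dl mu ^ 2 * G mu)) with (dl mu ^ 2 * n mu - dl mu ^ 4 * G mu) by ring.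
    rewrite <- Q2, <- R'. ring. }
  destruct (rlim_pos (fun mu => n mu - dl mu ^ 2 * G mu) N0) as [d7 [Hd7 Hsn]].
  { eapply rlim_eq; [rlim_tac|ring]. } { exact HC. }
  destruct (pos_min2 d6 d7) as (d8 & Hd8 & M7 & M8); [assumption..|].
  split; [|split].
  - exists d8. split; [exact Hd8|]. intros mu Hmu.
    rewrite Es by lra. apply Rmult_lt_0_compat; [|apply Hsn; lra].
    apply pow_lt. apply B. lra.
  - eapply rlim_eq.
    + eapply (rlim_ext _ s _ d6 Hd6); [intros mu Hmu; symmetry; apply Es, Hmu|]. rlim_tac.
    + ring.
  - eapply rlim_eq.
    + apply (rlim_ext (fun mu => G mu * / (n mu - dl mu ^ 2 * G mu) ^ 2) _ _ d8 Hd8).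
      * intros mu Hmu.
        specialize (Hsn mu ltac:(lra)).
        assert (En2 : (-1 - lam mu) - s mu = dl mu ^ 4 * G mu).
        { rewrite <- R by lra. unfold s. rewrite <- Ekh. ring. }
        rewrite En2, Es by lra. destruct (B mu ltac:(lra)) as (_ & B2 & _). field. split; lra.
      * apply rlim_mult; [exact LG|]. apply rlim_inv; [rlim_tac|]. apply pow_nonzero.
        replace (N0 - 0 ^ 2 * G0) with N0 by ring. lra.
    + unfold Rdiv. f_equal. f_equal. ring.
Qed.

(** * The parameters of the model *)

Lemma locally_pos (k : R -> R) mu : continuous k mu -> 0 < k mu -> locally mu (fun t => 0 < k t).
Proof.
  intros H Hk. destruct (continuous_eps k mu (k mu) H Hk) as [d Hd].
  exists d. intros t Ht. specialize (Hd t Ht). apply Rabs_lt_between in Hd. lra.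
Qed.

Lemma cont2_sq (f : R -> R -> R) x mu : cont2 f x mu -> cont2 f (f x mu) mu ->
  continuous (fun m => f (f x m) m) mu.
Proof. intros H1 H2. apply (cont2_section (fun x m => f (f x m) m)), cont2_comp; assumption. Qed.

(** At the bifurcation value F o F moves [b] towards 0.  By continuity this persists for nearby
    parameters, which places the cycle on the left of [b]. *)
Lemma sq_below (f : R -> R -> R) r d b : flip (S r) d (fun z => f z 0) -> sink d (fun z => f z 0) -> 0 < b < d ->
  (forall x, Rabs x < 2 * d -> cont2 f x 0) ->
  exists e, 0 < e /\ forall mu, Rabs mu < e -> f (f b mu) mu < b.
Proof.
  intros HF HS Hb HC.
  assert (T := flip_in_d r d _ b HF ltac:(lra)). cbv beta in T.
  assert (C : continuous (fun m => b - f (f b m) m) 0).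
  { apply (continuous_minus (fun _ => b) (fun m => f (f b m) m)); [apply continuous_const|].
    apply cont2_sq; apply HC; apply Rabs_lt_between; lra. }
  assert (P : 0 < b - f (f b 0) 0) by (assert (Q := HS b Hb); cbv beta in Q; lra).
  destruct (locally_Rabs _ _ (locally_pos _ 0 C P)) as [e He].
  exists e. split; [apply cond_pos|]. intros mu Hmu.
  assert (Q := He mu). rewrite Rminus_0_r in Q. specialize (Q Hmu). lra.
Qed.

(** The cycle lies between two points at which F (F x) - x has strict opposite signs, and these
    signs persist for nearby parameters. *)
Lemma cycle_continuous (f : R -> R -> R) r d mu1 (q : R -> R) :
  (forall mu, Rabs mu < mu1 -> flip (S r) d (fun z => f z mu)) ->
  (forall mu, 0 < mu < mu1 -> cycle d (fun z => f z mu) (q mu)) ->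
  (forall x mu, Rabs x < 2 * d -> Rabs mu < mu1 -> cont2 f x mu) ->
  forall mu, 0 < mu < mu1 -> continuous q mu.
Proof.
  intros HF HC Hc mu Hmu.
  assert (Hsq : forall x, 0 < x < d -> continuous (fun m => f (f x m) m) mu).
  { intros x Hx. assert (T := flip_in_d r d _ x (HF mu ltac:(rewrite Rabs_pos_eq; lra)) ltac:(lra)).
    cbv beta in T. apply cont2_sq; apply Hc; try (rewrite Rabs_pos_eq; lra). apply Rabs_lt_between; lra. }
  destruct (HC mu Hmu) as (Hq & _ & _ & HB & HA).
  intros P [eps HP].
  assert (He := cond_pos eps).
  destruct (pos_min3 (q mu / 2) ((d - q mu) / 2) (eps / 2)) as (k & Hk & M1 & M2 & M3); [lra..|].
  set (x1 := q mu - k). set (x2 := q mu + k).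
  assert (M5 : x1 = q mu - k) by reflexivity. assert (M6 : x2 = q mu + k) by reflexivity.
  assert (L1 : locally mu (fun t => 0 < f (f x1 t) t - x1)).
  { apply (locally_pos (fun t => f (f x1 t) t - x1)).
    - apply (continuous_minus (fun m => f (f x1 m) m) (fun _ => x1)); [apply Hsq; lra|apply continuous_const].
    - assert (T := HB x1 ltac:(lra)). cbv beta in T. lra. }
  assert (L2 : locally mu (fun t => 0 < x2 - f (f x2 t) t)).
  { apply (locally_pos (fun t => x2 - f (f x2 t) t)).
    - apply (continuous_minus (fun _ => x2) (fun m => f (f x2 m) m)); [apply continuous_const|apply Hsq; lra].
    - assert (T := HA x2 ltac:(lra)). cbv beta in T. lra. }
  assert (L3 := open_itv 0 mu1 mu Hmu).
  unfold filtermap. apply (filter_imp (F := locally mu)) with (2 := filter_and _ _ L3 (filter_and _ _ L1 L2)).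
  intros t (H1 & H2 & H3). unfold itv in H1. apply HP. change (Rabs (q t - q mu) < eps).
  destruct (HC t H1) as (Hqt & Et & _ & HBt & HAt).
  assert (x1 < q t).
  { destruct (Rlt_le_dec x1 (q t)) as [T|[T|T]]; [exact T| |].
    - assert (Q := HAt x1 ltac:(lra)). cbv beta in Q. lra.
    - rewrite <- T, Et in H2. lra. }
  assert (q t < x2).
  { destruct (Rlt_le_dec (q t) x2) as [T|[T|T]]; [exact T| |].
    - assert (Q := HBt x2 ltac:(lra)). cbv beta in Q. lra.
    - rewrite T, Et in H3. lra. }
  apply Rabs_lt_between. lra.
Qed.

Lemma quintic_taylor F dl eta eps : 0 < eta <= dl -> F 0 = 0 -> Cs_on 5 (itv (- dl) dl) F ->
  (forall x, Rabs x < eta -> Rabs (Derive_n F 5 x - Derive_n F 5 0) <= eps) ->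
  forall x, Rabs x < eta ->
    Rabs (F x - quintic (Derive_n F 1 0) (Derive_n F 2 0 / 2) (Derive_n F 3 0 / 6)
                 (Derive_n F 4 0 / 24) (Derive_n F 5 0 / 120) x) <= eps * Rabs x ^ 5 /\
    Rabs (Derive_n F 1 x - quintic' (Derive_n F 1 0) (Derive_n F 2 0 / 2) (Derive_n F 3 0 / 6)
                 (Derive_n F 4 0 / 24) (Derive_n F 5 0 / 120) 0 x) <= eps * Rabs x ^ 4.
Proof.
  intros Heta F0 HC H5.
  set (a1 := Derive_n F 1 0). set (a2 := Derive_n F 2 0). set (a3 := Derive_n F 3 0).
  set (a4 := Derive_n F 4 0). set (a5 := Derive_n F 5 0) in *.
  assert (D : forall k x, (k < 5)%nat -> Rabs x < eta -> is_derive (Derive_n F k) x (Derive_n F (S k) x)).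
  { intros k x Hk Hx. apply (Cs_on_derive_n 5 (itv (- dl) dl)); [exact HC|exact Hk|].
    apply Rabs_lt_between. lra. }
  assert (T4 : forall x, Rabs x < eta -> Rabs (Derive_n F 4 x - (a4 + a5 * x)) <= eps * Rabs x ^ 1).
  { apply (taylor_step (fun x => Derive_n F 4 x - (a4 + a5 * x)) (fun x => Derive_n F 5 x - a5)).
    - unfold a4. ring.
    - intros x Hx. apply (is_derive_minus (Derive_n F 4) (fun x => a4 + a5 * x)); [apply D; [lia|exact Hx]|].
      auto_derive; [exact Logic.I|ring].
    - intros x Hx. simpl. rewrite Rmult_1_r. apply H5, Hx. }
  assert (T3 : forall x, Rabs x < eta -> Rabs (Derive_n F 3 x - (a3 + a4 * x + a5 / 2 * x ^ 2)) <= eps * Rabs x ^ 2).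
  { apply (taylor_step _ (fun x => Derive_n F 4 x - (a4 + a5 * x))); [unfold a3; ring| |exact T4].
    intros x Hx. apply (is_derive_minus (Derive_n F 3) (fun x => a3 + a4 * x + a5 / 2 * x ^ 2)); [apply D; [lia|exact Hx]|].
    auto_derive; [exact Logic.I|field]. }
  assert (T2 : forall x, Rabs x < eta -> Rabs (Derive_n F 2 x - (a2 + a3 * x + a4 / 2 * x ^ 2 + a5 / 6 * x ^ 3)) <= eps * Rabs x ^ 3).
  { apply (taylor_step _ (fun x => Derive_n F 3 x - (a3 + a4 * x + a5 / 2 * x ^ 2))); [unfold a2; ring| |exact T3].
    intros x Hx. apply (is_derive_minus (Derive_n F 2) (fun x => a2 + a3 * x + a4 / 2 * x ^ 2 + a5 / 6 * x ^ 3)); [apply D; [lia|exact Hx]|].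
    auto_derive; [exact Logic.I|field]. }
  assert (T1 : forall x, Rabs x < eta -> Rabs (Derive_n F 1 x - quintic' a1 (a2 / 2) (a3 / 6) (a4 / 24) (a5 / 120) 0 x) <= eps * Rabs x ^ 4).
  { apply (taylor_step _ (fun x => Derive_n F 2 x - (a2 + a3 * x + a4 / 2 * x ^ 2 + a5 / 6 * x ^ 3))); [unfold quintic', a1; ring| |exact T2].
    intros x Hx. apply (is_derive_minus (Derive_n F 1) (quintic' a1 (a2 / 2) (a3 / 6) (a4 / 24) (a5 / 120) 0)); [apply D; [lia|exact Hx]|].
    unfold quintic'. auto_derive; [exact Logic.I|field]. }
  intros x Hx. split; [|apply T1, Hx]. revert x Hx.
  apply (taylor_step (fun x => F x - quintic a1 (a2 / 2) (a3 / 6) (a4 / 24) (a5 / 120) x)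
     (fun x => Derive_n F 1 x - quintic' a1 (a2 / 2) (a3 / 6) (a4 / 24) (a5 / 120) 0 x)); [unfold quintic; rewrite F0; ring| |exact T1].
  intros x Hx. apply (is_derive_minus F (quintic a1 (a2 / 2) (a3 / 6) (a4 / 24) (a5 / 120))); [apply (D 0%nat); [lia|exact Hx]|].
  unfold quintic, quintic'. auto_derive; [exact Logic.I|field].
Qed.

Definition multiplier (f : R -> R -> R) (mu : R) : R := Derive (fun z => f z mu) 0.

Definition cycle_multiplier (f : R -> R -> R) (q : R -> R) (mu : R) : R :=
  Derive (fun z => f z mu) (q mu) * Derive (fun z => f z mu) (f (q mu) mu).

(** The cycle of the odd map g is sqrt s, - sqrt s with s + a s^2 = nu, and its multiplier m
    satisfies sqrt m = 1 - 4 nu + 2 s.  Solving for s and a, with m the multiplier of the cycle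
    of f, gives this formula and the next one. *)
Definition s_of (f : R -> R -> R) (q : R -> R) (mu : R) : R :=
  2 * (-1 - multiplier f mu) - (1 - sqrt (cycle_multiplier f q mu)) / 2.

Definition a_of (f : R -> R -> R) (q : R -> R) (mu : R) : R :=
  if Rlt_dec 0 mu then ((-1 - multiplier f mu) - s_of f q mu) / s_of f q mu ^ 2 else a_zero f.

Lemma remainder_rlim (N D : R -> R) (k : nat) (x : R -> R) d :
  0 < d -> rlim x 0 -> (forall mu, 0 < mu < d -> x mu <> 0) ->
  (forall mu, 0 < mu < d -> D mu = x mu ^ k) ->
  (forall eps, 0 < eps -> exists e, 0 < e /\ forall mu, 0 < mu < e -> Rabs (x mu) < e ->
      Rabs (N mu) <= eps * Rabs (x mu) ^ k) ->
  rlim (fun mu => N mu / D mu) 0.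
Proof.
  intros Hd Lx Hx0 HD HN. apply rlim_eps. intros eps He.
  destruct (HN (eps / 2)) as [e [He0 H1]]; [lra|].
  rewrite rlim_eps in Lx. destruct (Lx e He0) as [e1 [He1 H2]].
  destruct (pos_min3 d e e1 Hd He0 He1) as (m & Hm & M1 & M2 & M3).
  exists m. split; [exact Hm|]. intros mu Hmu.
  specialize (H2 mu ltac:(lra)). rewrite Rminus_0_r in H2. specialize (H1 mu ltac:(lra) H2).
  rewrite Rminus_0_r, HD by lra.
  assert (Hp : 0 < Rabs (x mu) ^ k) by (apply pow_lt, Rabs_pos_lt, Hx0; lra).
  unfold Rdiv. rewrite Rabs_mult, Rabs_inv, <- RPow_abs.
  apply (Rmult_lt_reg_r (Rabs (x mu) ^ k)); [exact Hp|].
  rewrite Rmult_assoc, Rinv_l, Rmult_1_r by lra. nra.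
Qed.

(** Away from 0 the continuity of [a_of] is that of the cycle and of its multiplier; at 0 it is
    the limit given by [cycle_parameter_limit]. *)
Lemma bifurcation_parameters f r dl d mu1 (q : R -> R) :
  0 < dl -> 0 < d -> 2 * d < dl -> 0 < mu1 <= dl ->
  (forall x mu, Rabs x < dl -> Rabs mu < dl -> ex_diff_n f (S (S (S (S (S r))))) x mu) ->
  (forall mu, Rabs mu < mu1 -> flip (S (S (S r))) d (fun z => f z mu)) ->
  (forall mu, 0 < mu < mu1 -> cycle d (fun z => f z mu) (q mu) /\ q mu < d / 4) ->
  rlim q 0 -> dx f 1 = -1 -> 3 * dx f 2 ^ 2 + 2 * dx f 3 > 0 ->
  exists mu2, 0 < mu2 <= mu1 /\ (forall mu, 0 < mu < mu2 -> 0 < s_of f q mu) /\ rlim (s_of f q) 0 /\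
    (forall mu, Rabs mu < mu2 -> continuous (a_of f q) mu).
Proof.
  intros Hdl Hd Hddl Hmu1 Hbox HF HC Lq Hl Hc.
  set (ord := S (S (S (S (S r))))) in *.
  assert (Hcont : forall k, (k <= ord)%nat -> forall x mu, Rabs x < dl -> Rabs mu < dl -> cont2 (dxk f k) x mu).
  { intros k Hk x mu Hx Hmu. apply (ex_diff_n_cont2 _ (ord - k)). apply (ex_diff_n_section f ord dl Hbox k Hk); assumption. }
  assert (HCs := ex_diff_n_Cs f ord dl Hbox).
  assert (Z0 : Rabs 0 < dl) by (rewrite Rabs_R0; exact Hdl).
  assert (Hck : forall k mu, (k <= ord)%nat -> Rabs mu < dl -> continuous (fun mu => dxk f k 0 mu) mu).
  { intros k mu Hk Hmu. apply (cont2_section (dxk f k)). apply Hcont; assumption. }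
  assert (Lck : forall k, (k <= ord)%nat -> rlim (fun mu => dxk f k 0 mu) (dxk f k 0 0)).
  { intros k Hk. apply (rlim_comp (fun mu => mu) (fun mu => dxk f k 0 mu) 0 rlim_id). apply Hck; assumption. }
  set (p := fun mu => f (q mu) mu).
  assert (Hqp : forall mu, 0 < mu < mu1 -> 0 < q mu < d / 4 /\ - (2 * q mu) <= p mu < 0).
  { intros mu Hmu. destruct (HC mu Hmu) as [Cy Q4]. assert (Hq := proj1 Cy).
    assert (T := flip_pos _ d _ (q mu) (HF mu ltac:(rewrite Rabs_pos_eq; lra)) ltac:(lra)). cbv beta in T.
    unfold p. lra. }
  assert (Lp : rlim p 0).
  { apply (rlim_squeeze (fun mu => - (2 * q mu)) p (fun _ => 0) 0 mu1); [lra| | |apply rlim_const].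
    - intros mu Hmu. specialize (Hqp mu Hmu). lra.
    - eapply rlim_eq; [rlim_tac|ring]. }
  assert (Tay : forall eps, 0 < eps -> exists e, 0 < e /\ forall x mu, Rabs x < e -> Rabs mu < e ->
    Rabs (f x mu - quintic (dxk f 1 0 mu) (dxk f 2 0 mu / 2) (dxk f 3 0 mu / 6) (dxk f 4 0 mu / 24) (dxk f 5 0 mu / 120) x) <= eps * Rabs x ^ 5 /\
    Rabs (dxk f 1 x mu - quintic' (dxk f 1 0 mu) (dxk f 2 0 mu / 2) (dxk f 3 0 mu / 6) (dxk f 4 0 mu / 24) (dxk f 5 0 mu / 120) 0 x) <= eps * Rabs x ^ 4).
  { intros eps He.
    destruct (cont2_box (dxk f 5) 0 0 (eps / 2)) as [e1 [He1 B]]; [apply Hcont; try assumption; unfold ord; lia|lra|].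
    destruct (pos_min2 e1 mu1 He1 (proj1 Hmu1)) as (e & He0 & M1 & M2).
    exists e. split; [exact He0|]. intros x mu Hx Hmu.
    apply (quintic_taylor (fun z => f z mu) dl e eps).
    - lra.
    - apply (HF mu). lra.
    - apply (Cs_on_le 5 ord); [unfold ord; lia|]. apply HCs. lra.
    - intros z Hz. change (Rabs (dxk f 5 z mu - dxk f 5 0 mu) <= eps).
      assert (B1 := B z mu). assert (B2 := B 0 mu). rewrite Rminus_diag, Rabs_R0 in B2. rewrite !Rminus_0_r in B1.
      rewrite Rminus_0_r in B2. specialize (B1 ltac:(lra) ltac:(lra)). specialize (B2 ltac:(lra) ltac:(lra)).
      apply Rabs_lt_between in B1. apply Rabs_lt_between in B2. apply Rabs_le_between. lra.
    - exact Hx. }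
  set (Q := fun mu x => quintic (dxk f 1 0 mu) (dxk f 2 0 mu / 2) (dxk f 3 0 mu / 6) (dxk f 4 0 mu / 24) (dxk f 5 0 mu / 120) x) in *.
  set (Q' := fun mu x => quintic' (dxk f 1 0 mu) (dxk f 2 0 mu / 2) (dxk f 3 0 mu / 6) (dxk f 4 0 mu / 24) (dxk f 5 0 mu / 120) 0 x) in *.
  assert (Le : forall x : R -> R, rlim x 0 -> (forall mu, 0 < mu < mu1 -> x mu <> 0) ->
     rlim (fun mu => (f (x mu) mu - Q mu (x mu)) / x mu ^ 5) 0 /\
     rlim (fun mu => (dxk f 1 (x mu) mu - Q' mu (x mu)) / x mu ^ 4) 0).
  { intros x Lx Hx0. split.
    - apply (remainder_rlim (fun mu => f (x mu) mu - Q mu (x mu)) (fun mu => x mu ^ 5) 5 x mu1); try assumption; [lra|reflexivity|].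
      intros eps He. destruct (Tay eps He) as [e [He0 T]]. exists e. split; [exact He0|].
      intros mu Hmu Hx. apply (T (x mu) mu Hx). rewrite Rabs_pos_eq; lra.
    - apply (remainder_rlim (fun mu => dxk f 1 (x mu) mu - Q' mu (x mu)) (fun mu => x mu ^ 4) 4 x mu1); try assumption; [lra|reflexivity|].
      intros eps He. destruct (Tay eps He) as [e [He0 T]]. exists e. split; [exact He0|].
      intros mu Hmu Hx. apply (T (x mu) mu Hx). rewrite Rabs_pos_eq; lra. }
  destruct (Le q Lq) as [Le1 Le3]; [intros mu Hmu; specialize (Hqp mu Hmu); lra|].
  destruct (Le p Lp) as [Le2 Le4]; [intros mu Hmu; specialize (Hqp mu Hmu); lra|].
  destruct (cycle_parameter_limit mu1 q p (multiplier f) (fun mu => dxk f 2 0 mu / 2) (fun mu => dxk f 3 0 mu / 6)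
     (fun mu => dxk f 4 0 mu / 24) (fun mu => dxk f 5 0 mu / 120)
     (fun mu => (f (q mu) mu - Q mu (q mu)) / q mu ^ 5) (fun mu => (f (p mu) mu - Q mu (p mu)) / p mu ^ 5)
     (fun mu => (dxk f 1 (q mu) mu - Q' mu (q mu)) / q mu ^ 4) (fun mu => (dxk f 1 (p mu) mu - Q' mu (p mu)) / p mu ^ 4)
     (cycle_multiplier f q) (dx f 2 / 2) (dx f 3 / 6) (dx f 4 / 24) (dx f 5 / 120))
    as ([d1 [Hd1 Hs]] & Ls & La); try assumption.
  - lra.
  - replace ((dx f 2 / 2) ^ 2 + dx f 3 / 6) with ((3 * dx f 2 ^ 2 + 2 * dx f 3) / 12) by field. lra.
  - intros mu Hmu. destruct (Hqp mu Hmu) as [Hq Hp]. destruct (HC mu Hmu) as [Cy Q4].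
    split; [lra|]. split; [|split; [|split]].
    + apply (flip_multiplier _ d _ (q mu) (HF mu ltac:(rewrite Rabs_pos_eq; lra))). lra.
    + unfold Q, quintic, multiplier. change (dxk f 1 0 mu) with (Derive (fun z => f z mu) 0). unfold p at 1. field. lra.
    + assert (E := proj1 (proj2 Cy)). cbv beta in E. fold (p mu) in E. rewrite E.
      unfold Q, quintic, multiplier. change (dxk f 1 0 mu) with (Derive (fun z => f z mu) 0). field. lra.
    + unfold cycle_multiplier. fold (p mu).
      change (Derive (fun z => f z mu) (q mu)) with (dxk f 1 (q mu) mu).
      change (Derive (fun z => f z mu) (p mu)) with (dxk f 1 (p mu) mu).
      unfold Q', quintic', multiplier. change (dxk f 1 0 mu) with (Derive (fun z => f z mu) 0).
      f_equal; field; lra.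
  - replace (-1) with (dxk f 1 0 0) by exact Hl. apply (Lck 1%nat). unfold ord; lia.
  - apply rlim_mult; [apply (Lck 2%nat); unfold ord; lia|apply rlim_const].
  - apply rlim_mult; [apply (Lck 3%nat); unfold ord; lia|apply rlim_const].
  - apply rlim_mult; [apply (Lck 4%nat); unfold ord; lia|apply rlim_const].
  - apply rlim_mult; [apply (Lck 5%nat); unfold ord; lia|apply rlim_const].
  - destruct (pos_min2 mu1 d1 (proj1 Hmu1) Hd1) as (mu2 & Hmu2 & M1 & M2).
    exists mu2. split; [lra|].
    split; [intros mu Hmu; apply Hs; lra|]. split; [exact Ls|].
    fold (s_of f q) in *.
    assert (La' : rlim (a_of f q) (a_zero f)).
    { eapply rlim_eq; [apply (rlim_ext _ (a_of f q) _ 1 Rlt_0_1) with (2 := La)|].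
      - intros mu Hmu. unfold a_of. destruct (Rlt_dec 0 mu); [reflexivity|lra].
      - unfold a_zero. field. split; [lra|].
        replace ((dx f 2) ^ 2 * 6 + 2 ^ 2 * dx f 3) with (2 * (3 * dx f 2 ^ 2 + 2 * dx f 3)) by ring. lra. }
    intros mu Hmu. destruct (Rtotal_order mu 0) as [T|[T|T]].
    + apply (continuous_ext_on (fun t => t < 0) (fun _ => a_zero f)); [apply open_lt|exact T| |apply continuous_const].
      intros t Ht. unfold a_of. destruct (Rlt_dec 0 t); [lra|reflexivity].
    + subst mu. assert (a0 : a_of f q 0 = a_zero f) by (unfold a_of; destruct (Rlt_dec 0 0); [lra|reflexivity]).
      intros P [eps HP]. rewrite a0 in HP. rewrite rlim_eps in La'.
      destruct (La' eps (cond_pos eps)) as [e [He0 He]].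
      exists (mkposreal _ He0). intros t Ht. assert (Ht' : Rabs (t - 0) < e) by exact Ht.
      rewrite Rminus_0_r in Ht'. apply Rabs_lt_between in Ht'. apply HP. change (Rabs (a_of f q t - a_zero f) < eps).
      destruct (Rlt_dec 0 t) as [T|T]; [apply He; lra|].
      unfold a_of. destruct (Rlt_dec 0 t); [lra|]. rewrite Rminus_diag, Rabs_R0. apply cond_pos.
    + rewrite Rabs_pos_eq in Hmu by lra.
      apply (continuous_ext_on (fun t => 0 < t) (fun mu => ((-1 - multiplier f mu) - s_of f q mu) / s_of f q mu ^ 2));
        [apply open_gt|exact T| |].
      { intros t Ht. unfold a_of. destruct (Rlt_dec 0 t); [reflexivity|lra]. }
      assert (Hm' : Rabs mu < dl) by (rewrite Rabs_pos_eq; lra).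
      assert (Hm'' : Rabs mu < mu1) by (rewrite Rabs_pos_eq; lra).
      assert (Cl : continuous (multiplier f) mu) by (apply (Hck 1%nat); [unfold ord; lia|exact Hm']).
      assert (Cq : continuous q mu).
      { apply (cycle_continuous f (S (S r)) d mu1 q HF); [intros t Ht; apply HC, Ht| |lra].
        intros x t Hx Ht. apply (Hcont 0%nat); [lia|lra|lra]. }
      destruct (Hqp mu ltac:(lra)) as [Hq Hp].
      assert (Hqa : Rabs (q mu) < dl) by (rewrite Rabs_pos_eq; lra).
      assert (Hpa : Rabs (p mu) < dl) by (rewrite Rabs_left; lra).
      assert (Cp : continuous p mu).
      { apply (continuous_comp_2 q (fun m => m) f); [exact Cq|apply continuous_id|].
        apply (Hcont 0%nat); [lia|exact Hqa|exact Hm']. }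
      assert (Cm : continuous (cycle_multiplier f q) mu).
      { apply (continuous_mult (fun mu => dxk f 1 (q mu) mu) (fun mu => dxk f 1 (p mu) mu)).
        - apply (continuous_comp_2 q (fun m => m) (dxk f 1)); [exact Cq|apply continuous_id|].
          apply (Hcont 1%nat); [unfold ord; lia|exact Hqa|exact Hm'].
        - apply (continuous_comp_2 p (fun m => m) (dxk f 1)); [exact Cp|apply continuous_id|].
          apply (Hcont 1%nat); [unfold ord; lia|exact Hpa|exact Hm']. }
      assert (Hmp : 0 < cycle_multiplier f q mu).
      { apply (flip_multiplier _ d _ (q mu) (HF mu Hm'')). lra. }
      assert (Cs : continuous (s_of f q) mu).
      { apply (continuous_minus (fun mu => 2 * (-1 - multiplier f mu)) (fun mu => (1 - sqrt (cycle_multiplier f q mu)) / 2)).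
        - apply (continuous_mult (fun _ => 2) (fun mu => -1 - multiplier f mu)); [apply continuous_const|].
          apply (continuous_minus (fun _ => -1) (multiplier f)); [apply continuous_const|exact Cl].
        - apply (continuous_mult (fun mu => 1 - sqrt (cycle_multiplier f q mu)) (fun _ => / 2)); [|apply continuous_const].
          apply (continuous_minus (fun _ => 1) (fun mu => sqrt (cycle_multiplier f q mu))); [apply continuous_const|].
          apply (continuous_comp (cycle_multiplier f q) sqrt); [exact Cm|].
          apply continuity_pt_filterlim, continuity_pt_sqrt. lra. }
      assert (Hsp : 0 < s_of f q mu) by (apply Hs; lra).
      apply (continuous_mult (fun mu => (-1 - multiplier f mu) - s_of f q mu) (fun mu => / s_of f q mu ^ 2)).
      * apply (continuous_minus (fun mu => -1 - multiplier f mu) (s_of f q)); [|exact Cs].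
        apply (continuous_minus (fun _ => -1) (multiplier f)); [apply continuous_const|exact Cl].
      * apply continuous_Rinv_comp; [|apply pow_nonzero; lra].
        apply (continuous_comp (s_of f q) (fun t => t ^ 2)); [exact Cs|].
        apply (@ex_derive_continuous R_AbsRing R_NormedModule). auto_derive. exact Logic.I.
Qed.

(** * The model family *)

Lemma g_Cs s U nu a : open U -> Cs_on s U (fun y => g y nu a).
Proof.
  intros HU.
  assert (HP : forall n, Cs_on s U (fun y => y ^ n)).
  { induction n as [|n IH]; [exact (Cs_on_const s U 1 HU)|].
    apply (Cs_on_mult s U (fun y => y) (fun y => y ^ n)); [exact HU|apply Cs_on_id, HU|exact IH]. }
  apply (Cs_on_ext s U (fun y => (-1 - nu) * y + (1 * y ^ 3 + a * y ^ 5))); [exact HU|intros; unfold g; ring|].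
  apply (Cs_on_plus s U (fun y => (-1 - nu) * y) (fun y => 1 * y ^ 3 + a * y ^ 5) HU).
  - apply (Cs_on_scal s U (-1 - nu) (fun y => y) HU), Cs_on_id, HU.
  - apply (Cs_on_plus s U (fun y => 1 * y ^ 3) (fun y => a * y ^ 5) HU).
    + apply (Cs_on_scal s U 1 (fun y => y ^ 3) HU), HP.
    + apply (Cs_on_scal s U a (fun y => y ^ 5) HU), HP.
Qed.

Lemma g_derive_1 nu a y : Derive_n (fun y => g y nu a) 1 y = -1 - nu + 3 * y ^ 2 + 5 * a * y ^ 4.
Proof. apply is_derive_unique. unfold g. auto_derive; [exact Logic.I|ring]. Qed.

Lemma g_derive_2 nu a y : Derive_n (fun y => g y nu a) 2 y = 6 * y + 20 * a * y ^ 3.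
Proof.
  change (Derive (Derive_n (fun y => g y nu a) 1) y = 6 * y + 20 * a * y ^ 3).
  rewrite (Derive_ext _ _ y (g_derive_1 nu a)). apply is_derive_unique. auto_derive; [exact Logic.I|ring].
Qed.

Lemma g_derive_3 nu a y : Derive_n (fun y => g y nu a) 3 y = 6 + 60 * a * y ^ 2.
Proof.
  change (Derive (Derive_n (fun y => g y nu a) 2) y = 6 + 60 * a * y ^ 2).
  rewrite (Derive_ext _ _ y (g_derive_2 nu a)). apply is_derive_unique. auto_derive; [exact Logic.I|ring].
Qed.

Lemma cont2_ext (f k : R -> R -> R) x mu : (forall x mu, f x mu = k x mu) -> cont2 f x mu -> cont2 k x mu.
Proof. intros E H. apply (continuous_ext (fun z : R * R => f (fst z) (snd z))); [intros; apply E|exact H]. Qed.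

Ltac cont2_tac := repeat match goal with
  | |- cont2 (fun _ _ => ?c) _ _ => apply cont2_const
  | |- cont2 (fun x _ => x) _ _ => apply cont2_fst
  | |- cont2 (fun _ m => ?k m) _ _ => apply (cont2_snd k); assumption
  | |- cont2 (fun x m => @?f x m + @?k x m) _ _ => apply (cont2_plus f k)
  | |- cont2 (fun x m => @?f x m * @?k x m) _ _ => apply (cont2_mult f k)
  | |- cont2 (fun x m => @?f x m ^ ?n) _ _ => apply (cont2_pow f n)
  end.

Lemma g_cont2 nu a x mu : continuous nu mu -> continuous a mu -> cont2 (fun y m => g y (nu m) (a m)) x mu.
Proof.
  intros Hn Ha.
  apply (cont2_ext (fun y m => -1 * y + -1 * nu m * y + y ^ 3 + a m * y ^ 5)); [intros; unfold g; ring|].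
  cont2_tac.
Qed.

Lemma g_flip_family r nu a : continuous nu 0 -> continuous a 0 -> nu 0 = 0 ->
  flip_family r 1 (fun y m => g y (nu m) (a m)).
Proof.
  intros Hn Ha Hn0. split; [lra|]. split; [intros; unfold g; ring|].
  split; [intros; apply g_Cs, open_itv|]. split.
  - intros k Hk.
    assert (Hk' : (k = 0 \/ k = 1 \/ k = 2 \/ k = 3)%nat) by lia.
    destruct Hk' as [E|[E|[E|E]]]; subst k.
    + apply g_cont2; assumption.
    + apply (cont2_ext (fun y m => -1 + -1 * nu m + 3 * y ^ 2 + 5 * a m * y ^ 4)).
      { intros x m. unfold dxk. rewrite g_derive_1. ring. } cont2_tac.
    + apply (cont2_ext (fun y m => 6 * y + 20 * a m * y ^ 3)).
      { intros x m. unfold dxk. rewrite g_derive_2. ring. } cont2_tac.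
    + apply (cont2_ext (fun y m => 6 + 60 * a m * y ^ 2)).
      { intros x m. unfold dxk. rewrite g_derive_3. ring. } cont2_tac.
  - unfold dxk. rewrite g_derive_1, g_derive_2, g_derive_3, Hn0. split; [ring|lra].
Qed.

(** The map g exchanges sqrt s and - sqrt s, and its cycle is unique. *)
Lemma g_cycle d nu a (s : R) q : cycle d (fun y => g y nu a) q -> 0 < s -> sqrt s < d -> s + a * s ^ 2 = nu ->
  q = sqrt s /\
  Derive (fun y => g y nu a) q * Derive (fun y => g y nu a) (g q nu a) = (-1 - nu + 3 * s + 5 * a * s ^ 2) ^ 2.
Proof.
  intros (Hq & E & _ & HB & HA) Hs Hsd Hn.
  set (t := sqrt s) in *. assert (Ht : 0 < t) by (apply sqrt_lt_R0, Hs).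
  assert (Et : t * t = s) by (apply sqrt_sqrt; lra).
  assert (G1 : g t nu a = - t) by (unfold g; rewrite <- Hn, <- Et; ring).
  assert (G2 : g (- t) nu a = t) by (unfold g; rewrite <- Hn, <- Et; ring).
  assert (Eq : q = t).
  { destruct (Rtotal_order t q) as [T|[T|T]]; [|symmetry; exact T|].
    - assert (Q := HB t ltac:(lra)). cbv beta in Q. rewrite G1, G2 in Q. lra.
    - assert (Q := HA t ltac:(lra)). cbv beta in Q. rewrite G1, G2 in Q. lra. }
  split; [exact Eq|]. rewrite Eq, G1.
  change (Derive_n (fun y => g y nu a) 1 t * Derive_n (fun y => g y nu a) 1 (- t) = (-1 - nu + 3 * s + 5 * a * s ^ 2) ^ 2).
  rewrite !g_derive_1, <- Et. ring.
Qed.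

Lemma Cs_conjugate_iff s (U U' V V' : R -> Prop) F G :
  (forall x, U x <-> U' x) -> (forall x, V x <-> V' x) ->
  Cs_conjugate s U' V' F G -> Cs_conjugate s U V F G.
Proof.
  intros EU EV (h & (k & H1 & H2 & H3 & H4) & H). exists h. split.
  - exists k. split; [|split; [|split]].
    + intros x Hx. destruct (H1 x (proj1 (EU x) Hx)) as [A B]. split; [apply EV, A|exact B].
    + intros y Hy. destruct (H2 y (proj1 (EV y) Hy)) as [A B]. split; [apply EU, A|exact B].
    + apply (Cs_on_subset _ U'); [intros x Hx; apply EU, Hx|exact H3].
    + apply (Cs_on_subset _ V'); [intros x Hx; apply EV, Hx|exact H4].
  - intros x Hx HFx. apply H; apply EU; assumption.
Qed.

Lemma derive_sign k (l : R) : is_derive k 0 l -> k 0 = 0 -> 0 < l ->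
  exists e, 0 < e /\ forall t, Rabs t < e -> (0 < t -> 0 < k t) /\ (t < 0 -> k t < 0).
Proof.
  intros Hd H0 Hl. destruct (is_derive_lin_bound k 0 l (l / 2) Hd ltac:(lra)) as [e He].
  exists e. split; [apply cond_pos|]. intros t Ht. specialize (He t). rewrite Rminus_0_r, H0, Rminus_0_r in He.
  specialize (He ltac:(lra)). apply Rabs_le_between in He. split; intros T.
  - rewrite Rabs_pos_eq in He by lra. nra.
  - rewrite Rabs_left in He by lra. nra.
Qed.

(** [n] is taken slightly to the left of F b, where F n < b because F (F b) < b. *)
Lemma trap_exists (f : R -> R -> R) r d b : flip (S r) d (fun z => f z 0) -> sink d (fun z => f z 0) ->
  0 < b < d / 4 -> (forall x, Rabs x < 2 * d -> cont2 f x 0) ->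
  exists n e, 0 < e /\ forall mu, Rabs mu < e -> trap d (fun z => f z mu) n b.
Proof.
  intros HF HS Hb HC. set (F := fun z => f z 0) in *.
  assert (T := flip_pos _ d F b HF ltac:(lra)). assert (HSb := HS b ltac:(lra)).
  assert (Hc : continuous F (F b)) by (apply (flip_cont _ d F _ HF); lra).
  destruct (continuous_eps F (F b) (b - F (F b)) Hc ltac:(lra)) as [e1 He1]. assert (Hp := cond_pos e1).
  assert (Hd : 0 < d) by apply HF.
  destruct (pos_min2 (e1 / 2) ((F b + d / 2) / 2)) as (k & Hk & N1 & N2); [lra..|].
  set (n := F b - k). assert (En : n = F b - k) by reflexivity.
  assert (HFn : F n < b).
  { assert (Q := He1 n ltac:(apply Rabs_lt_between; lra)). apply Rabs_lt_between in Q. lra. }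
  assert (C1 : continuous (fun m => f b m - n) 0).
  { apply (continuous_minus (fun m => f b m) (fun _ => n)); [|apply continuous_const].
    apply cont2_section, HC, Rabs_lt_between. lra. }
  assert (C2 : continuous (fun m => b - f n m) 0).
  { apply (continuous_minus (fun _ => b) (fun m => f n m)); [apply continuous_const|].
    apply cont2_section, HC, Rabs_lt_between. lra. }
  assert (P1 : 0 < f b 0 - n) by (change (0 < F b - n); lra).
  assert (P2 : 0 < b - f n 0) by (change (0 < b - F n); lra).
  destruct (locally_Rabs _ _ (locally_pos _ 0 C1 P1)) as [e2 He2].
  destruct (locally_Rabs _ _ (locally_pos _ 0 C2 P2)) as [e3 He3].
  destruct (pos_min2 e2 e3 (cond_pos e2) (cond_pos e3)) as (e & He & M1 & M2).
  exists n, e. split; [exact He|]. intros mu Hmu.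
  assert (Q2 := He2 mu). assert (Q3 := He3 mu). rewrite Rminus_0_r in Q2, Q3.
  specialize (Q2 ltac:(lra)). specialize (Q3 ltac:(lra)).
  split; [lra|]. split; [lra|]. split; lra.
Qed.

Lemma attraction_conjugacy s dF F q n b dG G q' y : flip (S (S s)) dF F -> cycle dF F q ->
  trap dF F n b -> flip (S (S s)) dG G -> cycle dG G q' -> q' < y < dG / 4 ->
  Derive F q * Derive F (F q) = Derive G q' * Derive G (G q') ->
  exists v, - (2 * y) < v < - (y / 16) /\
    Cs_conjugate (S (S s)) (basin_attraction2 F (itv n b) q (F q))
      (basin_attraction2 G (itv v y) q' (G q')) F G.
Proof.
  intros HF CF TF HG CG Hy Em.
  destruct (trap_cycle _ dF F n b q HF TF CF) as (Hqb & Hp & Hq4).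
  assert (TF' := TF). destruct TF' as (Hn & Hb & _). assert (Hq' := proj1 CG).
  destruct (attraction_transport s dF F q b dG G q' y HF CF HG CG Em)
    as (h & Hh1 & Hh2 & Hh3 & Hh4 & Hh5); [lra|lra|].
  destruct (side_extension (S s) dF F n b dG G y h HF TF HG) as
    (v & H & Hv & _ & _ & _ & HC & HD & Hi & Hs & Hinj & Hconj & TG); try assumption; [lra|].
  exists v. split; [exact Hv|].
  apply (Cs_conjugate_iff _ _ (punctured n b) _ (punctured v y)).
  - apply (basin_attraction_cycle _ dF F n b q HF TF CF).
  - apply (basin_attraction_cycle _ dG G v y q' HG TG CG).
  - exists H. split.
    + apply Cs_diffeo_onto_image; try assumption; [apply open_punctured|].
      intros x z Hx Hz. apply Hinj; [apply Hx|apply Hz].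
    + intros x Hx _. apply Hconj, Hx.
Qed.

(** * The bifurcation theorem *)

Theorem theorem3p4 (r : nat) (f : R -> R -> R)
  (hr : (7 <= r)%nat)
  (hf : Cr_near_origin r f)
  (hf0 : locally 0 (fun mu => f 0 mu = 0))
  (hfx : dx f 1 = -1)
  (hfxx : 3 * dx f 2 ^ 2 + 2 * dx f 3 > 0)
  (hfxmu : partial_derive 1 1 f 0 0 < 0) :
  exists (N : R -> Prop) (mu0 : R),
    open_nbhd 0 N /\ 0 < mu0 /\
    (forall mu, - mu0 < mu < mu0 ->
       (forall x, N x -> (f x mu = x <-> x = 0)) /\
       (mu < 0 -> stable_fixed_point (fun x => f x mu) 0) /\
       (0 < mu -> unstable_fixed_point (fun x => f x mu) 0) /\
       (0 < mu ->
          exists p q : R,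
            stable_period2 (fun x => f x mu) N p q /\
            forall x, basin_attraction2 (fun x => f x mu) N p q x
                      <-> N x /\ x <> 0)) /\
    exists (M M0 : R -> Prop) (nu a : R -> R),
      open_nbhd 0 M /\ open_nbhd 0 M0 /\
      Cs_on 1 (fun mu => - mu0 < mu < mu0) nu /\
      (forall mu, - mu0 < mu < mu0 -> continuous a mu) /\
      nu 0 = 0 /\
      is_derive nu 0 (- partial_derive 1 1 f 0 0) /\
      a 0 = a_zero f /\
      (* M0 bounds the images V of N from below, uniformly in mu *)
      (forall mu, - mu0 < mu < 0 ->
         exists V : R -> Prop,
           open_nbhd 0 V /\ subset M0 V /\ subset V M /\
           Cs_conjugate (r - 1) N V
             (fun x => f x mu) (fun y => g y (nu mu) (a mu))) /\
      Cs_conjugate 1 N M (fun x => f x 0) (fun y => g y (nu 0) (a 0)) /\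
      (forall mu, 0 < mu < mu0 ->
         unstable_fixed_point (fun y => g y (nu mu) (a mu)) 0 /\
         Cs_conjugate (r - 1)
           (basin_repulsion (fun x => f x mu) N 0)
           (basin_repulsion (fun y => g y (nu mu) (a mu)) M 0)
           (fun x => f x mu) (fun y => g y (nu mu) (a mu)) /\
         exists p q p' q' : R,
           stable_period2 (fun x => f x mu) N p q /\
           stable_period2 (fun y => g y (nu mu) (a mu)) M p' q' /\
           exists V : R -> Prop,
             open_nbhd 0 V /\ subset M0 V /\ subset V M /\
             Cs_conjugate (r - 1)
               (basin_attraction2 (fun x => f x mu) N p q)
               (basin_attraction2 (fun y => g y (nu mu) (a mu)) V p' q')
               (fun x => f x mu) (fun y => g y (nu mu) (a mu))).

Proof.
  destruct r as [|[|[|[|[|[|[|r]]]]]]]; try (exfalso; lia). clear hr.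
  destruct hf as [dl1 hf]. destruct (locally_Rabs _ _ hf0) as [dl2 hf0']. clear hf0.
  destruct (pos_min2 dl1 dl2 (cond_pos dl1) (cond_pos dl2)) as (dl & Hdl & M1 & M2).
  assert (Hbox : forall x mu, Rabs x < dl -> Rabs mu < dl -> ex_diff_n f (S (S (S (S (S (S (S r))))))) x mu).
  { intros x mu Hx Hmu.  apply hf; rewrite Rminus_0_r; lra. }
  assert (H00 : forall mu, Rabs mu < dl -> f 0 mu = 0).
  { intros mu Hmu.  apply hf0'. rewrite Rminus_0_r. lra. }
  clear hf hf0' M1 M2.
  set (ord := S (S (S (S (S (S (S r))))))) in *.
  assert (Z0 : Rabs 0 < dl) by (rewrite Rabs_R0; exact Hdl).
  assert (HCs := ex_diff_n_Cs f ord dl Hbox).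
  assert (Hcont : forall k, (k <= ord)%nat -> forall x mu, Rabs x < dl -> Rabs mu < dl -> cont2 (dxk f k) x mu).
  { intros k Hk x mu Hx Hmu. apply (ex_diff_n_cont2 _ (ord - k)). apply (ex_diff_n_section f ord dl Hbox k Hk); assumption. }
  assert (Fam : flip_family ord dl f).
  { split; [exact Hdl|]. split; [exact H00|]. split; [exact HCs|].
    split; [intros k Hk; apply Hcont; try assumption; unfold ord; lia|]. split; [exact hfx|exact hfxx]. }
  destruct (flip_family_uniform (S (S (S (S r)))) dl f Fam) as (d & mu1 & Hd & Hddl & Hmu1 & HU).
  fold ord in HU.
  assert (HF : forall mu, Rabs mu < mu1 -> flip ord d (fun z => f z mu)) by (intros mu Hmu; apply HU, Hmu).
  assert (Z1 : Rabs 0 < mu1) by (rewrite Rabs_R0; lra).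
  assert (Hl0 : Derive (fun z => f z 0) 0 = -1) by exact hfx.
  assert (HS0 : sink d (fun z => f z 0)) by (apply (HU 0 Z1); lra).
  assert (Hc0 : forall x, Rabs x < 2 * d -> cont2 f x 0).
  { intros x Hx. apply (Hcont 0%nat); [lia|lra|exact Z0]. }
  (* the multiplier crosses -1 with nonzero speed *)
  set (nu := fun mu => -1 - multiplier f mu).
  assert (Hnu : forall mu, Rabs mu < dl ->
    is_derive nu mu (- Derive (multiplier f) mu) /\ continuous (fun mu => - Derive (multiplier f) mu) mu).
  { intros mu Hmu. destruct (multiplier_C1 f (S (S (S (S (S r))))) dl Hbox mu Hmu) as [D1 D2].
    split.
    - replace (- Derive (multiplier f) mu) with (0 - Derive (multiplier f) mu) by ring.
      apply (is_derive_minus (fun _ => -1) (multiplier f)); [apply (is_derive_const (-1) mu)|exact D1].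
    - apply (continuous_opp (fun mu => Derive (multiplier f) mu)). exact D2. }
  assert (Hnu0 : nu 0 = 0) by (unfold nu, multiplier; rewrite Hl0; ring).
  assert (Hnud : is_derive nu 0 (- partial_derive 1 1 f 0 0)).
  { rewrite <- (mixed_partial f (S (S (S (S (S r))))) dl Hdl Hbox). apply Hnu, Z0. }
  destruct (derive_sign nu _ Hnud Hnu0 ltac:(lra)) as [e2 [He2 Hsgn]].
  assert (HF0 := HF 0 Z1).
  destruct (sq_below f _ d (d / 8) HF0 HS0 ltac:(lra) Hc0) as [e1 [He1 Hbel]].
  destruct (pos_min3 mu1 e1 e2) as (mu2 & Hmu2 & A1 & A3 & A4); [lra..|].
  set (q := fun mu => epsilon (inhabits 0) (fun t => cycle d (fun z => f z mu) t)).
  assert (Hq : forall mu, 0 < mu < mu2 -> cycle d (fun z => f z mu) (q mu)).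
  { intros mu Hmu. assert (Hmua : Rabs mu = mu) by (apply Rabs_pos_eq; lra).
    apply (epsilon_spec (inhabits 0) (fun t => cycle d (fun z => f z mu) t)).
    apply (HU mu); [lra| |].
    - assert (T := proj1 (Hsgn mu ltac:(lra)) ltac:(lra)). unfold nu, multiplier in T. lra.
    - exists (d / 8). split; [lra|]. apply Hbel. lra. }
  assert (Hqlt : forall b mu, 0 < mu < mu2 -> 0 < b < d -> f (f b mu) mu < b -> q mu < b).
  { intros b mu Hmu Hb Hfb. assert (Hmua : Rabs mu = mu) by (apply Rabs_pos_eq; lra).
    apply (cycle_lt _ d (fun z => f z mu) (q mu) b (HF mu ltac:(lra)) (Hq mu Hmu) Hb Hfb). }
  assert (Hq8 : forall mu, 0 < mu < mu2 -> q mu < d / 8).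
  { intros mu Hmu. apply Hqlt; [exact Hmu|lra|]. apply Hbel. rewrite Rabs_pos_eq; lra. }
  assert (Lq : rlim q 0).
  { apply rlim_eps. intros eps Heps.
    destruct (pos_min2 (eps / 2) (d / 2)) as (b & B1 & B2 & B3); [lra..|].
    destruct (sq_below f _ d b HF0 HS0 ltac:(lra) Hc0) as [e [He Hbb]].
    destruct (pos_min2 e mu2 He Hmu2) as (m & Hm & M1 & M2).
    exists m. split; [exact Hm|]. intros mu Hmu.
    assert (T := Hqlt b mu ltac:(lra) ltac:(lra) (Hbb mu ltac:(rewrite Rabs_pos_eq; lra))).
    assert (T2 := proj1 (Hq mu ltac:(lra))). rewrite Rminus_0_r, Rabs_pos_eq; lra. }
  destruct (bifurcation_parameters f (S (S r)) dl d mu2 q) as (mu3 & Hmu3 & Hs & Ls & Ha); try assumption.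
  { lra. }
  { intros mu Hmu. assert (T := HF mu ltac:(lra)). destruct T as (t1 & t2 & t3 & t4).
    split; [exact t1|split; [exact t2|split; [|exact t4]]]. apply (Cs_on_le _ ord); [unfold ord; lia|exact t3]. }
  { intros mu Hmu. split; [apply Hq, Hmu|]. assert (T := Hq8 mu Hmu). lra. }
  set (a := a_of f q) in *.
  assert (Ha0 : a 0 = a_zero f).
  { unfold a, a_of. destruct (Rlt_dec 0 0); [lra|reflexivity]. }
  assert (Cnu : continuous nu 0).
  { apply (is_derive_continuous _ _ _ Hnud). }
  assert (Ca : continuous a 0) by (apply Ha; rewrite Rabs_R0; lra).
  set (G := fun y mu => g y (nu mu) (a mu)).
  destruct (flip_family_uniform (S (S (S (S r)))) 1 G (g_flip_family ord nu a Cnu Ca Hnu0))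
    as (dG & muG & HdG & HdG1 & HmuG & HUG).
  fold ord in HUG.
  assert (ZG : Rabs 0 < muG) by (rewrite Rabs_R0; lra).
  assert (HG : forall mu, Rabs mu < muG -> flip ord dG (fun z => G z mu)) by (intros mu Hmu; apply HUG, Hmu).
  assert (HlG : forall mu, Derive (fun z => G z mu) 0 = Derive (fun z => f z mu) 0).
  { intros mu. change (Derive_n (fun y => g y (nu mu) (a mu)) 1 0 = Derive (fun z => f z mu) 0).
    rewrite g_derive_1. unfold nu, multiplier. ring. }
  assert (HSG0 : sink dG (fun z => G z 0)) by (apply (HUG 0 ZG); rewrite HlG; lra).
  assert (HcG : forall x, Rabs x < 2 * dG -> cont2 G x 0) by (intros x _; apply g_cont2; assumption).
  assert (HG0 := HG 0 ZG).
  (* b and y1 must also fit in the domains of the Fatou coordinates of the maps at mu = 0 *)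
  destruct (flip_parabolic (S (S (S r))) d (fun z => f z 0) HF0 Hl0 hfxx) as (d0 & ga & C & Hd0 & PF).
  destruct (flip_parabolic (S (S (S r))) dG (fun z => G z 0) HG0) as (d0' & ga' & C' & Hd0' & PG).
  { rewrite HlG. exact Hl0. }
  { unfold G. rewrite g_derive_2, g_derive_3. lra. }
  destruct (pos_min2 (d / 8) (d0 / 2)) as (b & Hb & Hb1 & Hb2); [lra..|].
  destruct (trap_exists f _ d b HF0 HS0 ltac:(lra) Hc0) as (n & e4 & He4 & HT).
  destruct (pos_min2 (dG / 16) (d0' / 2)) as (y1 & Hy1 & Hy11 & Hy12); [lra..|].
  assert (Ze4 : Rabs 0 < e4) by (rewrite Rabs_R0; lra).
  assert (HlG0 : Derive (fun z => G z 0) 0 = -1) by (rewrite HlG; exact Hl0).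
  destruct (parabolic_conjugacy _ d (fun z => f z 0) n b dG (fun z => G z 0) y1 d0 ga C d0' ga' C'
     HF0 HG0 (HT 0 Ze4) ltac:(lra) Hl0 HlG0 PF PG ltac:(lra) ltac:(lra)) as (v0 & Hv0 & Conj0).
  (* with this factor the images V, contained in (- 2 y2, y2), lie in M: v0 < - y1 / 16 = - 2 y2 *)
  set (y2 := y1 / 32). assert (Hy2 : 0 < y2) by (unfold y2; lra).
  assert (Ey2 : y1 = 32 * y2) by (unfold y2; field).
  destruct (sq_below G _ dG y2 HG0 HSG0 ltac:(lra) HcG) as [e5 [He5 Hbel2]].
  rewrite rlim_eps in Ls.
  destruct (Ls (dG ^ 2) ltac:(apply pow_lt; lra)) as [e6 [He6 Hs6]].
  destruct (pos_min2 mu3 muG) as (mu4 & Hmu4 & B1 & B2); [lra..|].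
  destruct (pos_min4 mu4 e4 e5 e6) as (mu0 & Hmu0 & B3 & B4 & B5 & B6); [lra..|].
  assert (Habs : forall mu, - mu0 < mu < mu0 -> Rabs mu < mu0) by (intros; apply Rabs_lt_between; lra).
  assert (HFm : forall mu, - mu0 < mu < mu0 -> flip ord d (fun z => f z mu)).
  { intros mu Hmu. specialize (Habs mu Hmu). apply HF. lra. }
  assert (HGm : forall mu, - mu0 < mu < mu0 -> flip ord dG (fun z => G z mu)).
  { intros mu Hmu. specialize (Habs mu Hmu). apply HG. lra. }
  assert (HTm : forall mu, - mu0 < mu < mu0 -> trap d (fun z => f z mu) n b).
  { intros mu Hmu. specialize (Habs mu Hmu). apply HT. lra. }
  assert (Hneg : forall mu, - mu0 < mu < 0 -> -1 < Derive (fun z => f z mu) 0).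
  { intros mu Hmu. specialize (Habs mu ltac:(lra)).
    assert (T := proj2 (Hsgn mu ltac:(lra)) ltac:(lra)). unfold nu, multiplier in T. lra. }
  assert (Hpos : forall mu, 0 < mu < mu0 -> Derive (fun z => f z mu) 0 < -1).
  { intros mu Hmu. specialize (Habs mu ltac:(lra)).
    assert (T := proj1 (Hsgn mu ltac:(lra)) ltac:(lra)). unfold nu, multiplier in T. lra. }
  assert (Hsink : forall mu, - mu0 < mu < 0 -> sink d (fun z => f z mu) /\ sink dG (fun z => G z mu)).
  { intros mu Hmu. assert (T := Hneg mu Hmu). specialize (Habs mu ltac:(lra)). split.
    - apply (HU mu); lra.
    - apply (HUG mu); [lra|]. rewrite HlG. lra. }
  (* sqrt s lies in (0, dG), so it is the cycle of the model found by continuity, and s, a were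
     chosen to give it the multiplier of the cycle of f *)
  assert (HqG : forall mu, 0 < mu < mu0 -> exists q', cycle dG (fun z => G z mu) q' /\ q' < y2 /\
     Derive (fun z => f z mu) (q mu) * Derive (fun z => f z mu) (f (q mu) mu) =
     Derive (fun z => G z mu) q' * Derive (fun z => G z mu) (G q' mu)).
  { intros mu Hmu. assert (T := Hpos mu Hmu). assert (Hm := Habs mu ltac:(lra)).
    assert (Hbm : G (G y2 mu) mu < y2) by (apply Hbel2; lra).
    destruct (HUG mu ltac:(lra)) as (HGf & _ & HGc).
    destruct HGc as [q' Cq']; [rewrite HlG; lra|exists y2; split; [lra|exact Hbm]|].
    exists q'. split; [exact Cq'|].
    split; [apply (cycle_lt _ dG (fun z => G z mu) q' y2 HGf Cq'); [lra|exact Hbm]|].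
    assert (Hsp := Hs mu ltac:(lra)). set (s := s_of f q mu) in *.
    assert (Hs7 := Hs6 mu ltac:(lra)). fold s in Hs7. rewrite Rminus_0_r, Rabs_pos_eq in Hs7 by lra.
    assert (Hsq : sqrt s < dG).
    { rewrite <- (sqrt_pow2 dG) by lra. apply sqrt_lt_1; [lra|apply pow_le; lra|exact Hs7]. }
    assert (Ea : a mu = (nu mu - s) / s ^ 2).
    { unfold a, a_of. destruct (Rlt_dec 0 mu); [reflexivity|lra]. }
    assert (Es : s + a mu * s ^ 2 = nu mu) by (rewrite Ea; field; lra).
    destruct (g_cycle dG (nu mu) (a mu) s q' Cq' Hsp Hsq Es) as [_ Em].
    change (Derive (fun z => f z mu) (q mu) * Derive (fun z => f z mu) (f (q mu) mu)
      = Derive (fun y => g y (nu mu) (a mu)) q' * Derive (fun y => g y (nu mu) (a mu)) (g q' (nu mu) (a mu))).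
    rewrite Em. fold (cycle_multiplier f q mu).
    assert (Hcm : 0 < cycle_multiplier f q mu).
    { assert (T2 := Hq8 mu ltac:(lra)). assert (T3 := proj1 (Hq mu ltac:(lra))).
      apply (flip_multiplier _ d (fun z => f z mu) (q mu) (HFm mu ltac:(lra))). lra. }
    replace (-1 - nu mu + 3 * s + 5 * a mu * s ^ 2) with (- sqrt (cycle_multiplier f q mu)).
    - replace ((- sqrt (cycle_multiplier f q mu)) ^ 2) with (sqrt (cycle_multiplier f q mu) * sqrt (cycle_multiplier f q mu)) by ring.
      symmetry. apply sqrt_sqrt. lra.
    - replace (5 * a mu * s ^ 2) with (5 * (nu mu - s)) by (rewrite <- Es; ring).
      assert (Ess : s = 2 * nu mu - (1 - sqrt (cycle_multiplier f q mu)) / 2) by reflexivity.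
      rewrite Ess. field. }
  assert (Hn : - (d / 2) < n < 0) by apply (HT 0 Ze4).
  exists (itv n b), mu0.
  split; [split; [apply open_itv|unfold itv; lra]|]. split; [exact Hmu0|]. split.
  - intros mu Hmu. assert (HFmu := HFm mu Hmu). split; [|split; [|split]].
    + intros x Hx. unfold itv in Hx. apply (flip_only_fixed _ d (fun z => f z mu) x HFmu). lra.
    + intros Hn'. apply (sink_stable _ d _ HFmu). apply Hsink. lra.
    + intros Hp. apply (cycle_unstable _ d _ (q mu) HFmu). apply Hq. lra.
    + intros Hp. assert (Cq := Hq mu ltac:(lra)).
      destruct (trap_cycle _ d _ n b (q mu) HFmu (HTm mu Hmu) Cq) as (T1 & T2 & T3).
      assert (T4 := proj1 Cq).
      exists (q mu), (f (q mu) mu). split.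
      * apply (cycle_stable2 _ d (fun z => f z mu) (q mu) (itv n b) HFmu Cq T3); unfold itv; lra.
      * apply (basin_attraction_cycle _ d (fun z => f z mu) n b (q mu) HFmu (HTm mu Hmu) Cq).
  - exists (itv v0 y1), (itv (- (y2 / 16)) (y2 / 16)), nu, a.
    split; [split; [apply open_itv|unfold itv; lra]|].
    split; [split; [apply open_itv|unfold itv; lra]|].
    split; [|split; [|split; [|split; [|split; [|split; [|split]]]]]].
    + apply (Cs_on_intro 0 (itv (- mu0) mu0) nu (fun mu => - Derive (multiplier f) mu)); [apply open_itv| |].
      * intros mu Hmu. apply Hnu. specialize (Habs mu Hmu). lra.
      * rewrite Cs_on_0. intros mu Hmu. apply Hnu. specialize (Habs mu Hmu). lra.
    + intros mu Hmu. apply Ha. specialize (Habs mu Hmu). lra.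
    + exact Hnu0.
    + exact Hnud.
    + exact Ha0.
    + intros mu Hmu. destruct (Hsink mu Hmu) as [S1 S2].
      destruct (sink_conjugacy (S (S (S (S (S r))))) d (fun z => f z mu) n b dG (fun z => G z mu) y2)
        as (v & Hv & Cj); try assumption.
      * apply HFm. lra.
      * apply HGm. lra.
      * symmetry. apply HlG.
      * apply Hneg, Hmu.
      * apply HTm. lra.
      * lra.
      * exists (itv v y2). split; [split; [apply open_itv|unfold itv; lra]|].
        split; [intros x Hx; unfold itv in *; lra|]. split; [intros x Hx; unfold itv in *; lra|].
        apply (Cs_conjugate_le _ ord); [unfold ord; lia|exact Cj].
    + exact Conj0.
    + intros mu Hmu. assert (HFmu := HFm mu ltac:(lra)). assert (HGmu := HGm mu ltac:(lra)).
      assert (HTmu := HTm mu ltac:(lra)). assert (Cq := Hq mu ltac:(lra)).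
      destruct (HqG mu Hmu) as (q' & Cq' & Hq'y & Em).
      destruct (trap_cycle _ d _ n b (q mu) HFmu HTmu Cq) as (T1 & T2 & T3).
      assert (T4 := proj1 Cq). assert (T4' := proj1 Cq').
      assert (Hp' := flip_pos _ dG _ q' HGmu ltac:(lra)). cbv beta in Hp'.
      split; [apply (cycle_unstable _ dG _ q' HGmu Cq')|]. split.
      * apply (Cs_conjugate_iff _ _ (itv (f (q mu) mu) (q mu)) _ (itv (G q' mu) q')).
        -- apply (basin_repulsion_cycle _ d (fun z => f z mu) (q mu) (itv n b) HFmu Cq T3); unfold itv; intros; lra.
        -- apply (basin_repulsion_cycle _ dG (fun z => G z mu) q' (itv v0 y1) HGmu Cq'); unfold itv; intros; lra.
        -- apply (Cs_conjugate_le _ ord); [unfold ord; lia|].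
           apply (repulsion_conjugacy _ d (fun z => f z mu) (q mu) dG (fun z => G z mu) q'); try assumption; try lra.
           ++ symmetry. apply HlG.
           ++ apply Hpos, Hmu.
      * exists (q mu), (f (q mu) mu), q', (G q' mu).
        split; [apply (cycle_stable2 _ d (fun z => f z mu) (q mu) (itv n b) HFmu Cq T3); unfold itv; lra|].
        split; [apply (cycle_stable2 _ dG (fun z => G z mu) q' (itv v0 y1) HGmu Cq'); unfold itv; lra|].
        destruct (attraction_conjugacy (S (S (S (S (S r))))) d (fun z => f z mu) (q mu) n b dG (fun z => G z mu) q' y2
          HFmu Cq HTmu HGmu Cq' ltac:(lra) Em) as (v & Hv & Cj).
        exists (itv v y2). split; [split; [apply open_itv|unfold itv; lra]|].
        split; [intros x Hx; unfold itv in *; lra|]. split; [intros x Hx; unfold itv in *; lra|].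
        apply (Cs_conjugate_le _ ord); [unfold ord; lia|exact Cj].
Qed.
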